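(* Let $d\ge1$, let $\varphi:[0,\infty)\to[0,\infty)$ be locally integrable, and let $(Z^i_t)_{i\in\mathbb Z^d,t\ge0}$ be the impulsion Hawkes process on $\mathbb Z^d$ with excitation function $\varphi$ (defined in the context). 1. The process $Z_t=\sum_{i\in\mathbb Z^d}Z^i_t$ is a scalar impulsion Hawkes process with excitation function $\varphi$. In other words, $(Z_t)_{t\ge0}$ is a counting process with compensator $A_t=\int_0^t\lambda_s\,ds$, where $$\lambda_t=\varphi(t)+\int_0^{t-}\varphi(t-s)\,dZ_s.$$ 2. Introduce the extinction event $\Omega_e=\{\lim_{t\to\infty}\sum_{i\in\mathbb Z^d}Z^i_t<\infty\}$ and set $\Lambda=\int_0^\infty\varphi(s)\,ds$. Then (i) $\Pr(\Omega_e)=0$ if $\Lambda=\infty$; (ii) $\Pr(\Omega_e)=\exp(-\gamma_\Lambda\Lambda)$ if $\Lambda\in(1,\infty)$, where $\gamma_\Lambda\in(0,1)$ is characterised by $\gamma_\Lambda\Lambda+\log(1-\gamma_\Lambda)=0$; (iii) $\Pr(\Omega_e)=1$ if $\Lambda\in(0,1]$.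
   Context: A counting process is a non-decreasing, càdlàg, integer-valued (finite for all times) process with all its jumps of height $1$. The compensator of an adapted counting process $X$ is the unique non-decreasing predictable process $A$ such that $X-A$ is a local martingale. $\mathbb Z^d$ is endowed with the set of edges $\mathcal E=\{(i,j)\in(\mathbb Z^d)^2:|i-j|=0\text{ or }1\}$, $|\cdot|$ being the Euclidean norm; $\sum_{j\to i}$ denotes summation over $\{j:(j,i)\in\mathcal E\}$. Given a family $(\pi^i(ds\,dz))_{i\in\mathbb Z^d}$ of i.i.d. $(\mathcal F_t)_{t\ge0}$-Poisson measures on $[0,\infty)\times[0,\infty)$ with intensity measure $ds\,dz$, the impulsion Hawkes process with excitation function $\varphi$ is the pathwise unique family $(Z^i_t)_{i\in\mathbb Z^d,t\ge0}$ of $(\mathcal F_t)_{t\ge0}$-adapted counting processes such that $\sum_{i\in\mathbb Z^d}\mathbb E[Z^i_t]<\infty$ for all $t\ge0$ and, for all $i\in\mathbb Z^d$, $t\ge 0$, $$Z^i_t=\int_0^t\int_0^\infty\mathbf 1_{\{z\le\sum_{j\to i}(2d+1)^{-1}[\int_0^{s-}\varphi(s-u)\,dZ^j_u+\varphi(s)\mathbf 1_{\{j=0\}}]\}}\,\pi^i(ds\,dz).$$ *)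

(* Defs.v *)
From HB Require Import structures.
From mathcomp Require Import all_boot all_order all_algebra.
From mathcomp Require Import all_classical all_reals all_analysis.
From mathcomp Require Import measurable_realfun.

Set Implicit Arguments.
Unset Strict Implicit.
Unset Printing Implicit Defensive.

Import Order.TTheory GRing.Theory Num.Theory.
Import numFieldTopology.Exports numFieldNormedType.Exports.

Local Open Scope classical_set_scope.
Local Open Scope ring_scope.

(** Conventions.  Time is the half-line [0, +oo[ of [R]: a process is a function
    [X : R -> Omega -> R] whose values at negative times are never used.
    Path properties and identities between processes are required almost surely
    (simultaneously for all times), and no completeness or right-continuity is
    imposed on the filtration. *)

Section paths.
Context {R : realType}.
Implicit Types x : R -> R.

Definition cadlag x :=
  (forall t : R, 0 <= t -> x r @[r --> t^'+] --> x t) /\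
  (forall t : R, 0 < t -> cvg (x r @[r --> t^'-])).

Definition counting_path x :=
  [/\ forall t : R, 0 <= t -> exists n : nat, x t = n%:R,
      forall s t : R, 0 <= s -> s <= t -> x s <= x t,
      cadlag x
    & forall t : R, 0 < t -> x t - lim (x r @[r --> t^'-]) != 0 ->
        x t - lim (x r @[r --> t^'-]) = 1].

(** A path on [0, +oo[ is extended to [R] by its value at 0, so that the
    measure [dx] gives no mass to ]-oo, 0]. *)
Definition extend_path x : R -> R := fun t => x (Num.max 0 t).

Section cumulative_path.
Variable x : R -> R.
Hypothesis xcum : nondecreasing (extend_path x) /\
                  right_continuous (extend_path x).
Definition cumul_path : R -> R := extend_path x.
HB.instance Definition _ :=
  isCumulative.Build R _ R cumul_path (proj1 xcum) (proj2 xcum).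
Definition cumul_path_measure : {measure set (measurableTypeR R) -> \bar R} :=
  lebesgue_stieltjes_measure cumul_path.
End cumulative_path.

(** The Lebesgue-Stieltjes measure [dx] on ]0, +oo[ of a nondecreasing
    right-continuous path (and, by convention, the zero measure if the path is
    not of this kind). *)
Definition path_measure x : {measure set (measurableTypeR R) -> \bar R} :=
  match pselect (nondecreasing (extend_path x) /\
                 right_continuous (extend_path x)) with
  | left h => cumul_path_measure h
  | right _ => mzero
  end.

End paths.

Section probability.
Context {R : realType} {dO : measure_display} {Omega : measurableType dO}.
Variable P : probability Omega R.

(** [E] is an event of the [P]-completion, of probability [p]. *)
Definition has_prob (E : set Omega) (p : \bar R) :=
  exists E' : set Omega, [/\ measurable E', P E' = p &
    P.-negligible ((E `\` E') `|` (E' `\` E))].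

Definition independent_systems (I : eqType) (C : I -> set (set Omega)) :=
  forall (J : seq I) (A : I -> set Omega), uniq J ->
    (forall i, i \in J -> C i (A i)) ->
    P (\bigcap_(i in [set i | i \in J]) A i) = (\prod_(i <- J) P (A i))%E.

Definition measurable_wrt (G : set (set Omega)) d' (T : measurableType d')
  (f : Omega -> T) := forall Y : set T, measurable Y -> G (f @^-1` Y).

Variable F : R -> set (set Omega).

Definition filtration :=
  [/\ forall t : R, 0 <= t -> sigma_algebra setT (F t),
      forall t : R, 0 <= t -> F t `<=` measurable
    & forall s t : R, 0 <= s -> s <= t -> F s `<=` F t].

Definition adapted (X : R -> Omega -> R) :=
  forall t : R, 0 <= t -> measurable_wrt (F t) (X t).

Definition predictable_sigma : set (set (Omega * R)) :=
  <<s [set: Omega] `*` `[0, +oo[,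
      [set B | (exists A : set Omega, F 0 A /\ B = A `*` [set 0]) \/
               (exists (s t : R) (A : set Omega), [/\ 0 <= s, s < t, F s A & B = A `*` (`]s, t]%classic) ])] >>.

Definition predictable (X : R -> Omega -> R) :=
  forall Y : set R, measurable Y ->
    predictable_sigma [set p : Omega * R | 0 <= p.2 /\ Y (X p.2 p.1)].

Definition stopping_time (T : Omega -> \bar R) :=
  (forall w, (0 <= T w)%E) /\
  (forall t : R, 0 <= t -> F t [set w | (T w <= t%:E)%E]).

Definition stopped (X : R -> Omega -> R) (T : Omega -> \bar R) :
  R -> Omega -> R := fun t w => X (fine (Order.min t%:E (T w))) w.

(** The last clause says that the conditional expectation of [M t] given [F s]
    is [M s]. *)
Definition martingale (M : R -> Omega -> R) :=
  [/\ adapted M,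
      {ae P, forall w, cadlag (M ^~ w)},
      forall t : R, 0 <= t -> P.-integrable setT (EFin \o M t)
    & forall s t : R, 0 <= s -> s <= t -> forall A, F s A ->
        (\int[P]_(w in A) (M t w)%:E = \int[P]_(w in A) (M s w)%:E)%E].

Definition local_martingale (M : R -> Omega -> R) :=
  [/\ adapted M,
      {ae P, forall w, cadlag (M ^~ w)}
    & exists T : nat -> Omega -> \bar R,
      [/\ forall n, stopping_time (T n),
          {ae P, forall w, (forall n, (T n w <= T n.+1 w)%E) /\
                           T n w @[n --> \oo] --> +oo%E}
        & forall n, martingale (stopped M (T n))]].

Definition counting_process (X : R -> Omega -> R) :=
  adapted X /\ {ae P, forall w, counting_path (X ^~ w)}.

(** The compensator is unique up to indistinguishability, so [A] is only asked
    to be indistinguishable from a predictable process; [A] being extended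
    valued, this also says that almost surely [A] is finite at all times. *)
Definition is_compensator (X : R -> Omega -> R) (A : R -> Omega -> \bar R) :=
  exists A' : R -> Omega -> R,
    [/\ predictable A',
        {ae P, forall w, [/\ A' 0 w = 0,
           forall s t : R, 0 <= s -> s <= t -> A' s w <= A' t w
         & cadlag (A' ^~ w)]},
        local_martingale (fun t w => X t w - A' t w)
      & {ae P, forall w, forall t : R, 0 <= t -> A t w = (A' t w)%:E}].

Definition quadrant : set (R * R) := `[0, +oo[ `*` `[0, +oo[.

(** Sigma-algebra generated by the restriction of a random measure to [D]. *)
Definition sigma_random_measure (pi : R.-ker Omega ~> (R * R)%type) (D : set (R * R))
  : set (set Omega) :=
  <<s [set A | exists (B : set (R * R)) (Y : set (\bar R)), [/\ measurable B, B `<=` D, measurable Y &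
                           A = (fun w => pi w B) @^-1` Y]] >>.

(** Poisson random measure on the quadrant with intensity [ds dz].  In
    [poisson_prob r 0] the argument [0] is a dummy; [poisson_prob 0 0] is the
    Dirac mass at 0. *)
Definition poisson_measure (pi : R.-ker Omega ~> (R * R)%type) :=
  let nu := (lebesgue_measure \x lebesgue_measure)%E in
  (forall B : set (R * R), measurable B -> B `<=` quadrant -> (nu B < +oo)%E ->
     forall k : nat, P [set w | pi w B = (k%:R)%:E] =
                     poisson_prob (fine (nu B)) 0%N [set k]) /\
  (forall (n : nat) (B : 'I_n -> set (R * R)),
     (forall k, measurable (B k)) -> (forall k, B k `<=` quadrant) ->
     trivIset setT B ->
     independent_systems (fun k => sigma_random_measure pi (B k))).

Definition filtered_poisson_measure (pi : R.-ker Omega ~> (R * R)%type) :=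
  [/\ poisson_measure pi,
      forall t : R, 0 <= t -> sigma_random_measure pi (`[0, t] `*` `[0, +oo[) `<=` F t
    & forall t : R, 0 <= t -> forall A B, F t A ->
        sigma_random_measure pi (`]t, +oo[ `*` `[0, +oo[) B ->
        P (A `&` B) = (P A * P B)%E].

(** The common law of the [pi i] is prescribed by the common intensity. *)
Definition iid_poisson_measures (I : eqType) (pi : I -> R.-ker Omega ~> (R * R)%type) :=
  (forall i, filtered_poisson_measure (pi i)) /\
  independent_systems (fun i => sigma_random_measure (pi i) quadrant).

End probability.

Section hawkes.
Context {R : realType} {dO : measure_display} {Omega : measurableType dO}.
Variables (P : probability Omega R) (F : R -> set (set Omega)) (phi : R -> R).

(** The integral of [phi (t - s)] against [dX s] over s in ]0, t[. *)
Definition past_excitation (X : R -> Omega -> R) (t : R) (w : Omega) : \bar R :=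
  (\int[path_measure (X ^~ w)]_(s in `]0%R, t[) (phi (t - s))%:E)%E.

Definition scalar_intensity (X : R -> Omega -> R) (t : R) (w : Omega) : \bar R :=
  ((phi t)%:E + past_excitation X t w)%E.

Definition scalar_impulsion_hawkes (X : R -> Omega -> R) :=
  counting_process P F X /\
  is_compensator P F X (fun t w =>
    (\int[lebesgue_measure]_(s in `[0%R, t]) scalar_intensity X s w)%E).

Section lattice.
Variable d : nat.
Local Notation Zd := 'rV[int]_d.

Definition euclidean_dist (i j : Zd) : R :=
  Num.sqrt (\sum_(k < d) ((i ord0 k - j ord0 k)%:~R) ^+ 2).

Definition edge (i j : Zd) : bool :=
  (euclidean_dist i j == 0) || (euclidean_dist i j == 1).

Definition intensity (Z : Zd -> R -> Omega -> R) (i : Zd) (s : R) (w : Omega)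
  : \bar R :=
  (\esum_(j in [set j | edge j i])
     (((2 * d + 1)%:R)^-1)%:E *
     (past_excitation (Z j) s w + (phi s * (j == 0)%:R)%:E))%E.

Definition impulsion_hawkes (pi : Zd -> R.-ker Omega ~> (R * R)%type)
  (Z : Zd -> R -> Omega -> R) :=
  [/\ forall i, counting_process P F (Z i),
      forall t : R, 0 <= t -> (\esum_(i in [set: Zd]) 'E_P[Z i t] < +oo)%E
    & forall i, {ae P, forall w, forall t : R, 0 <= t ->
        (Z i t w)%:E =
        (\int[pi i w]_(p in `[0%R, t] `*` `[0%R, +oo[)
           (\1_[set q : R * R | (q.2%:E <= intensity Z i q.1 w)%E] p)%:E)%E}].

Definition total_process (Z : Zd -> R -> Omega -> R) (t : R) (w : Omega) : \bar R :=
  (\esum_(i in [set: Zd]) (Z i t w)%:E)%E.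

Definition extinction (Z : Zd -> R -> Omega -> R) : set Omega :=
  [set w | (lim (total_process Z t w @[t --> +oo%R]) < +oo)%E].

End lattice.
End hawkes.

(* Main.v *)
(** Summing over [i] the intensities of the [Z^i], the weights [1/(2d+1)] given
    to the [2d+1] neighbours of a site add up to 1, so that the total intensity
    is the one of the scalar process.  Each [Z^i] has the predicted compensator
    because the Poisson measure and its intensity have the same integral against
    predictable marked sets (uniqueness of measures on a pi-system), and almost
    surely no two [Z^i] jump simultaneously, so the sum [X] is a counting process
    with jumps of height 1.

    For the extinction, let [Phi] be the primitive of [phi] and
    [A_t = Phi(t) + \sum_{a jump of X} Phi(t - a)] the compensator of [X]; thus
    [A_t <= Lambda (1 + X_t)] and [Phi(t) <= A_t].

    If [Lambda = +oo], comparing [1_{X_t < N} (Phi(t) + N - X_t)] with its value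
    at 0 gives [P (X_t < N) Phi(t) <= N], so [X] is almost surely unbounded.

    If [Lambda < +oo], then for [c] in ]0, 1[ with
    [c Lambda + ln (1 - c) < 0] the process [(1 - c)^(X_t) e^(c A_t)] is a
    bounded martingale of mean 1.  It tends to 0 where [X] is unbounded and to
    [exp (c Lambda + (c Lambda + ln (1 - c)) X_oo)] elsewhere.  Letting [c]
    decrease to the root [gamma] of [c Lambda + ln (1 - c)] ([gamma = 0] when
    [Lambda <= 1]) gives [P (extinction) e^(gamma Lambda) = 1]. *)
Require Import Defs.
From HB Require Import structures.
From mathcomp Require Import all_boot all_order all_algebra.
From mathcomp Require Import all_classical all_reals all_analysis.
From mathcomp Require Import unstable measurable_realfun ring lra.

Set Implicit Arguments.
Unset Strict Implicit.
Unset Printing Implicit Defensive.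

Import Order.TTheory GRing.Theory Num.Theory.
Import numFieldTopology.Exports numFieldNormedType.Exports.

Local Open Scope classical_set_scope.
Local Open Scope ring_scope.

(** * The measure [dx] of a counting path as a finite sum of Dirac masses *)

Section jump_list.
Context {R : realType}.
Implicit Types (x : R -> R) (l : seq R) (T t : R).

(** Adaptedness is required at every [w], path properties only almost surely, and the filtration is
    not assumed complete, so null sets cannot be discarded when checking measurability. Each process
    that must be adapted or predictable is therefore given by a formula meaningful for arbitrary
    functions ([age], [excitation], [compensating], positive parts), and meets its intended value
    only on good paths. For the same reason [extinction] is compared with [bounded_event], which
    involves integer times only.

    Instead of a stochastic integral, martingale identities come from Riemann sums over a fine
    partition: the first-order terms have mean 0 because a bounded past variable multiplies a
    martingale increment, and the remainder tends to 0 because a short enough step contains at most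
    one jump and little of [A].

    The bound [A <= L (1 + X)] keeps the exponential martingale below [exp (c L)] when
    [c L + ln (1 - c)] is not positive; strict negativity sends it to 0 on unbounded paths. At the
    root the bound gives no decay, hence the limit from above. *)

Definition jump_list x l T :=
  (forall a, a \in l -> 0 < a <= T) /\
  (forall t, 0 <= t <= T -> x t = \sum_(a <- l) (a <= t)%R%:R).

Lemma extend_path_cumulative x : counting_path x ->
  nondecreasing (extend_path x) /\ right_continuous (extend_path x).
Proof.
move=> [_ xnd [xrc _] _]; split.
  move=> a b ab; rewrite /extend_path; apply: xnd.
    by rewrite le_max lexx.
  by rewrite ge_max !le_max lexx/= ab orbT.
move=> t; rewrite /extend_path.
have [t0|t0] := leP 0 t.
  apply: cvg_trans (xrc t t0).
  apply: near_eq_cvg; near=> r.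
  by rewrite max_r// (le_trans t0)//; near: r; exact: nbhs_right_ge.
apply: cvg_trans (@cvg_cst _ (x 0) _ (t^'+) _).
apply: near_eq_cvg; near=> r.
rewrite max_l// ltW//; near: r; exact: nbhs_right_lt.
Unshelve. all: by end_near. Qed.

Lemma path_measure_itv x (a b : R) : counting_path x -> 0 <= a -> a <= b ->
  path_measure x `]a, b]%classic = (x b - x a)%:E.
Proof.
move=> cx a0 ab; rewrite /path_measure.
case: pselect => [h|]; last by move/(_ (extend_path_cumulative cx)).
rewrite /cumul_path_measure/=.
rewrite /lebesgue_stieltjes_measure/= /measure_extension/= measurable_mu_extE/=; last exact: is_ocitv.
by rewrite wlength_itv_bnd// /cumul_path /extend_path !max_r// (le_trans a0).
Qed.

(** Beyond [T] the list says nothing about [x], so both measures are restricted to []0, T]]. There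
    they agree on half-open intervals, each giving the increment of [x], and uniqueness of measures
    applies. *)
Lemma jump_list_path_measure x l T (A : set (measurableTypeR R)) :
  counting_path x -> jump_list x l T -> measurable A -> A `<=` `]0, T]%classic ->
  path_measure x A = msum (fun k => \d_(nth 0 l k : measurableTypeR R)) (size l) A.
Proof.
move=> cx [l0 xl] mA AT.
have mD : measurable (`]0, T]%classic : set (measurableTypeR R)).
  exact: measurable_itv.
pose m2 : {measure set (measurableTypeR R) -> \bar R} :=
  msum (fun k => \d_(nth 0 l k : measurableTypeR R)) (size l).
rewrite -[RHS]/(m2 A).
have -> : path_measure x A = mrestr (path_measure x) mD A.
  by rewrite /mrestr setIidl.
have -> : m2 A = mrestr m2 mD A by rewrite /mrestr setIidl.
have [T0|T0] := leP 0 T; last first.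
  have A0 : A = set0.
    rewrite -subset0 => r /AT/=; rewrite in_itv/= => /andP[r0 rT].
    by move: (lt_le_trans r0 rT); rewrite ltNge (ltW T0).
  by rewrite A0 !measure0.
pose r1 : {measure set (measurableTypeR R) -> \bar R} := mrestr (path_measure x) mD.
pose r2 : {measure set (measurableTypeR R) -> \bar R} := mrestr m2 mD.
apply: (@measure_unique _ R (measurableTypeR R) (@ocitv R)
  (fun k => `](- k%:R), k%:R]%classic) _ _ _ _ r1 r2) => //.
- exact: ocitvI.
- by move=> i; exact: is_ocitv.
- rewrite -subTset => r _ /=.
  by exists (Num.bound r); rewrite //= in_itv/= ltrNl ltrNbound ltW// ltr_bound.
- move=> _ [[a b] _ <-]/=; rewrite /r1 /r2 /= /mrestr.
  have -> : `]a, b]%classic `&` `]0, T]%classic = `]Num.max a 0, Num.min b T]%classic :> set R.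
    apply/seteqP; split => r /=; rewrite !in_itv/= gt_max le_min.
      by move=> [/andP[-> ->] /andP[-> ->]].
    by move=> /andP[/andP[-> ->] /andP[-> ->]].
  set a' := Num.max a 0; set b' := Num.min b T.
  have a'0 : 0 <= a' by rewrite le_max lexx orbT.
  have b'T : b' <= T by rewrite ge_min lexx orbT.
  have [a'b'|b'a'] := leP a' b'; last first.
    by rewrite set_itv_ge ?measure0// bnd_simp -leNgt ltW.
  rewrite path_measure_itv// !xl ?a'0 ?(le_trans a'b')// ?b'T ?andbT ?(le_trans a'0)//.
  rewrite /m2 /msum -sumrB (big_nth 0) big_mkord -sumEFin; apply: eq_bigr => i _.
  rewrite /= /dirac indicE; congr (_%:E).
  have [xb|xb] := leP (nth 0 l i) b'; have [xa|xa] := leP (nth 0 l i) a'.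
  - by rewrite subrr memNset//= in_itv/= ltNge xa.
  - by rewrite subr0 mem_set//= in_itv/= xa xb.
  - by have := le_lt_trans (le_trans xa a'b') xb; rewrite ltxx.
  - by rewrite subr0 memNset//= in_itv/= leNgt xb andbF.
- move=> k; rewrite /r1 /= /mrestr.
  apply: le_lt_trans (_ : path_measure x `]0%R, T]%classic < +oo)%E.
    by apply: le_measure; rewrite ?inE//; (exact: measurableI || exact: subIsetr).
  by rewrite path_measure_itv// ltry.
Qed.

Lemma integral_path_measure x l T t (g : R -> \bar R) :
  counting_path x -> jump_list x l T -> t <= T ->
  measurable_fun `]0, t[ g -> (forall s, 0 < s < t -> (0 <= g s)%E) ->
  (\int[path_measure x]_(s in `]0%R, t[) g s = \sum_(a <- l | (a < t)%R) g a)%E.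
Proof.
move=> cx xl tT mg g0.
rewrite (eq_measure_integral (msum (fun k => \d_(nth 0 l k : measurableTypeR R)) (size l))); last first.
  move=> A mA AT; apply: (jump_list_path_measure cx xl) => //.
  move=> r /AT/=; rewrite !in_itv/= => /andP[-> rt].
  by rewrite (le_trans (ltW rt)).
rewrite ge0_integral_measure_sum//=.
rewrite [RHS](big_nth 0) big_mkord [RHS]big_mkcond/=; apply: eq_bigr => i _.
rewrite integral_dirac// /dirac indicE.
have /andP[l0 lT] := xl.1 (nth 0 l i) (mem_nth _ (ltn_ord i)).
case: ifPn => lt.
  by rewrite mem_set ?mul1e//= in_itv/= l0 lt.
by rewrite memNset ?mul0e//= in_itv/= (negbTE lt) andbF.
Qed.

End jump_list.

(** * Ages and jump times of a counting path *)

Section age.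
Context {R : realType}.
Implicit Types (x : R -> R) (t a T : R) (k : nat).

(** The time elapsed at [t] since the [k.+1]-th jump of [x] (0 before that
    jump).  The supremum over rational times makes it measurable as soon as all
    the [x t] are, whatever the paths. *)
Definition age x k t : R :=
  sup ([set 0] `|` [set y | exists q : rat,
    [/\ 0 <= ratr q :> R, k.+1%:R <= x (ratr q) & y = t - ratr q]]).

Let age_set_sup x k t : has_sup ([set 0] `|` [set y | exists q : rat,
    [/\ 0 <= ratr q :> R, k.+1%:R <= x (ratr q) & y = t - ratr q]]).
Proof.
split; first by exists 0; left.
exists (Num.max 0 t) => y [->|[q [q0 _ ->]]]; first by rewrite le_max lexx.
by rewrite le_max; apply/orP; right; rewrite lerBlDr lerDl.
Qed.

(** A strict inequality turns the supremum into the existence of a rational witness; the resulting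
    countable union is the source of measurability. *)
Lemma age_gtP x k t a : 0 <= a ->
  a < age x k t <-> exists q : rat,
    [/\ 0 <= ratr q :> R, k.+1%:R <= x (ratr q) & ratr q + a < t].
Proof.
move=> a0; split=> [aage|[q [q0 xq qat]]].
  have [y [->|[q [q0 xq ->]]] ay] := sup_gt (age_set_sup x k t).1 aage.
    by rewrite ltNge a0 in ay.
  by exists q; split=> //; rewrite -ltrBrDl.
rewrite (@lt_le_trans _ _ (t - ratr q)) ?ltrBrDl//.
by apply: (sup_ubound (age_set_sup x k t).2); right; exists q.
Qed.

Lemma age_ge0 x k t : 0 <= age x k t.
Proof. by apply: (sup_ubound (age_set_sup x k t).2); left. Qed.

Lemma age_eq x k t b : 0 <= b ->
  (forall a, 0 <= a -> a < age x k t <-> a < b) -> age x k t = b.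
Proof.
move=> b0 h; apply/eqP; rewrite eq_le; apply/andP; split; rewrite leNgt;
  apply/negP => lt.
  by have := (h b b0).1 lt; rewrite ltxx.
by have := (h _ (age_ge0 x k t)).2 lt; rewrite ltxx.
Qed.

Lemma age_le0 x k t : t <= 0 -> age x k t = 0.
Proof.
move=> t0; apply: age_eq => // a a0; split; last by rewrite ltNge a0.
move=> /(age_gtP _ _ _ a0)[q [q0 _]]; rewrite ltNge => /negP[].
by rewrite (le_trans t0)// addr_ge0.
Qed.

Lemma age_nojump x k t T : counting_path x -> t <= T -> x T < k.+1%:R ->
  age x k t = 0.
Proof.
move=> [_ xnd _ _] tT xT; apply: age_eq => // a a0; split.
  move=> /(age_gtP _ _ _ a0)[q [q0 xq qt]].
  have qT : ratr q <= T by rewrite (le_trans _ tT)// (le_trans _ (ltW qt))// lerDl.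
  by have := le_lt_trans (le_trans xq (xnd _ _ q0 qT)) xT; rewrite ltxx.
by rewrite ltNge a0.
Qed.

(** Meaningful only if the level [k.+1] is reached; the lemmas below carry a horizon [T] with
    [k.+1%:R <= x T]. *)
Definition jump_time x k : R := inf [set t | 0 <= t /\ k.+1%:R <= x t].

Section jump_time.
Variables (x : R -> R) (k : nat) (T : R).
Hypotheses (cx : counting_path x) (x0 : x 0 = 0) (T0 : 0 <= T).
Hypothesis xT : k.+1%:R <= x T.

Let S := [set t | 0 <= t /\ k.+1%:R <= x t].

Let infS : has_inf S.
Proof. by split; [exists T|exists 0 => t []]. Qed.

Lemma jump_time_ge0 : 0 <= jump_time x k.
Proof. by apply: lb_le_inf; [exists T|move=> t []]. Qed.

(** Right-continuity makes the infimum attained, hence the large inequality on the right. *)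
Lemma jump_timeP t : 0 <= t -> (k.+1%:R <= x t) = (jump_time x k <= t).
Proof.
have [_ xnd [xrc _] _] := cx.
move=> t0; apply/idP/idP => [xt|tt]; first exact: (ge_inf infS.2).
apply: le_trans (xnd _ _ jump_time_ge0 tt).
have xr r : jump_time x k < r -> k.+1%:R <= x r.
  move=> tr; have [s [s0 xs] sr] := inf_lt infS.1 tr.
  by apply: le_trans xs _; apply: xnd => //; exact: ltW.
have := xrc _ jump_time_ge0 => xcvg.
rewrite -(cvg_lim _ xcvg)//; apply: limr_ge; first by apply/cvg_ex; eexists; exact: xcvg.
by near=> r; apply: xr; near: r; exact: nbhs_right_gt.
Unshelve. all: by end_near. Qed.

Lemma jump_time_gt0 : 0 < jump_time x k.
Proof. by rewrite ltNge -jump_timeP// x0 -ltNge ltr0n. Qed.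

Lemma jump_time_le : jump_time x k <= T.
Proof. by rewrite -jump_timeP. Qed.

Lemma age_jump t : age x k t = Num.max 0 (t - jump_time x k).
Proof.
apply: age_eq => [|a a0]; first by rewrite le_max lexx.
rewrite lt_max [a < 0]ltNge a0/= ltrBrDr; split.
  move=> /(age_gtP _ _ _ a0)[q [q0 xq qt]].
  by rewrite (le_lt_trans _ qt)// addrC lerD2r -jump_timeP.
move=> at_; apply/(age_gtP _ _ _ a0).
have [q] : exists q : rat, jump_time x k < ratr q < t - a.
  have ht : jump_time x k < t - a by rewrite ltrBrDl.
  by have [q] := rat_in_itvoo ht; rewrite in_itv/= => ?; exists q.
move=> /andP[q1 q2]; have q0 : 0 <= ratr q :> R.
  exact: le_trans jump_time_ge0 (ltW q1).
by exists q; split => //; [rewrite jump_timeP// ltW|rewrite -ltrBrDr].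
Qed.

End jump_time.

(** If jump [k] were no later than jump [j], the left limit at its time [s] would be at most [j]
    while [x s >= k + 1 >= j + 2]: a jump of height at least 2. *)
Lemma jump_time_lt x j k T : counting_path x -> x 0 = 0 -> 0 <= T ->
  k.+1%:R <= x T -> (j < k)%N -> jump_time x j < jump_time x k.
Proof.
move=> cx x0 T0 xT jk; have [xnat xnd [_ xll] xj] := cx.
have xTj : j.+1%:R <= x T by rewrite (le_trans _ xT)// ler_nat ltnS ltnW.
set s := jump_time x k.
have s0 : 0 < s := jump_time_gt0 cx x0 T0 xT.
have xs : k.+1%:R <= x s by rewrite (jump_timeP cx T0 xT) ?(ltW s0).
rewrite ltNge; apply/negP => sj.
have xl : lim (x r @[r --> s^'-]) <= j%:R.
  apply: limr_le; first exact: xll.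
  near=> r.
  have r0 : 0 < r by near: r; exact: nbhs_left_gt.
  have rs : r < s by near: r; exact: nbhs_left_lt.
  have [n xrn] := xnat r (ltW r0).
  rewrite xrn ler_nat -ltnS -(ltr_nat R) -xrn ltNge (jump_timeP cx T0 xTj (ltW r0)).
  by rewrite -ltNge; exact: lt_le_trans rs sj.
have h : 2 <= x s - lim (x r @[r --> s^'-]).
  rewrite lerBrDr (le_trans _ xs)// (le_trans (lerD (lexx _) xl))//.
  by rewrite -natrD ler_nat.
have := xj s s0; have -> : (x s - lim (x r @[r --> s^'-])) != 0.
  by rewrite gt_eqF// (lt_le_trans _ h).
by move=> /(_ isT) e; move: h; rewrite e; lra.
Unshelve. all: by end_near. Qed.

Lemma counting_path_sum x T n : counting_path x -> x 0 = 0 -> x T = n%:R ->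
  forall t, 0 <= t <= T -> x t = \sum_(k < n) (jump_time x k <= t)%R%:R.
Proof.
move=> cx x0 xT t /andP[t0 tT]; have [xnat xnd _ _] := cx.
have T0 := le_trans t0 tT.
have [m xm] := xnat t t0.
have mn : (m <= n)%N by rewrite -(ler_nat R) -xm -xT xnd.
rewrite (eq_bigr (fun k : 'I_n => (k < m)%N%:R)); last first.
  move=> k _; rewrite -(@jump_timeP x k T)//; last by rewrite xT ler_nat.
  by rewrite xm ler_nat.
rewrite xm -natr_sum; congr (_%:R).
rewrite -(big_mkord xpredT (fun k => (k < m)%N : nat))/= (big_cat_nat (leq0n _) mn)//=.
rewrite (eq_big_nat _ _ (F2 := fun=> 1%N)) => [|i /andP[_ ->]//].
rewrite big_const_nat iter_addn subn0 mul1n addn0 big_nat big1 ?addn0//.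
by move=> i /andP[mi _]; rewrite ltnNge mi.
Qed.

Definition jumps_up_to x n : seq R := [seq jump_time x k | k <- iota 0 n].

Lemma jump_list_jumps x T n : counting_path x -> x 0 = 0 -> 0 <= T ->
  x T = n%:R -> jump_list x (jumps_up_to x n) T.
Proof.
move=> cx x0 T0 xT; split.
  move=> a /mapP[k]; rewrite mem_iota add0n => /andP[_ kn] ->.
  have xk : k.+1%:R <= x T by rewrite xT ler_nat.
  by rewrite jump_time_le// (@jump_time_gt0 _ _ T).
move=> t tT; rewrite (counting_path_sum cx x0 xT tT).
by rewrite /jumps_up_to big_map -[X in iota 0 X]subn0 -/(index_iota 0 n) big_mkord.
Qed.

(** Jumps that have not occurred by [T] have age 0, and [g 0 = 0] removes them: only [n] terms of
    the series remain. *)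
Lemma age_series x T n (g : R -> R) t : counting_path x -> x 0 = 0 -> 0 <= T ->
  x T = n%:R -> g 0 = 0 -> t <= T ->
  (\sum_(k <oo) (g (age x k t))%:E =
   \sum_(a <- jumps_up_to x n) (g (Num.max 0 (t - a)))%:E)%E.
Proof.
move=> cx x0 T0 xT g0 tT.
have agen k : (n <= k)%N -> age x k t = 0.
  by move=> nk; apply: (age_nojump cx tT); rewrite xT ltr_nat ltnS.
transitivity (\sum_(0 <= k < n) (g (age x k t))%:E)%E.
  apply: cvg_lim => //; rewrite -(cvg_shiftn n)/=.
  apply: cvg_near_cst; near=> m.
  rewrite (big_cat_nat (leq0n _) (leq_addl m n))/=.
  rewrite [X in (_ + X)%E = _](_ : _ = 0%E) ?adde0// big_nat big1//.
  by move=> k /andP[nk _]; rewrite agen// g0.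
rewrite /jumps_up_to big_map /index_iota subn0 !big_seq; apply: eq_bigr => k.
rewrite mem_iota add0n => /andP[_ kn]; rewrite (@age_jump x k T)//.
by rewrite xT ler_nat.
Unshelve. all: by end_near. Qed.

End age.

(** * The primitive of the excitation function and its sums over jumps *)

Section primitive.
Context {R : realType}.
Variable f : R -> R.
Local Notation leb := (@lebesgue_measure R).

(** Starting the integral at [-oo] changes nothing, [f] being 0 on negative arguments, and makes
    translation by a jump time a plain shift of the half-line. *)
Definition primitive (t : R) : R :=
  fine (\int[leb]_(s in `]-oo, t]) (f s)%:E)%E.

Hypotheses (f_ge0 : forall v, 0 <= f v) (f_le0 : forall v, v <= 0 -> f v = 0).
Hypothesis f_meas : measurable_fun setT f.
Hypothesis f_int : forall t, (\int[leb]_(s in `]-oo, t]) (f s)%:E < +oo)%E.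

Let f_emeas D : measurable_fun D (fun s => (f s)%:E).
Proof. by apply/measurable_EFinP; exact: measurable_funTS. Qed.

Lemma primitiveE t : (primitive t)%:E = (\int[leb]_(s in `]-oo, t]) (f s)%:E)%E.
Proof.
rewrite fineK// ge0_fin_numE//; apply: integral_ge0 => s _.
by rewrite lee_fin.
Qed.

Lemma primitiveB s t : s <= t ->
  (primitive t - primitive s)%:E = (\int[leb]_(u in `]s, t]) (f u)%:E)%E.
Proof.
move=> st; rewrite EFinB !primitiveE.
have -> : (`]-oo, t]%classic : set R) = `]-oo, s] `|` `]s, t].
  by rewrite -itv_bndbnd_setU// bnd_simp.
rewrite ge0_integral_setU//=.
- by rewrite -primitiveE addeAC subee// add0e.
- exact: f_emeas.
- by move=> u _; rewrite lee_fin.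
- apply/disj_setPS => r [/=]; rewrite !in_itv/= => rs /andP[].
  by rewrite ltNge rs.
Qed.

Lemma primitive_nd : {homo primitive : s t / s <= t}.
Proof.
move=> s t st; rewrite -subr_ge0 -lee_fin primitiveB//.
by apply: integral_ge0 => u _; rewrite lee_fin.
Qed.

Lemma primitive_ge0 t : 0 <= primitive t.
Proof.
by rewrite -lee_fin primitiveE; apply: integral_ge0 => u _; rewrite lee_fin.
Qed.

Lemma primitive_le0 t : t <= 0 -> primitive t = 0.
Proof.
move=> t0; apply: EFin_inj; rewrite primitiveE integral0_eq// => u.
by rewrite /= in_itv/= => ut; rewrite f_le0// (le_trans ut).
Qed.

Lemma primitive_max t : primitive (Num.max 0 t) = primitive t.
Proof. by have [t0|] := leP 0 t => // t0; rewrite !primitive_le0// ltW. Qed.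

(** Absolute continuity of the integral, applied to [f] cut off at [T]: only the truncated function
    is known to be integrable. *)
Lemma primitive_unif_continuous T e : 0 < e -> exists2 d, 0 < d &
  forall s t, s <= t -> t <= T -> t - s < d -> primitive t - primitive s < e.
Proof.
move=> e0; pose g := f \_ `]-oo, T].
have mg : measurable_fun setT (EFin \o g).
  apply/measurable_EFinP; apply/(measurable_restrictT _ _).1 => //.
  exact: measurable_funTS.
have ge0 u : (0 <= g u)%R by rewrite /g patchE; case: ifPn.
have gint : leb.-integrable setT (EFin \o g).
  apply/integrableP; split=> //.
  have -> : (\int[leb]_x `|(EFin \o g) x| =
      \int[leb]_(s in `]-oo, T]) (f s)%:E)%E; last exact: f_int.
    rewrite [RHS]integral_mkcond; apply: eq_integral => u _.
    by rewrite /= /g !patchE; case: ifPn => _; rewrite ?normr0 ?ger0_norm.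
have [d [d0 hd]] := integral_normr_continuous gint e0.
exists d => // s t st tT tsd.
have mst : measurable (`]s, t]%classic : set (measurableTypeR R)).
  exact: measurable_itv.
have := hd _ mst.
rewrite /= lebesgue_measure_itv/= lte_fin.
move=> /(_ _)/wrap[]; first by case: ifPn => _; rewrite ?lte_fin// -EFinB lte_fin.
apply: le_lt_trans; rewrite -lee_fin primitiveB// fineK; last first.
  rewrite ge0_fin_numE; last by apply: integral_ge0 => u _; rewrite lee_fin.
  have gI : (\int[leb]_x (`|g x|)%:E < +oo)%E by case/integrableP: gint.
  apply: le_lt_trans gI; apply: ge0_subset_integral => //.
  by apply/measurable_EFinP; apply: measurableT_comp => //; exact/measurable_EFinP.
under [leRHS]eq_integral => u.
  rewrite inE/= in_itv/= => /andP[su ut].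
  rewrite ger0_norm// /g patchE mem_set/= ?in_itv/= ?(le_trans ut)//.
  over.
exact: lexx.
Qed.

Lemma primitive_continuous : continuous primitive.
Proof.
move=> t; apply/cvgrPdist_lt => e e0.
have [d d0 hd] := primitive_unif_continuous (t + 1) e0.
near=> s.
have s1 : s <= t + 1.
  by rewrite ltW//; near: s; apply: lt_nbhsl; rewrite ltrDl.
have sd : `|t - s| < d by near: s; exact: cvgr_dist_lt.
have [ts|st] := leP t s.
  rewrite distrC ger0_norm ?subr_ge0 ?primitive_nd//.
  by apply: hd => //; rewrite -(ger0_norm (_ : 0 <= s - t)) ?subr_ge0// distrC.
rewrite ger0_norm ?subr_ge0 ?primitive_nd ?ltW//.
apply: hd; rewrite ?ltW ?lerDl//.
  by rewrite ltrDl.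
by rewrite -(ger0_norm (_ : 0 <= t - s)) ?subr_ge0// ltW.
Unshelve. all: by end_near. Qed.

(** Translation invariance of Lebesgue measure, obtained from its uniqueness on half-open
    intervals. *)
Lemma integral_shift a t :
  (\int[leb]_(s in `]-oo, t]) (f (s - a))%:E = (primitive (t - a))%:E)%E.
Proof.
pose sh : measurableTypeR R -> measurableTypeR R := fun s => s - a.
have msh : measurable_fun [set: measurableTypeR R] sh.
  by apply: measurable_funB => //; exact: measurable_cst.
have sh_itv : `]-oo, t]%classic = sh @^-1` `]-oo, t - a].
  by apply/seteqP; split => r /=; rewrite !in_itv/= /sh lerD2r.
have sh_leb A : measurable A -> pushforward leb sh A = leb A.
  move=> mA; apply/esym/lebesgue_measure_unique => //= _ [[b c]] _ <-.
  rewrite /pushforward; have -> : sh @^-1` `]b, c] = `]b + a, c + a]%classic.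
    by apply/seteqP; split => r /=; rewrite !in_itv/= /sh ltrBrDr lerBlDr.
  rewrite !lebesgue_measure_itv/= !lte_fin ltrD2r.
  by case: ifPn => // _; rewrite -!EFinB opprD addrACA subrr addr0.
rewrite sh_itv -[LHS](@ge0_integral_pushforward _ _ (measurableTypeR R) (measurableTypeR R) R sh msh
  leb `]-oo, (t - a)%R]%classic (fun s => (f s)%:E))//.
- rewrite primitiveE; apply: eq_measure_integral => A mA _.
  exact: sh_leb.
- exact: f_emeas.
- by move=> y _; rewrite lee_fin.
Qed.

(** For a counting path these are the sums over its jump times [a < t] of
    [f (t - a)] and of the primitive of [f] at [t - a]; going through the ages
    keeps them measurable in the path without any assumption on it. *)
Definition excitation (x : R -> R) t : \bar R :=
  (\sum_(k <oo) (f (age x k t))%:E)%E.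

Definition cum_excitation (x : R -> R) t : \bar R :=
  (\sum_(k <oo) (primitive (age x k t))%:E)%E.

(** Two jump lists of the same path are not compared as multisets: the sum over either one is the
    integral against [dx], so [l] can be exchanged for [jumps_up_to]. *)
Lemma excitation_jump_list x l T t : counting_path x -> x 0 = 0 -> 0 <= T ->
  jump_list x l T -> t <= T ->
  excitation x t = (\sum_(a <- l) (f (t - a))%:E)%E.
Proof.
move=> cx x0 T0 xl tT.
have [t0|t0] := leP t 0.
  rewrite /excitation eseries0 => [|k _ _]; last by rewrite age_le0// f_le0.
  rewrite big_seq big1// => a al; rewrite f_le0//.
  by have /andP[a0 _] := xl.1 _ al; rewrite subr_le0 (le_trans t0)// ltW.
have key l' : jump_list x l' T -> (\int[path_measure x]_(s in `]0%R, t[) (f (t - s))%:E =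
    \sum_(a <- l') (f (t - a))%:E)%E.
  move=> xl'; rewrite (integral_path_measure cx xl' tT).
  - rewrite big_mkcond/=; apply: eq_bigr => a _.
    by case: ifPn => //; rewrite -leNgt => ta; rewrite f_le0// subr_le0.
  - apply/measurable_EFinP; apply: measurable_funTS.
    apply: measurableT_comp => //.
    by apply: measurable_funB => //; exact: measurable_cst.
  - by move=> s _; rewrite lee_fin.
rewrite -(key _ xl).
have [xnat _ _ _] := cx; have [n xT] := xnat T T0.
rewrite (key _ (jump_list_jumps cx x0 T0 xT)).
rewrite /excitation (age_series cx x0 T0 xT (f_le0 (lexx 0)) tT).
apply: eq_bigr => a _; have [h|h] := leP 0 (t - a) => //.
by rewrite !f_le0// ltW.
Qed.

(** The integral over []0, t[] leaves out a jump at [t] itself; in the sum this jump contributes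
    [f 0 = 0], whatever the value of [phi] at 0. *)
Lemma excitation_past (phi : R -> R) x t : counting_path x -> x 0 = 0 -> 0 < t ->
  (forall v, 0 < v -> f v = phi v) ->
  (\int[path_measure x]_(s in `]0%R, t[) (phi (t - s))%:E = excitation x t)%E.
Proof.
move=> cx x0 t0 fphi; have [xnat _ _ _] := cx; have [n xt] := xnat t (ltW t0).
have xl := jump_list_jumps cx x0 (ltW t0) xt.
rewrite (excitation_jump_list cx x0 (ltW t0) xl (lexx t)).
transitivity (\int[path_measure x]_(s in `]0%R, t[) (f (t - s))%:E)%E.
  apply: eq_integral => s; rewrite inE/= in_itv/= => /andP[s0 st].
  by rewrite fphi// subr_gt0.
rewrite (integral_path_measure cx xl (lexx t)).
- rewrite big_mkcond/=; apply: eq_bigr => a _.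
  by case: ifPn => //; rewrite -leNgt => ta; rewrite f_le0// subr_le0.
- apply/measurable_EFinP; apply: measurable_funTS.
  apply: measurableT_comp => //.
  by apply: measurable_funB => //; exact: measurable_cst.
- by move=> s _; rewrite lee_fin.
Qed.

Lemma excitation_ge0 x t : (0 <= excitation x t)%E.
Proof. by apply: nneseries_ge0 => k _ _; rewrite lee_fin. Qed.

(** The concatenation of jump lists of the [z i] is a jump list of [x]. *)
Lemma excitation_sum (I : eqType) (r : seq I) (x : R -> R) (z : I -> R -> R) T t :
  counting_path x -> x 0 = 0 ->
  (forall i, i \in r -> counting_path (z i) /\ z i 0 = 0) -> 0 <= T ->
  (forall s, 0 <= s <= T -> x s = \sum_(i <- r) z i s) -> t <= T ->
  excitation x t = (\sum_(i <- r) excitation (z i) t)%E.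
Proof.
move=> cx x0 cz T0 xz tT.
have /choice[l hl] i : exists l, i \in r -> jump_list (z i) l T.
  have [ir|] := boolP (i \in r); last by exists [::].
  have [cz_ z0] := cz i ir; have [znat _ _ _] := cz_.
  by have [n zn] := znat T T0; exists (jumps_up_to (z i) n) => _; exact: jump_list_jumps.
have xl : jump_list x (flatten [seq l i | i <- r]) T.
  split=> [a /flattenP[_ /mapP[i ir ->]]|s sT]; first exact: (hl i ir).1.
  rewrite xz// big_flatten/= big_map !big_seq; apply: eq_bigr => i ir.
  by rewrite (hl i ir).2.
rewrite (excitation_jump_list cx x0 T0 xl tT) big_flatten/= big_map !big_seq.
apply: eq_bigr => i ir; have [? ?] := cz i ir.
by rewrite (excitation_jump_list _ _ T0 (hl i ir) tT).
Qed.

Lemma cum_excitationE x T n t : counting_path x -> x 0 = 0 -> 0 <= T ->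
  x T = n%:R -> t <= T ->
  cum_excitation x t = (\sum_(a <- jumps_up_to x n) primitive (t - a))%:E.
Proof.
move=> cx x0 T0 xT tT.
rewrite /cum_excitation (age_series cx x0 T0 xT (primitive_le0 (lexx 0)) tT).
by rewrite -sumEFin; apply: eq_bigr => a _; rewrite primitive_max.
Qed.

Lemma integral_excitation x t : counting_path x -> x 0 = 0 -> 0 <= t ->
  (\int[leb]_(s in `]-oo, t]) excitation x s = cum_excitation x t)%E.
Proof.
move=> cx x0 t0; have [xnat _ _ _] := cx; have [n xt] := xnat t t0.
rewrite (cum_excitationE cx x0 t0 xt (lexx t)).
transitivity (\int[leb]_(s in `]-oo, t]) \sum_(a <- jumps_up_to x n) (f (s - a))%:E)%E.
  apply: eq_integral => s; rewrite inE/= in_itv/= => st.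
  exact: (excitation_jump_list cx x0 t0 (jump_list_jumps cx x0 t0 xt) st).
rewrite ge0_integral_sum//=.
- by rewrite -sumEFin; apply: eq_bigr => a _; rewrite integral_shift.
- move=> a; apply/measurable_EFinP; apply: measurable_funTS.
  apply: measurableT_comp => //.
  by apply: measurable_funB => //; exact: measurable_cst.
- by move=> a s _; rewrite lee_fin.
Qed.

End primitive.

(** * Predictable sets, with and without marks *)

Section predictable_rectangles.
Context {R : realType} {dO : measure_display} {Omega : measurableType dO}.
Variable F : R -> set (set Omega).
Hypothesis hF : filtration F.

(** Half-lines, rather than bounded intervals, so that the generators form a
    pi-system containing the whole space. *)
Definition predictable_rectangles : set (set (Omega * R)) :=
  [set B | B = setT \/ exists (s : R) (A : set Omega),
     [/\ 0 <= s, F s A & B = A `*` `]s, +oo[%classic]].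

Definition predictable_space := g_sigma_algebraType predictable_rectangles.

(** Predictable sets with an additional mark; the marks are kept bounded so that
    Poisson measures have finite intensity on the generators. *)
Definition thickened_rectangles : set (set (Omega * (R * R))) :=
  [set B | exists (D : set (Omega * R)) (C : set R) (n : nat),
     [/\ predictable_rectangles D, measurable C, C `<=` `[- n%:R, n%:R] &
         B = [set p | D (p.1, p.2.1) /\ C p.2.2]]].

Definition thickened_space := g_sigma_algebraType thickened_rectangles.

Lemma filtrationT t : 0 <= t -> F t setT.
Proof.
move=> t0; have [sF _ _] := hF; have [F0 FC _] := sF t t0.
by rewrite -(setD0 setT); exact: FC.
Qed.

Lemma filtrationI t A B : 0 <= t -> F t A -> F t B -> F t (A `&` B).
Proof.
move=> t0 FA FB; have [sF _ _] := hF.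
have FE := @measurable_g_measurableTypeE Omega (F t) (sF t t0).
rewrite -FE in FA FB *; exact: measurableI.
Qed.

Lemma predictable_rectanglesI : setI_closed predictable_rectangles.
Proof.
have [_ _ Fle] := hF.
move=> _ B [->|[s [A [s0 FA ->]]]]; first by rewrite setTI.
move=> [->|[t [A' [t0 FA' ->]]]].
  by rewrite setIT; right; exists s, A.
right; exists (Num.max s t), (A `&` A'); split.
- by rewrite le_max s0.
- apply: filtrationI; first by rewrite le_max s0.
    by apply: (Fle s) => //; rewrite le_max lexx.
  by apply: (Fle t) => //; rewrite le_max lexx orbT.
- apply/seteqP; split => [[w u]/=|[w u]/=]; rewrite !in_itv/= !andbT gt_max.
    by move=> [[? ->] [? ->]].
  by move=> [[? ?] /andP[-> ->]].
Qed.

Lemma predictable_rectangles_measurable :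
  predictable_rectangles `<=` @measurable _ (Omega * R)%type.
Proof.
have [_ Fm _] := hF.
move=> _ [->|[s [A [s0 FA ->]]]]; first exact: measurableT.
by apply: measurableX; [exact: (Fm s)|exact: measurable_itv].
Qed.

Lemma predictable_space_measurable (B : set (Omega * R)) :
  @measurable _ predictable_space B -> @measurable _ (Omega * R)%type B.
Proof.
apply: smallest_sub; first exact: sigma_algebra_measurable.
exact: predictable_rectangles_measurable.
Qed.

(** The section at [t] of a generator with time set []s, +oo[] is its event, in [F s] and so in
    [F t], when [s < t], and is empty otherwise. This later turns predictability of the compensator
    into adaptedness. *)
Lemma predictable_space_section (B : set (Omega * R)) t : 0 <= t ->
  @measurable _ predictable_space B -> F t [set w | B (w, t)].
Proof.
move=> t0; have [sF _ Fle] := hF; have [F0 FC FU] := sF t t0.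
move: B; suff : <<s predictable_rectangles >> `<=` [set B | F t [set w | B (w, t)]].
  by move=> h B; exact: h.
apply: smallest_sub.
- split => //= [A FA|A FA].
    have -> : [set w | (setT `\` A) (w, t)] = setT `\` [set w | A (w, t)] by [].
    exact: FC.
  have -> : [set w | (\bigcup_k A k) (w, t)] = \bigcup_k [set w | A k (w, t)] by [].
  exact: FU.
- move=> _ [->|[s [A [s0 FA ->]]]] /=; first exact: filtrationT.
  have [st|ts] := ltP s t.
    have -> : [set w | A w /\ t \in `]s, +oo[] = A.
      by apply/seteqP; split=> [w []//|w Aw]/=; rewrite in_itv/= st.
    by apply: Fle FA => //; exact: ltW.
  have -> : [set w | A w /\ t \in `]s, +oo[] = set0; last exact: F0.
  by rewrite -subset0 => w [_]; rewrite /= in_itv/= andbT ltNge ts.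
Qed.

(** The two sigma-algebras live over different time sets, hence the intersection. A half-line []s,
    +oo[] is a countable union of the bounded intervals []s, s + n + 1]] used by
    [predictable_sigma]. *)
Lemma predictable_space_predictable (B : set (Omega * R)) :
  @measurable _ predictable_space B ->
  predictable_sigma F (B `&` [set: Omega] `*` `[0, +oo[).
Proof.
set D := [set: Omega] `*` `[0, +oo[%classic.
have [P0 PC PU] : sigma_algebra D (predictable_sigma F).
  by apply: smallest_sigma_algebra.
move: B; suff : <<s predictable_rectangles >> `<=`
    [set B | predictable_sigma F (B `&` D)].
  by move=> h B; exact: h.
apply: smallest_sub.
- split => /=; first by rewrite set0I.
    move=> A PA; have -> : (setT `\` A) `&` D = D `\` (A `&` D).
      by apply/seteqP; split=> p /=; tauto.
    exact: PC.
  by move=> A PA; rewrite setI_bigcupl; exact: PU.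
- move=> _ [->|[s [A [s0 FA ->]]]] /=.
    by rewrite setTI -(setD0 D); exact: PC.
  have -> : (A `*` `]s, +oo[) `&` D = \bigcup_n (A `*` `]s, s + n.+1%:R]%classic).
    apply/seteqP; split => [[w u] [[/= Aw]]|[w u] [n _ [/= Aw]]].
      rewrite !in_itv/= !andbT => su _.
      exists (Num.bound (u - s)) => //=; split=> //; rewrite in_itv/= su/=.
      rewrite -lerBlDl (le_trans (ltW (ltr_bound _)))//.
      by rewrite ler_nat.
    rewrite !in_itv/= !andbT => /andP[su _]; split; split => //=.
    by rewrite in_itv/= andbT (le_trans s0)// ltW.
  apply: PU => n; apply: sub_sigma_algebra; right.
  by exists s, (s + n.+1%:R), A; split => //; rewrite ltrDl ltr0n.
Qed.

(** Since generators have bounded marks, the preimage is exhausted by its parts with mark in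
    [[-n, n]]. *)
Lemma measurable_thickened_fst :
  measurable_fun [set: thickened_space]
    (fun p : thickened_space => (p.1, p.2.1) : predictable_space).
Proof.
apply: (@measurability _ _ thickened_space predictable_space setT _ predictable_rectangles) => //.
move=> _ [B PB <-]; rewrite setTI.
have -> : (fun p : thickened_space => (p.1, p.2.1) : predictable_space) @^-1` B =
    \bigcup_n [set p | B (p.1, p.2.1) /\ `[- n%:R, n%:R]%classic p.2.2].
  apply/seteqP; split => [p Bp|p [n _ []]//].
  exists (Num.bound p.2.2) => //; split => //.
  by rewrite /= in_itv/= lerNl !ltW ?ltrNbound ?ltr_bound.
apply: bigcupT_measurable => n; apply: sub_sigma_algebra.
by exists B, `[- n%:R, n%:R]%classic, n; split => //; exact: measurable_itv.
Qed.

Lemma measurable_thickened_snd :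
  measurable_fun [set: thickened_space] (fun p : thickened_space => p.2.2 : R).
Proof.
move=> _ C mC; rewrite setTI.
have -> : (fun p : thickened_space => p.2.2 : R) @^-1` C =
    \bigcup_n [set p | (C `&` `[- n%:R, n%:R]%classic) p.2.2].
  apply/seteqP; split => [p Cp|p [n _ []]//].
  exists (Num.bound p.2.2) => //; split => //.
  by rewrite /= in_itv/= lerNl !ltW ?ltrNbound ?ltr_bound.
apply: bigcupT_measurable => n; apply: sub_sigma_algebra.
exists setT, (C `&` `[- n%:R, n%:R]%classic), n; split.
- by left.
- by apply: measurableI => //; exact: measurable_itv.
- exact: subIsetr.
- by apply/seteqP; split => p //= [].
Qed.

Lemma thickened_rectanglesI : setI_closed thickened_rectangles.
Proof.
move=> _ _ [D [C [n [PD mC Cn ->]]]] [D' [C' [n' [PD' mC' Cn' ->]]]].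
exists (D `&` D'), (C `&` C'), n; split.
- exact: predictable_rectanglesI.
- exact: measurableI.
- by move=> z [/Cn].
- by apply/seteqP; split => p /=; tauto.
Qed.

Lemma thickened_rectangles_measurable :
  thickened_rectangles `<=` @measurable _ (Omega * (R * R))%type.
Proof.
move=> _ [D [C [n [PD mC _ ->]]]].
have mD := predictable_rectangles_measurable PD.
have -> : [set p : Omega * (R * R) | D (p.1, p.2.1) /\ C p.2.2] =
    (fun p : Omega * (R * R) => (p.1, p.2.1)) @^-1` D `&`
    (fun p : Omega * (R * R) => p.2.2) @^-1` C by [].
apply: measurableI.
  rewrite -[X in measurable X]setTI.
  suff : measurable_fun [set: Omega * (R * R)] (fun p => (p.1, p.2.1)) by exact.
  apply: measurable_fun_pair => //.
  exact: measurableT_comp measurable_fst measurable_snd.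
rewrite -[X in measurable X]setTI.
suff : measurable_fun [set: Omega * (R * R)] (fun p => p.2.2) by exact.
exact: measurableT_comp measurable_snd measurable_snd.
Qed.

(** The set where the age exceeds [a] is the union over rationals [q >= 0] of rectangles with event
    [k.+1 <= X q] and times []q + a, +oo[]. The event lies in [F q], hence in [F (q + a)], which
    makes each rectangle a generator. *)
Lemma measurable_age (X : R -> Omega -> R) k : adapted F X ->
  measurable_fun [set: predictable_space]
    (fun p : predictable_space => age (X ^~ p.1) k p.2).
Proof.
move=> aX; have [_ _ Fle] := hF.
apply: (measurability _ (RGenOInfty.measurableE R)) => //.
move=> _ [_ [a ->] <-]; rewrite setTI.
have [a0|a0] := leP 0 a; last first.
  rewrite (_ : _ @^-1` _ = setT); first exact: measurableT.
  apply/seteqP; split => // p _ /=; rewrite in_itv/= andbT.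
  by rewrite (lt_le_trans a0)// age_ge0.
have -> : (fun p : predictable_space => age (X ^~ p.1) k p.2) @^-1` `]a, +oo[ =
    \bigcup_(q in [set q : rat | 0 <= ratr q :> R])
      ([set w | k.+1%:R <= X (ratr q) w] `*` `]ratr q + a, +oo[%classic).
  apply/seteqP; split => [[w u]/=|[w u] [q /= q0 [/= xq]]].
    rewrite in_itv/= andbT => /(age_gtP _ _ _ a0)[q [q0 xq qu]].
    by exists q => //=; split=> //=; rewrite in_itv/= qu.
  rewrite !in_itv/= !andbT => qu; apply/(age_gtP _ _ _ a0).
  by exists q.
rewrite bigcup_mkcond; apply: bigcupT_measurable_rat => q.
case: ifPn => [|_]; last exact: measurable0.
rewrite inE/= => q0; apply: sub_sigma_algebra; right.
exists (ratr q + a), [set w | k.+1%:R <= X (ratr q) w]; split => //.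
  exact: addr_ge0.
apply: (Fle (ratr q)) => //; first by rewrite lerDl.
have -> : [set w | k.+1%:R <= X (ratr q) w] = X (ratr q) @^-1` `[k.+1%:R, +oo[.
  by apply/seteqP; split => w /=; rewrite in_itv/= andbT.
by apply: aX => //; exact: measurable_itv.
Qed.

(** The truncation at 0 matters: the generators do not separate negative times, so [p.2] itself is
    not measurable. *)
Lemma measurable_time : measurable_fun [set: predictable_space]
    (fun p : predictable_space => Num.max 0 p.2).
Proof.
apply: (measurability _ (RGenOInfty.measurableE R)) => //.
move=> _ [_ [a ->] <-]; rewrite setTI.
have [a0|a0] := leP 0 a; last first.
  rewrite (_ : _ @^-1` _ = setT); first exact: measurableT.
  apply/seteqP; split => // p _ /=; rewrite in_itv/= andbT.
  by rewrite lt_max a0.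
apply: sub_sigma_algebra; right; exists a, setT; split => //.
  exact: filtrationT.
apply/seteqP; split => p /=; rewrite !in_itv/= !andbT lt_max ltNge a0/=; tauto.
Qed.

End predictable_rectangles.

(** * Planar Lebesgue measure, the Poisson law and Poisson measures *)

Section planar.
Context {R : realType}.
Definition planar_measure : set (measurableTypeR R * measurableTypeR R)%type -> \bar R :=
  product_measure1 (@lebesgue_measure R) (@lebesgue_measure R).
HB.instance Definition _ := Measure.on planar_measure.

Lemma planar_measureX (A B : set (measurableTypeR R)) : measurable A -> measurable B ->
  planar_measure (A `*` B) = (lebesgue_measure A * lebesgue_measure B)%E.
Proof. exact: product_measure1E. Qed.

Lemma planar_measure_sigma_finite : sigma_finite setT planar_measure.
Proof.
pose I n : set (measurableTypeR R) := `[- n%:R, n%:R]%classic.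
have mI n : measurable (I n) by exact: measurable_itv.
exists (fun n => I n `*` I n).
  apply/esym; rewrite -subTset => -[a b] _ /=.
  exists (maxn (Num.bound a) (Num.bound b)) => //.
  have h (c : R) m : (Num.bound c <= m)%N -> - m%:R <= c <= m%:R.
    move=> cm; rewrite lerNl (le_trans (ltW (ltrNbound _))) ?ler_nat//=.
    by rewrite (le_trans (ltW (ltr_bound _))) ?ler_nat.
  by split; rewrite /I /= in_itv; apply: h; rewrite ?leq_maxl ?leq_maxr.
move=> n; split; first exact: measurableX.
rewrite planar_measureX// /I !lebesgue_measure_itv/=.
by case: ifPn => _; rewrite ?mul0e// -EFinD -EFinM ltry.
Qed.

HB.instance Definition _ := Measure_isSigmaFinite.Build _ _ _ planar_measure planar_measure_sigma_finite.
End planar.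

Section poisson_law.
Context {R : realType}.
Local Open Scope ereal_scope.

Lemma poisson_prob_pmf (r : R) k : (0 < r)%R ->
  poisson_prob r 0%N [set k] = (poisson_pmf r k)%:E.
Proof.
by move=> r0; rewrite /poisson_prob r0 esum_set1// lee_fin poisson_pmf_ge0.
Qed.

Lemma poisson_prob_series (r : R) :
  \sum_(k <oo) poisson_prob r 0%N [set k] = 1.
Proof.
have <- : poisson_prob r 0%N [set: nat] = 1 by exact: probability_setT.
have -> : [set: nat] = \bigcup_k [set k].
  by apply/esym; rewrite -subTset => k _; exists k.
apply: cvg_lim => //.
apply: (@measure_semi_sigma_additive _ _ _ (poisson_prob r 0%N)) => //.
by apply/trivIsetP => i j _ _ ij; apply/seteqP; split=> // n [/= -> /eqP]; rewrite (negbTE ij).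
Qed.

(** Shift by one: [k + 1] times the mass at [k + 1] is [r] times the mass at [k]. Rate 0, where
    [poisson_prob] is a Dirac mass, is treated apart. *)
Lemma poisson_prob_mean (r : R) : (0 <= r)%R ->
  \sum_(k <oo) k%:R%:E * poisson_prob r 0%N [set k] = r%:E.
Proof.
rewrite le_eqVlt => /predU1P[<-|r0].
  rewrite eseries0// => -[|k] _ _; first by rewrite mul0e.
  by rewrite /poisson_prob ltxx diracE memNset ?mule0.
rewrite nneseries_recl//; last by move=> k _; rewrite mule_ge0// lee_fin ler0n.
rewrite mul0e add0e -[RHS]mule1 -(poisson_prob_series r).
rewrite -nneseriesZl//; rewrite -(nneseries_addn 1)//; last first.
  by move=> k; rewrite mule_ge0// lee_fin ler0n.
apply: eq_eseriesr => k _; rewrite addn1 !poisson_prob_pmf//.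
rewrite -!EFinM; congr (_%:E); rewrite /poisson_pmf r0 factS exprS natrM invfM.
have : (k.+1%:R : R) != 0%R by rewrite pnatr_eq0.
have : (k`!%:R : R) != 0%R by rewrite pnatr_eq0 -lt0n fact_gt0.
move: (k.+1%:R : R) (k`!%:R : R) (expR (- r)) => a b c b0 a0.
by field; rewrite a0 b0.
Qed.

End poisson_law.

Section poisson_measure.
Context {R : realType} {dO : measure_display} {Omega : measurableType dO}.
Variables (P : probability Omega R) (F : R -> set (set Omega)).
Variable pi : R.-ker Omega ~> (R * R)%type.
Hypotheses (hF : filtration F) (hpi : filtered_poisson_measure P F pi).
Local Open Scope ereal_scope.
Local Notation nu := (@planar_measure R).

Let law (B : set (R * R)) k : measurable B -> B `<=` quadrant -> nu B < +oo ->
  P [set w | pi w B = (k%:R)%:E] = poisson_prob (fine (nu B)) 0%N [set k].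
Proof. by move=> mB Bq Boo; have [[+ _] _ _] := hpi; exact. Qed.

Let level_measurable (B : set (R * R)) y : measurable B ->
  measurable [set w | pi w B = y].
Proof.
move=> mB; rewrite -[X in measurable X]setTI.
exact: (measurable_kernel pi B mB measurableT [set y]).
Qed.

Let level_trivIset (B : set (R * R)) :
  trivIset setT (fun k : nat => [set w | pi w B = (k%:R)%:E]).
Proof.
apply/trivIsetP => i j _ _ ij; apply/seteqP; split=> // w [/= -> [] /eqP].
by rewrite eqr_nat (negbTE ij).
Qed.

(** The level sets of [pi w B] at the integers are disjoint and their Poisson probabilities add up
    to 1. *)
Lemma poisson_measure_nat (B : set (R * R)) : measurable B -> B `<=` quadrant ->
  nu B < +oo -> {ae P, forall w, exists k : nat, pi w B = k%:R%:E}.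
Proof.
move=> mB Bq Boo.
pose E (k : nat) := [set w | pi w B = (k%:R)%:E].
have mE : measurable (\bigcup_k E k) by apply: bigcup_measurable => k _; exact: level_measurable.
exists (~` (\bigcup_k E k)); split.
- exact: measurableC.
- rewrite probability_setC//= (_ : P _ = 1) ?subee//.
  rewrite -(poisson_prob_series (fine (nu B))).
  apply/esym/cvg_lim => //.
  rewrite [X in X @ _ --> _](_ : _ = fun n => \sum_(0 <= i < n) P (E i)); last first.
    by apply/funext => n; apply: eq_bigr => i _; rewrite law.
  apply: measure_semi_sigma_additive => //; last exact: level_trivIset.
  by move=> k; exact: level_measurable.
- by move=> w /= h [k _ Ek]; apply: h; exists k.
Qed.

(** Decompose [pi w B] over its integer values; as [B] lies strictly after time [s], each level set
    is independent of the event [A] of [F s], and the mean of the Poisson law appears. *)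
Lemma poisson_measure_mean s A (B : set (R * R)) : (0 <= s)%R -> F s A ->
  measurable B -> B `<=` `]s, +oo[ `*` `[0%R, +oo[ -> nu B < +oo ->
  \int[P]_(w in A) pi w B = P A * nu B.
Proof.
move=> s0 FA mB Bs Boo.
have Bq : B `<=` quadrant.
  move=> [u z] /Bs[/=]; rewrite !in_itv/= !andbT => su z0.
  by split; rewrite /= in_itv/= andbT// ltW// (le_lt_trans s0).
have mA : measurable A by have [_ Fm _] := hF; exact: Fm FA.
pose E (k : nat) := [set w | pi w B = (k%:R)%:E].
have mE k : measurable (E k) by exact: level_measurable.
pose g w := \sum_(k <oo) k%:R%:E * (\1_(E k) w : R)%:E.
have mg k : measurable_fun setT (fun w => k%:R%:E * (\1_(E k) w)%:E : \bar R).
  by apply: measurable_funeM; apply/measurable_EFinP.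
have gk0 k w : 0 <= k%:R%:E * (\1_(E k) w)%:E :> \bar R.
  by rewrite mule_ge0// lee_fin ?ler0n.
transitivity (\int[P]_(w in A) g w).
  apply: ae_eq_integral => //.
  - by apply: measurable_funTS; exact: measurable_kernel.
  - by apply: measurable_funTS; apply: ge0_emeasurable_sum => // k w _ _; exact: gk0.
  have := poisson_measure_nat mB Bq Boo; apply: filterS => w [k wk] _.
  rewrite /g (@nneseriesD1 _ _ k xpredT)//.
  rewrite indicE mem_set// mule1 eseries0 ?adde0 ?wk// => i _ /= ik.
  rewrite indicE memNset ?mule0// /E/= wk => -[/eqP].
  by rewrite eqr_nat eq_sym (negbTE ik).
rewrite /g integral_nneseries//; last by move=> k; exact: measurable_funTS.
transitivity (\sum_(k <oo) P A * (k%:R%:E * poisson_prob (fine (nu B)) 0%N [set k])).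
  apply: eq_eseriesr => k _.
  rewrite ge0_integralZl//; last by apply/measurable_EFinP; exact: measurable_funTS.
  rewrite integral_indic//= muleCA; congr (_ * _).
  rewrite -law//; have [_ _ ind] := hpi; rewrite setIC; apply: (ind s) => //.
  apply: sub_sigma_algebra; exists B, [set k%:R%:E]; split => //.
have PA : P A = (fine (P A))%:E by rewrite fineK// fin_num_measure.
rewrite PA nneseriesZl => [|k _]; last by rewrite mule_ge0// lee_fin ler0n.
rewrite poisson_prob_mean ?fine_ge0//; congr (_ * _); rewrite fineK//.
by rewrite ge0_fin_numE.
Qed.

End poisson_measure.

(** * Joint measures and measurability of sections for kernels of possibly infinite mass *)

Section kernel_extension.
Context d1 d2 (T1 : measurableType d1) (T2 : measurableType d2) (R : realType).
Variables (P : {measure set T1 -> \bar R}) (l : T1 -> {measure set T2 -> \bar R}).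
Hypothesis l_meas : forall S : set (T1 * T2), measurable S ->
  measurable_fun setT (fun w => l w (xsection S w)).
Local Open Scope ereal_scope.

(** The joint measure [P(dw) l(w, dx)]. Its only input is measurability along sections, so it covers
    kernels that are not finite. *)
Definition kernel_extension (S : set (T1 * T2)) : \bar R :=
  \int[P]_w l w (xsection S w).

Let ext0 : kernel_extension set0 = 0.
Proof. by apply: integral0_eq => w _; rewrite xsection0 measure0. Qed.

Let ext_ge0 S : 0 <= kernel_extension S.
Proof. by apply: integral_ge0 => w _; exact: measure_ge0. Qed.

Let ext_sigma_additive : semi_sigma_additive kernel_extension.
Proof.
move=> S mS tS mUS.
rewrite [X in _ --> X](_ : _ = \sum_(n <oo) kernel_extension (S n)).
  by apply/cvg_closeP; split; [exact: is_cvg_nneseries|rewrite closeE].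
rewrite -integral_nneseries//; last by move=> n; exact: l_meas.
apply: eq_integral => x _; apply/esym/cvg_lim => //=; rewrite xsection_bigcup.
apply: (measure_sigma_additive _ (trivIset_xsection tS)) => ?.
exact: measurable_xsection.
Qed.

Definition kernel_extension_mixin := isMeasure.Build _ _ _ kernel_extension
  ext0 ext_ge0 ext_sigma_additive.
Definition kernel_extension_measure : {measure set (T1 * T2) -> \bar R} :=
  HB.pack kernel_extension kernel_extension_mixin.

End kernel_extension.

Section truncated_kernel.
Context d1 d2 (T1 : measurableType d1) (T2 : measurableType d2) (R : realType).
Variables (pi : R.-ker T1 ~> T2) (B : set T2) (mB : measurable B) (m : nat).
Local Open Scope ereal_scope.

(** Discarding the [w] where [B] has mass above [m] produces a finite kernel, for which
    measurability of sections is available. *)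
Definition truncated_kernel (w : T1) : {measure set T2 -> \bar R} :=
  if pi w B <= m%:R%:E then (mrestr (pi w) mB : {measure set T2 -> \bar R})
  else mzero.

Let trunc_meas U : measurable U -> measurable_fun setT (truncated_kernel ^~ U).
Proof.
move=> mU.
have -> : truncated_kernel ^~ U =
    fun w => if pi w B <= m%:R%:E then pi w (U `&` B) else 0.
  by apply/funext => w; rewrite /truncated_kernel; case: ifPn.
apply: measurable_fun_ifT => //.
  by apply: measurable_fun_lee => //; exact: measurable_kernel.
by apply: measurable_kernel; exact: measurableI.
Qed.

HB.instance Definition _ :=
  isKernel.Build _ _ T1 T2 R truncated_kernel trunc_meas.

Let trunc_uub : measure_fam_uub truncated_kernel.
Proof.
exists (m.+1%:R)%R => w; rewrite /truncated_kernel; case: ifPn => h /=.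
  by rewrite /mrestr setTI (le_lt_trans h)// lte_fin ltr_nat.
by rewrite /mzero lte_fin ltr0n.
Qed.

HB.instance Definition _ :=
  Kernel_isFinite.Build _ _ T1 T2 R truncated_kernel trunc_uub.

Lemma truncated_kernel_xsection (S : set (T1 * T2)) : measurable S ->
  measurable_fun setT (fun w => truncated_kernel w (xsection S w)).
Proof.
move=> mS; have := @measurable_fun_xsection_finite_kernel _ _ _ _ _ truncated_kernel S.
by apply; rewrite inE.
Qed.

End truncated_kernel.

Section sigma_finite_xsection.
Context d1 d2 (T1 : measurableType d1) (T2 : measurableType d2) (R : realType).
Variables (pi : R.-ker T1 ~> T2) (B : (set T2)^nat).
Hypotheses (mB : forall n, measurable (B n)) (ndB : nondecreasing_seq B).
Local Open Scope ereal_scope.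

Let good w := `[< forall n, pi w (B n) < +oo >].

Lemma measurable_good : measurable_fun setT good.
Proof.
apply: (measurable_fun_bool true) => //; rewrite setTI.
have -> : good @^-1` [set true] = \bigcap_n [set w | pi w (B n) < +oo].
  apply/seteqP; split => w /=; first by move=> /asboolP h n _; exact: h.
  by move=> h; apply/asboolP => n; exact: h.
apply: bigcapT_measurable => n; rewrite -[X in measurable X]setTI.
by apply: emeasurable_fun_infty_o => //; exact: measurable_kernel.
Qed.

(** A double limit of finite kernels: first in the truncation level [m], which is eventually
    inactive at each good [w], then in [n] by continuity from below along the increasing [B n]. *)
Lemma measurable_sigma_finite_xsection (S : set (T1 * T2)) : measurable S ->
  measurable_fun setT (fun w => if good w then
    pi w (xsection S w `&` \bigcup_n B n) else 0).
Proof.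
move=> mS.
have mSB n w : measurable (xsection S w `&` B n).
  by apply: measurableI => //; exact: measurable_xsection.
apply: (@emeasurable_fun_cvg _ _ _ _
  (fun n w => if good w then pi w (xsection S w `&` B n) else 0)); last first.
  move=> w _; case: ifPn => _; last exact: cvg_cst.
  rewrite setI_bigcupr; apply: nondecreasing_cvg_mu => //.
    by apply: bigcupT_measurable.
  by move=> i j ij; apply/subsetPset; apply: setIS; apply/subsetPset; exact: ndB.
move=> n; apply: (@emeasurable_fun_cvg _ _ _ _
  (fun m w => if good w then truncated_kernel pi (mB n) m w (xsection S w) else 0)).
  move=> m; apply: measurable_fun_ifT => //; first exact: measurable_good.
  exact: truncated_kernel_xsection.
move=> w _; case: ifPn => gw; last exact: cvg_cst.
have Boo : pi w (B n) \is a fin_num.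
  by rewrite ge0_fin_numE//; move/asboolP: gw; exact.
apply: cvg_near_cst; near=> m.
rewrite /truncated_kernel ifT//.
rewrite -(fineK Boo) lee_fin (le_trans (ltW (ltr_bound _)))// ler_nat.
by near: m; exact: nbhs_infty_ge.
Unshelve. all: by end_near. Qed.

End sigma_finite_xsection.

(** * The compensation formula for a Poisson measure *)

Section compensation.
Context {R : realType} {dO : measure_display} {Omega : measurableType dO}.
Variables (P : probability Omega R) (F : R -> set (set Omega)).
Variable pi : R.-ker Omega ~> (R * R)%type.
Hypotheses (hF : filtration F) (hpi : filtered_poisson_measure P F pi).
Local Open Scope ereal_scope.
Local Notation nu := (@planar_measure R).
Local Notation RR := (measurableTypeR R * measurableTypeR R)%type.

Definition region (s t : R) (h : R -> \bar R) : set (R * R) :=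
  [set q | [/\ (s < q.1 <= t)%R, (0 <= q.2)%R & q.2%:E <= h q.1]].

Lemma planar_measure_region s t h : (forall u, 0 <= h u) ->
  nu (region s t h) = \int[lebesgue_measure]_(u in `]s, t]) h u.
Proof.
move=> h0; rewrite [RHS]integral_mkcond; apply: eq_integral => u _.
rewrite patchE; case: ifPn => [|/negP]; rewrite inE/= in_itv/= => sut.
  have : xsection (region s t h) u = [set z | (0 <= z)%R /\ z%:E <= h u].
    by apply/seteqP; split => z; rewrite /xsection/= inE /region/=; [case|move=> []].
  move=> /= ->; have := h0 u; case: (h u) => [r r0|_|//].
    rewrite [X in lebesgue_measure X](_ : _ = `[0%R, r]%classic).
      rewrite lebesgue_measure_itv/= lte_fin; case: ltgtP r0 => [||<-]//=.
        by rewrite oppr0 adde0.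
      by rewrite lee_fin => h1 h2; have := lt_le_trans h1 h2; rewrite ltxx.
    by apply/seteqP; split => z /=; rewrite in_itv/= lee_fin => /andP.
  rewrite [X in lebesgue_measure X](_ : _ = `[0%R, +oo[%classic).
    by rewrite lebesgue_measure_itv/= ltry.
  apply/seteqP; split => z /=; rewrite in_itv/= andbT; first by case.
  by move=> z0; rewrite leey.
have -> : xsection (region s t h) u = set0; last by rewrite /= measure0.
by apply/seteqP; split => z //; rewrite /xsection/= inE => -[].
Qed.

Section horizon.
Variable T : R.

Let box n : set (R * R) := `]0%R, T] `*` `[0%R, n%:R].
Let strip : set (R * R) := `]0%R, T] `*` `[0%R, +oo[.

Let box_meas n : measurable (box n).
Proof. by apply: measurableX; exact: measurable_itv. Qed.

Let strip_meas : measurable strip.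
Proof. by apply: measurableX; exact: measurable_itv. Qed.

Let box_nd : nondecreasing_seq box.
Proof.
move=> m n mn; apply/subsetPset => -[u z] [/= uT]; rewrite !in_itv/= => /andP[z0 zm].
by split => //=; rewrite in_itv/= z0 (le_trans zm)// ler_nat.
Qed.

Let strip_box : strip = \bigcup_n box n.
Proof.
apply/seteqP; split => [[u z] [/= uT]|[u z] [n _ [/= uT]]]; rewrite !in_itv/=.
  rewrite andbT => z0; exists (Num.bound z) => //; split => //=.
  by rewrite in_itv/= z0 ltW// ltr_bound.
by move=> /andP[z0 _]; split => //=; rewrite in_itv/= z0.
Qed.

Let box_fin n : nu (box n) < +oo.
Proof.
have := @planar_measureX R `]0%R, T]%classic `[0%R, n%:R]%classic (measurable_itv _) (measurable_itv _).
rewrite /box => ->; rewrite !lebesgue_measure_itv/=.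
by case: ifPn => _; case: ifPn => _; rewrite ?mule0 ?mul0e// -!EFinD -EFinM ltry.
Qed.

Lemma poisson_boxes_finite :
  {ae P, forall w, forall n, pi w (box n) < +oo}.
Proof.
apply: ae_foralln => n.
have bq : box n `<=` quadrant.
  move=> [u z] [/=]; rewrite !in_itv/= => /andP[u0 _] /andP[z0 _].
  by split; rewrite /= in_itv/= andbT// ltW.
have := poisson_measure_nat hpi (box_meas n) bq (box_fin n).
by apply: filterS => w [k ->]; rewrite ltry.
Qed.

Let good w := `[< forall n, pi w (box n) < +oo >].

Let stripped w := mrestr (pi w) strip_meas.

(** A copy of [stripped w] whose domain has the display of the product measure. *)
Let restripped w : {measure set RR -> \bar R} := HB.pack_for
  {measure set RR -> \bar R} (stripped w : set RR -> \bar R)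
  (isMeasure.Build _ RR R (stripped w) (measure0 (stripped w))
    (measure_ge0 (stripped w)) (@measure_semi_sigma_additive _ _ _ (stripped w))).

(** On the null set where some box has infinite mass the measure is replaced by 0, so that
    measurability of sections holds over all of [Omega]. *)
Let l w : {measure set RR -> \bar R} := if good w then restripped w else mzero.

Let lE w X : l w X = if good w then pi w (X `&` strip) else 0.
Proof. by rewrite /l; case: ifPn. Qed.

Let l_meas (S : set (Omega * RR)) : measurable S ->
  measurable_fun setT (fun w => l w (xsection S w)).
Proof.
move=> mS; have := measurable_sigma_finite_xsection pi box_meas box_nd mS.
by rewrite -strip_box; congr (measurable_fun _ _); apply/funext => w; rewrite lE.
Qed.

Let m1 : {measure set (Omega * RR) -> \bar R} :=
  kernel_extension_measure P l_meas.

Let cyl_meas : measurable (setT `*` strip : set (Omega * RR)).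
Proof. by apply: measurableX => //; exact: strip_meas. Qed.

Let m2 : {measure set (Omega * RR) -> \bar R} :=
  mrestr (product_measure1 P nu) cyl_meas.

(** On a generator this is the independence of [F s] and of the Poisson measure
    after time [s]. *)
Lemma thickened_measure_eq (S : set (Omega * RR)) :
  <<s thickened_rectangles F >> S -> m1 S = m2 S.
Proof.
have agree (B : set (Omega * RR)) : thickened_rectangles F B ->
    m1 B = m2 B /\ m2 B < +oo.
  move=> thB; have mB : measurable B by exact: (thickened_rectangles_measurable hF thB).
  move: thB => [D [C [n [PD mC Cn BE]]]].
  (* Times in the strip are positive, so the generator [setT] behaves like a rectangle with [s = 0]
     and [A = setT]. *)
  have [s [A [s0 FA DE]]] : exists s A, [/\ (0 <= s)%R, F s A &
      forall w u, (0 < u)%R -> D (w, u) <-> A w /\ (s < u)%R].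
    move: PD => [->|[s [A [s0 FA ->]]]].
      by exists 0%R, setT; split => //; exact: filtrationT.
    by exists s, A; split => // w u u0; rewrite /= in_itv/= andbT.
  have mA : measurable A by have [_ Fm _] := hF; exact: Fm FA.
  pose C0 := C `&` `[0%R, +oo[%classic.
  have mC0 : measurable C0 by apply: measurableI => //; exact: measurable_itv.
  pose Q : set (R * R) := `]s, T] `*` C0.
  have mQ : measurable Q by apply: measurableX => //; exact: measurable_itv.
  have QE : nu Q = lebesgue_measure (`]s, T]%classic : set (measurableTypeR R)) *
      lebesgue_measure (C0 : set (measurableTypeR R)).
    by apply: planar_measureX => //; exact: measurable_itv.
  have Qoo : nu Q < +oo.
    rewrite QE lebesgue_measure_itv/=.
    have : lebesgue_measure (C0 : set (measurableTypeR R)) < +oo.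
      apply: (@le_lt_trans _ _ (lebesgue_measure (`[(- n%:R)%R, n%:R]%classic : set R))).
        apply: le_measure; rewrite ?inE//;
          first [exact: measurable_itv | by move=> z [/Cn]].
      by rewrite lebesgue_measure_itv/=; case: ifPn => // _; rewrite -EFinD ltry.
    rewrite -ge0_fin_numE// => Cfin.
    by case: ifPn => _; rewrite ?mul0e//; rewrite -(fineK Cfin) -EFinD -EFinM ltry.
  have Bsec w : xsection B w `&` strip = if w \in A then Q else set0.
    case: ifPn => [|/negP]; rewrite inE => Aw.
      apply/seteqP; split => [[u z]|[u z]].
        rewrite /xsection/= inE BE/= /strip/= !in_itv/= !andbT => -[[Dwu Cz] [/andP[u0 uT] z0]].
        have [_ su] := (DE w u u0).1 Dwu.
        by split; [rewrite /= in_itv/= su|split => //=; rewrite in_itv/= z0].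
      rewrite /Q /C0 /xsection/= inE BE/= /strip/= !in_itv/= !andbT => -[/andP[su uT] [Cz z0]].
      have u0 : (0 < u)%R by rewrite (le_lt_trans s0).
      by split; split => //; [apply/(DE w u u0)|rewrite u0].
    rewrite -subset0 => -[u z]; rewrite /xsection/= inE BE/= /strip/= !in_itv/=.
    move=> [[Dwu _] [/andP[u0 _] _]].
    by have [Aw' _] := (DE w u u0).1 Dwu.
  have m2B : m2 B = P A * nu Q.
    have BQ : B `&` (setT `*` strip) = A `*` Q.
      apply/seteqP; split => [[w q] [Bwq [_ sq]]|[w q] [/= Aw Qq]].
        have : (xsection B w `&` strip) q by split => //; rewrite /xsection/= inE.
        by rewrite Bsec; case: ifPn => //; rewrite inE.
      have : (xsection B w `&` strip) q by rewrite Bsec mem_set.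
      by rewrite /xsection => -[/=]; rewrite inE => ? ?; split.
    rewrite /m2/= /mrestr BQ.
    exact: (@product_measure1E _ _ Omega RR R P nu A Q mA mQ).
  split.
    rewrite m2B -(poisson_measure_mean hF hpi s0 FA mQ _ Qoo); last first.
      move=> [u z] [/= + [_ /=]]; rewrite !in_itv/= !andbT => /andP[su _] z0.
      by split; rewrite /= ?su ?z0.
    rewrite [RHS]integral_mkcond; apply: ae_eq_integral => //.
    - exact: l_meas.
    - by apply/(measurable_restrictT _ _).1 => //; apply: measurable_funTS; exact: measurable_kernel.
    - have := poisson_boxes_finite; apply: filterS => w gw _.
      rewrite lE ifT; last by apply/asboolP.
      by rewrite Bsec patchE; case: ifPn => //; rewrite measure0.
  rewrite -ge0_fin_numE// in Qoo.
  by rewrite m2B -(fineK (fin_num_measure P A mA)) -(fineK Qoo) -EFinM ltry.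
pose G := thickened_rectangles F : set (set (Omega * RR)).
pose g n : set (Omega * RR) := [set p | `[(- n%:R)%R, n%:R]%classic p.2.2].
move=> GS; apply: (@g_sigma_algebra_measure_unique _ R (Omega * RR)%type G
  _ g _ _ m1 m2 _ _ _ S GS).
- exact: thickened_rectangles_measurable.
- move=> n; exists setT, `[(- n%:R)%R, n%:R]%classic, n; split => //.
  + by left.
  + by apply/seteqP; split => p //= [].
- rewrite -subTset => p _; exists (Num.bound (p.2.2 : R)) => //.
  by rewrite /g /= in_itv/= lerNl !ltW ?ltrNbound ?ltr_bound.
- exact: thickened_rectanglesI.
- by move=> B /agree[].
- move=> n.
  have [|-> //] := agree (g n).
  exists setT, `[(- n%:R)%R, n%:R]%classic, n; split => //.
  + by left.
  + by apply/seteqP; split => p //= [].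
Qed.

(** Evaluate the two measures on the set [S] of points of [A] and of []s, T]] lying below the graph
    of [H]. It is a marked predictable set; its sections over [A] have [pi]-mass [Y] and area the
    integral of [H]. *)
Lemma compensation s A (H : Omega * R -> \bar R) (Y : Omega -> \bar R) :
  (0 <= s <= T)%R -> F s A ->
  measurable_fun [set: predictable_space F] (H : predictable_space F -> \bar R) ->
  (forall p, 0 <= H p) -> measurable_fun setT Y ->
  {ae P, forall w, Y w = pi w (region s T (fun u => H (w, u)))} ->
  \int[P]_(w in A) Y w =
  \int[P]_(w in A) \int[lebesgue_measure]_(u in `]s, T]) H (w, u).
Proof.
move=> /andP[s0 sT] FA mH H0 mY YE.
have mA : measurable A by have [_ Fm _] := hF; exact: Fm FA.
pose S : set (Omega * RR) := [set p | A p.1 /\ region s T (fun u => H (p.1, u)) p.2].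
have mS : <<s thickened_rectangles F >> S.
  have sub (D : set (Omega * R)) : @measurable _ (predictable_space F) D ->
      @measurable _ (thickened_space F) [set p | D (p.1, p.2.1)].
    by move=> mD; have := measurable_thickened_fst measurableT mD; rewrite setTI.
  (* The interval []s, T]] is cut out as a difference of two half-lines, the only time sets among
     the generators. *)
  pose D1 : set (Omega * R) := A `*` `]s, +oo[%classic.
  pose D2 : set (Omega * R) := setT `*` `]T, +oo[%classic.
  have mD1 : @measurable _ (predictable_space F) D1.
    by apply: sub_sigma_algebra; right; exists s, A.
  have mD2 : @measurable _ (predictable_space F) D2.
    apply: sub_sigma_algebra; right; exists T, setT; split => //.
      exact: le_trans s0 sT.
    by apply: filtrationT => //; exact: le_trans s0 sT.
  have mz : @measurable _ (thickened_space F) [set p | `[0%R, +oo[%classic p.2.2].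
    have := @measurable_thickened_snd R dO Omega F measurableT `[0%R, +oo[%classic (measurable_itv _).
    by rewrite setTI.
  have mzH : @measurable _ (thickened_space F)
      [set p | (p.2.2)%:E <= H (p.1, p.2.1)].
    rewrite -[X in measurable X]setTI; apply: measurable_lee => //.
      by apply/measurable_EFinP; exact: measurable_thickened_snd.
    by move=> _ U mU; have := mH measurableT _ mU; rewrite !setTI => /sub.
  have -> : S = ([set p | D1 (p.1, p.2.1)] `\` [set p | D2 (p.1, p.2.1)]) `&`
      ([set p | `[0%R, +oo[%classic p.2.2] `&` [set p | (p.2.2)%:E <= H (p.1, p.2.1)]).
    apply/seteqP; split => [[w [u z]]|[w [u z]]];
      rewrite /S /region /D1 /D2 /= !in_itv/= !andbT.
      move=> [Aw [/andP[su uT] z0 zH]]; split=> //; split=> //.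
      by move=> []; rewrite ltNge uT.
    move=> [[[Aw su] uT] [z0 zH]]; split=> //; split=> //.
    by rewrite su/= leNgt; apply/negP => Tu; exact: uT.
  apply: (@measurableI _ (thickened_space F)); last exact: measurableI.
  by apply: (@measurableD _ (thickened_space F)); exact: sub.
have mS' : measurable S.
  have := smallest_sub (@sigma_algebra_measurable _ (Omega * (R * R))%type)
    (thickened_rectangles_measurable hF).
  exact.
have Ssec w : xsection S w = if w \in A then region s T (fun u => H (w, u)) else set0.
  case: ifPn => [|/negP]; rewrite inE => Aw.
    by apply/seteqP; split => q; rewrite /xsection/= inE /S/= => -[].
  by rewrite -subset0 => q; rewrite /xsection/= inE /S/= => -[].
have reg_strip h : region s T h `<=` strip.
  move=> [u z] [/= /andP[su uT] z0 _]; split; rewrite /= in_itv/= ?z0//.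
  by rewrite uT (le_lt_trans s0).
have := thickened_measure_eq mS.
have -> : m1 S = \int[P]_(w in A) Y w.
  rewrite [RHS]integral_mkcond; apply: ae_eq_integral => //.
  - exact: l_meas.
  - by apply/(measurable_restrictT _ _).1 => //; exact: measurable_funTS.
  - apply: filterS2 YE poisson_boxes_finite => w YE gw _.
    rewrite lE ifT; last by apply/asboolP.
    rewrite Ssec patchE; case: ifPn => _; last by rewrite set0I measure0.
    by rewrite YE setIidl.
move=> ->.
rewrite /m2/= /mrestr [RHS]integral_mkcond; apply: eq_integral => w _.
rewrite /= patchE -(planar_measure_region _ _ (fun u => H0 (w, u))).
have -> : xsection (S `&` setT `*` strip) w = xsection S w.
  apply/seteqP; split => q; rewrite /xsection/= !inE; first by case.
  by move=> Sq; split => //; split => //; case: Sq => _ /reg_strip.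
by rewrite Ssec; case: ifPn => _ //; rewrite measure0.
Qed.

End horizon.
End compensation.

Lemma cvg_seq_sum {R : realType} {T I : Type} {F : set_system T} {FF : Filter F}
    (r : seq I) (f : I -> T -> R) (l : I -> R) :
  (forall i, f i t @[t --> F] --> l i) ->
  \sum_(i <- r) f i t @[t --> F] --> \sum_(i <- r) l i.
Proof.
move=> fl; elim: r => [|i r IH].
  by under eq_fun do rewrite big_nil; rewrite big_nil; exact: cvg_cst.
under eq_fun do rewrite big_cons; rewrite big_cons; exact: cvgD.
Qed.

(** * Sums of counting paths *)

Section total_path.
Context {R : realType} {I : choiceType}.

Lemma esum_seq (f : I -> \bar R) (r : seq I) : uniq r ->
  (forall i, 0 <= f i)%E -> (forall i, i \notin r -> f i = 0%E) ->
  (\esum_(i in [set: I]) f i = \sum_(i <- r) f i)%E.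
Proof.
move=> ur f0 fr; rewrite fsbig_seq// -esum_fset//.
rewrite [RHS]esum_mkcond; apply: eq_esum => i _.
by case: ifPn => //; rewrite mem_setE => /fr.
Qed.

(** Every non-zero term is at least 1, so infinitely many of them would exceed any bound. *)
Lemma nat_esum_finite_support (f : I -> R) : (forall i, exists n : nat, f i = n%:R) ->
  (\esum_(i in [set: I]) (f i)%:E < +oo)%E ->
  exists2 r : seq I, uniq r & forall i, i \notin r -> f i = 0.
Proof.
move=> fnat fsum.
have f0 i : 0 <= f i by have [n ->] := fnat i; rewrite ler0n.
have [/finite_fsetP[X XE]|inf] := pselect (finite_set [set i | f i != 0]).
  exists (finmap.enum_fset X) => [|i iX]; first exact: finmap.fset_uniq.
  apply/eqP; apply: contraNT iX => fi.
  have : [set i | f i != 0] i by [].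
  by rewrite XE.
exfalso; have sum0 : (0 <= \esum_(i in [set: I]) (f i)%:E)%E.
  by apply: esum_ge0 => i _; rewrite lee_fin.
have sfin : \esum_(i in [set: I]) (f i)%:E \is a fin_num by rewrite ge0_fin_numE.
pose N := Num.bound (fine (\esum_(i in [set: I]) (f i)%:E)).
have sN : (\esum_(i in [set: I]) (f i)%:E < N%:R%:E)%E.
  by rewrite -(fineK sfin) lte_fin ltr_bound.
have [B BA NB] := infinite_set_fset N inf.
have : (N%:R%:E <= \esum_(i in [set: I]) (f i)%:E)%E.
  apply: esum_ge; exists [set` finmap.enum_fset B]; first by split => //; apply/finite_seqP; eexists.
  rewrite -(fsbig_seq _ _ (finmap.fset_uniq B)) sumEFin lee_fin.
  rewrite (le_trans (_ : _ <= (size (finmap.enum_fset B))%:R))// ?ler_nat//.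
  rewrite -sum1_size natr_sum big_seq [leRHS]big_seq ler_sum// => i iB.
  have : f i != 0 := BA i iB.
  by have [n ->] := fnat i; rewrite pnatr_eq0 -lt0n ler1n.
by rewrite leNgt sN.
Qed.

Variable z : I -> R -> R.
Hypothesis cz : forall i, counting_path (z i).
Hypothesis z0 : forall i, z i 0 = 0.
Hypothesis zsum : forall t, 0 <= t -> (\esum_(i in [set: I]) (z i t)%:E < +oo)%E.

Definition total_path (t : R) : R := fine (\esum_(i in [set: I]) (z i t)%:E).

(** By monotonicity a site with no jump by time [T] had none earlier, so the finite support at [T]
    serves the whole interval [[0, T]]. *)
Lemma total_path_seq T : 0 <= T -> exists2 r : seq I, uniq r &
  forall t, 0 <= t <= T -> [/\ forall i, i \notin r -> z i t = 0,
    \esum_(i in [set: I]) (z i t)%:E = (total_path t)%:E &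
    total_path t = \sum_(i <- r) z i t].
Proof.
move=> T0.
have [|r ur zr] := @nat_esum_finite_support (z ^~ T) _ (zsum T0).
  by move=> i; have [+ _ _ _] := cz i; exact.
exists r => // t /andP[t0 tT].
have zge0 i s : 0 <= s -> 0 <= z i s.
  by move=> s0; have [+ _ _ _] := cz i => /(_ s s0)[n ->]; rewrite ler0n.
have zt i : i \notin r -> z i t = 0.
  move=> ir; apply/eqP; rewrite eq_le zge0// andbT -(zr i ir).
  by have [_ + _ _] := cz i; exact.
have E : (\esum_(i in [set: I]) (z i t)%:E = (\sum_(i <- r) z i t)%:E)%E.
  rewrite (esum_seq ur) ?sumEFin// => i; first by rewrite lee_fin zge0.
  by move=> /zt ->.
by split => //; rewrite /total_path E.
Qed.

Lemma total_path0 : total_path 0 = 0.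
Proof.
have [r _ h] := total_path_seq (lexx 0).
have [|_ _ ->] := h 0; first by rewrite lexx.
by rewrite big1.
Qed.

Let jump (x : R -> R) t := x t - lim (x r @[r --> t^'-]).

Hypothesis nosim : forall t i j, 0 < t -> i != j ->
  jump (z i) t = 0 \/ jump (z j) t = 0.

(** Locally in time the sum is finite, so limits are taken term by term; at any time at most one
    term jumps, by [nosim], and its jump is 1. *)
Lemma counting_total_path : counting_path total_path.
Proof.
have Xnd s t : 0 <= s -> s <= t -> total_path s <= total_path t.
  move=> s0 st; have [r _ h] := total_path_seq (le_trans s0 st).
  have [|_ _ ->] := h s; first by rewrite s0.
  have [|_ _ ->] := h t; first by rewrite (le_trans s0)//=.
  by apply: ler_sum => i _; have [_ + _ _] := cz i; exact.
have Xleft r t : 0 < t ->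
    (forall s, 0 <= s <= t -> total_path s = \sum_(i <- r) z i s) ->
    total_path s @[s --> t^'-] --> \sum_(i <- r) lim (z i s @[s --> t^'-]).
  move=> t0 h; apply: (@cvg_trans _ ((\sum_(i <- r) z i s) @[s --> t^'-])).
    apply: near_eq_cvg; near=> s; rewrite h//.
    have s0 : 0 < s by near: s; exact: nbhs_left_gt.
    have st : s < t by near: s; exact: nbhs_left_lt.
    by rewrite !ltW.
  apply: cvg_seq_sum => i; have [_ _ [_ +] _] := cz i => /(_ t t0).
  by [].
split => //.
- move=> t t0; have [r _ h] := total_path_seq t0.
  have [|_ _ ->] := h t; first by rewrite t0 lexx.
  have /choice[n hn] i : exists n : nat, z i t = n%:R.
    by have [+ _ _ _] := cz i; exact.
  by exists (\sum_(i <- r) n i)%N; rewrite natr_sum; apply: eq_bigr.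
- split=> t t0.
    (* The right limit looks past [t], so the finite list of sites is taken up to [t + 1]. *)
    have t10 : 0 <= t + 1 by rewrite addr_ge0.
    have [r _ h] := total_path_seq t10.
    have [|_ _ ->] := h t; first by rewrite t0/= lerDl.
    apply: (@cvg_trans _ ((\sum_(i <- r) z i s) @[s --> t^'+])).
      apply: near_eq_cvg; near=> s.
      have [|_ _ -> //] := h s.
      apply/andP; split; first by rewrite (le_trans t0)//; near: s; exact: nbhs_right_ge.
      by near: s; apply: nbhs_right_le; rewrite ltrDl.
    by apply: cvg_seq_sum => i; have [_ _ [+ _] _] := cz i; exact.
  have [r _ h] := total_path_seq (ltW t0).
  apply/cvg_ex; eexists; apply: (Xleft r t t0) => s st.
  by have [] := h s st.
- move=> t t0; have [r ur h] := total_path_seq (ltW t0).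
  rewrite (cvg_lim _ (Xleft r t t0 _))//; last by move=> s st; have [] := h s st.
  have [|_ _ ->] := h t; first by rewrite lexx ltW.
  rewrite -sumrB.
  have [/hasP[i ir ji]|/hasPn none] := boolP (has (fun i => jump (z i) t != 0) r).
    rewrite (bigD1_seq i)//= big1 ?addr0 => [_|j ji_].
      by have [_ _ _ +] := cz i => /(_ t t0 ji).
    have [|//] := nosim t0 ji_ => [//|].
    by move=> e; move: ji; rewrite e eqxx.
  rewrite big_seq big1 ?eqxx// => i /none; rewrite negbK => /eqP.
  by [].
Unshelve. all: by end_near. Qed.

End total_path.

(** * Independent Poisson measures have no atoms at a common time *)

Section simultaneous_jumps.
Context {R : realType} {dO : measure_display} {Omega : measurableType dO}.
Variables (P : probability Omega R) (F : R -> set (set Omega)).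
Hypothesis hF : filtration F.
Local Open Scope ereal_scope.
Local Notation nu := (@planar_measure R).

Let nonnull_measurable (pi : R.-ker Omega ~> (R * R)%type) (B : set (R * R)) :
  measurable B -> measurable [set w | pi w B != 0].
Proof.
move=> mB; have -> : [set w | pi w B != 0] = (fun w => pi w B) @^-1` (~` [set 0]).
  by apply/seteqP; split => w /= /eqP.
rewrite -[X in measurable X]setTI.
by apply: (measurable_kernel pi B mB measurableT); exact: measurableC.
Qed.

(** Markov's inequality: [pi w B] is almost surely an integer, so it is at least 1 when non-zero,
    and its mean is [nu B]. *)
Lemma poisson_nonnull_le (pi : R.-ker Omega ~> (R * R)%type) (B : set (R * R)) :
  filtered_poisson_measure P F pi -> measurable B ->
  B `<=` `]0%R, +oo[ `*` `[0%R, +oo[ -> nu B < +oo ->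
  P [set w | pi w B != 0] <= nu B.
Proof.
move=> hpi mB B0 Boo; set E := [set w | _].
have mE : measurable E by exact: nonnull_measurable.
have Bq : B `<=` quadrant.
  move=> [u z] /B0[/=]; rewrite !in_itv/= !andbT => u0 z0.
  by split; rewrite /= in_itv/= andbT// ltW.
have mpi D : measurable_fun D (fun w => pi w B).
  by apply: measurable_funTS; exact: measurable_kernel.
have := poisson_measure_mean hF hpi (lexx 0%R) (filtrationT hF (lexx 0%R)) mB B0 Boo.
rewrite probability_setT mul1e => <-.
apply: (@le_trans _ _ (\int[P]_(w in E) pi w B)); last first.
  by apply: ge0_subset_integral => //; exact: mpi.
rewrite -[leLHS]mul1e -integral_cst//.
apply: ae_ge0_le_integral => //.
have := poisson_measure_nat hpi mB Bq Boo; apply: filterS => w [[|k] wk]; rewrite /E/= wk ?eqxx//.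
by rewrite lee_fin ler1n.
Qed.

Variables (I : eqType) (pi : I -> R.-ker Omega ~> (R * R)%type).
Hypothesis hpi : iid_poisson_measures P F pi.

Let slab (N m k : nat) : set (R * R) :=
  `](k%:R * (N%:R / m%:R))%R, (k.+1%:R * (N%:R / m%:R))%R] `*` `[0%R, N%:R].

Let slab_meas N m k : measurable (slab N m k).
Proof. by apply: measurableX; exact: measurable_itv. Qed.

Let slab_pos N m k : slab N m k `<=` `]0%R, +oo[ `*` `[0%R, +oo[.
Proof.
move=> [u z] [/=]; rewrite !in_itv/= => /andP[ku _] /andP[z0 _]; split => /=.
  by rewrite andbT (le_lt_trans _ ku)// mulr_ge0 ?divr_ge0// ler0n.
by rewrite z0.
Qed.

Let slabE N m k : nu (slab N m k) = (N%:R / m%:R * N%:R)%:E.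
Proof.
have Nm0 : (0 <= N%:R / m%:R :> R)%R by rewrite divr_ge0.
rewrite /slab planar_measureX; [|exact: measurable_itv..].
rewrite EFinM; congr (_ * _); rewrite lebesgue_measure_itv/= lte_fin.
  case: ltP => [_|]; first by rewrite -EFinD -mulrBl -natrB// subSnn mul1r.
  rewrite -natr1 mulrDl mul1r gerDl => h; congr (_%:E); apply/eqP.
  by rewrite eq_le Nm0 h.
by case: ltP => [_|h]; rewrite ?oppr0 ?adde0//; congr (_%:E); apply/eqP; rewrite eq_le h ler0n.
Qed.

Let both i j N m k := [set w | pi i w (slab N m k) != 0] `&`
  [set w | pi j w (slab N m k) != 0].

Let both_le i j N m k : i != j -> P (both i j N m k) <= ((N%:R / m%:R * N%:R) ^+ 2)%:E.
Proof.
move=> ij; have [hp indep] := hpi.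
have := indep [:: i; j] (fun l => [set w | pi l w (slab N m k) != 0]).
rewrite !big_cons big_nil mule1.
have -> : \bigcap_(l in [set l | l \in [:: i; j]]) [set w | pi l w (slab N m k) != 0] =
    both i j N m k.
  apply/seteqP; split => w /=.
    by move=> h; split; apply: h; rewrite /= !inE eqxx ?orbT.
  by move=> [wi wj] l /=; rewrite !inE => /orP[] /eqP ->.
move=> -> //; last 2 first.
- by rewrite /= inE ij.
- move=> l _; apply: sub_sigma_algebra.
  exists (slab N m k), (~` [set 0]); split => //.
  + move=> [u z] /slab_pos[/=]; rewrite !in_itv/= !andbT => u0 z0.
    by split; rewrite /= in_itv/= andbT// ltW.
  + exact: measurableC.
  + by apply/seteqP; split => w /= /eqP.
rewrite expr2 EFinM -(slabE N m k); apply: lee_pmul => //;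
  by apply: poisson_nonnull_le => //; rewrite slabE ltry.
Qed.

(** Cut []0, N]] into [m + 1] slabs, with marks at most [N]. Atoms at a common time charge one slab
    twice, which by independence has probability at most [(N^2 / (m + 1))^2]; summing over the slabs
    gives [N^4 / (m + 1)], which tends to 0. *)
Lemma no_simultaneous_atoms i j : i != j -> {ae P, forall w, forall t K : R,
  (0 < t)%R -> pi i w ([set t] `*` `[0%R, K]) = 0 \/
               pi j w ([set t] `*` `[0%R, K]) = 0}.
Proof.
move=> ij.
pose E N m := \bigcup_(k < m.+1) both i j N m.+1 k.
have mboth N m k : measurable (both i j N m k).
  by apply: measurableI; exact: nonnull_measurable.
have mE N m : measurable (E N m).
  by apply: bigcup_measurable => k _.
have E_le N m : P (E N m) <= (N%:R ^+ 4 / m.+1%:R)%:E.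
  rewrite /E bigcup_mkord; apply: (le_trans (Boole_inequality _ _)) => //.
  apply: (@le_trans _ _ (\sum_(k < m.+1) ((N%:R / m.+1%:R * N%:R) ^+ 2)%:E)).
    by apply: lee_sum => k _; exact: both_le.
  rewrite sumEFin lee_fin sumr_const card_ord le_eqVlt; apply/orP; left.
  apply/eqP; rewrite -[LHS]mulr_natl; have : (m.+1%:R : R) != 0%R by rewrite pnatr_eq0.
  by move: (m.+1%:R : R) => a a0; field.
have PE N : P (\bigcap_m E N m) = 0.
  apply/eqP; rewrite eq_le measure_ge0 andbT.
  apply/lee_addgt0Pr => e e0; rewrite add0e.
  pose m := Num.bound (N%:R ^+ 4 / e)%R.
  apply: (le_trans (_ : _ <= P (E N m))).
    apply: le_measure; rewrite ?inE//.
      by apply: bigcapT_measurable.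
    by move=> w; exact.
  apply: (le_trans (E_le N m)); rewrite lee_fin ler_pdivrMr ?ltr0n//.
  rewrite mulrC -ler_pdivrMr// (le_trans (ltW (ltr_bound _)))// ler_nat.
  exact: leqnSn.
exists (\bigcup_N \bigcap_m E N m); split.
- by apply: bigcupT_measurable => N; exact: bigcapT_measurable.
- apply/negligibleP; first by apply: bigcupT_measurable => N; exact: bigcapT_measurable.
  apply: negligible_bigcup => N; apply/negligibleP; last exact: PE.
  exact: bigcapT_measurable.
move=> w /= /existsNP[t /existsNP[K /not_implyP[t0 /not_orP[wi wj]]]].
pose N := (maxn (Num.bound t) (Num.bound K)).
have tN : (t < N%:R)%R.
  by rewrite (lt_le_trans (ltr_bound _))// ler_nat leq_maxl.
have KN : (K <= N%:R)%R.
  by rewrite ltW// (lt_le_trans (ltr_bound _))// ler_nat leq_maxr.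
have N0 : (0 < N%:R :> R)%R by exact: lt_trans tN.
exists N => // m _.
pose h := (N%:R / m.+1%:R : R)%R.
have h0 : (0 < h)%R by rewrite divr_gt0// ltr0n.
have ex : exists l : nat, (t <= l%:R * h)%R.
  exists m.+1; rewrite /h mulrC divfK ?pnatr_eq0//.
  exact: ltW.
(* The least [l] with [t <= l h] is the right end of the slab that contains [t]. It is positive as
   [t > 0], and the slab has index [l - 1]. *)
have [l tl lmin] := ex_minnP ex.
have lm : (l <= m.+1)%N.
  by apply: lmin; rewrite /h mulrC divfK ?pnatr_eq0// ltW.
case: l tl lmin lm => [|k] tl lmin km; first by move: tl; rewrite mul0r leNgt t0.
have kt : (k%:R * h < t)%R.
  by rewrite ltNge; apply/negP => /lmin; rewrite ltnn.
exists k => //.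
have sub : [set t] `*` `[0%R, K] `<=` slab N m.+1 k.
  move=> [u z] [/= ->]; rewrite in_itv/= => /andP[z0 zK]; split => /=.
    by rewrite in_itv/= kt tl.
  by rewrite in_itv/= z0 (le_trans zK).
have msub : measurable ([set t] `*` `[0%R, K] : set (R * R)).
  by apply: measurableX => //; exact: measurable_itv.
split; rewrite /=; apply/negP => /eqP s0; [apply: wi|apply: wj];
  by apply/eqP; rewrite eq_le measure_ge0 andbT -s0; apply: le_measure; rewrite ?inE.
Qed.

End simultaneous_jumps.

(** * Counting the points of a measure below a graph *)

Section thinning.
Context {R : realType}.
Variables (m : {measure set (R * R)%type -> \bar R}) (h : R -> \bar R).
Hypothesis h_meas : measurable_fun setT h.

Lemma region_measurable s t : measurable (region s t h).
Proof.
have -> : region s t h = (fst @^-1` `]s, t] `&` (snd @^-1` `[0, +oo[)) `&`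
    [set q : R * R | (q.2%:E <= h q.1)%E].
  apply/seteqP; split => -[u z]; rewrite /region /= !in_itv/= !andbT.
    by move=> [].
  by move=> [[]].
apply: measurableI; last first.
  rewrite -[X in measurable X]setTI; apply: measurable_lee => //.
    by apply/measurable_EFinP; exact: measurable_snd.
  exact: measurableT_comp h_meas measurable_fst.
apply: measurableI.
  by rewrite -[X in measurable X]setTI; apply: measurable_fst => //; exact: measurable_itv.
by rewrite -[X in measurable X]setTI; apply: measurable_snd => //; exact: measurable_itv.
Qed.

Lemma region_split s t u : s <= t -> t <= u ->
  m (region s u h) = (m (region s t h) + m (region t u h))%E.
Proof.
move=> st tu; rewrite -measureU; [|exact: region_measurable..|].
  congr (m _); apply/seteqP; split => -[v z]; rewrite /region/=.
    move=> [/andP[sv vu] z0 zh]; have [vt|tv] := leP v t.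
      by left; split => //; rewrite sv.
    by right; split => //; rewrite tv vu.
  move=> [[/andP[sv vt] z0 zh]|[/andP[tv vu] z0 zh]]; split => //.
    by rewrite sv (le_trans vt).
  by rewrite vu (le_lt_trans st).
rewrite -subset0 => -[v z] [[/= /andP[_ vt] _ _] [/= /andP[tv _] _ _]].
by move: tv; rewrite ltNge vt.
Qed.

(** The domain of integration contains time 0, where [g] may differ from [h]; the piece [V] arising
    there lies on the vertical axis, which has mass 0. *)
Lemma integral_thinning (g : R -> \bar R) t : 0 <= t ->
  (forall u, 0 < u -> g u = h u) -> m ([set 0] `*` `[0, +oo[) = 0%E ->
  (\int[m]_(p in `[0%R, t] `*` `[0%R, +oo[)
     (\1_[set q : R * R | (q.2%:E <= g q.1)%E] p)%:E = m (region 0 t h))%E.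
Proof.
move=> t0 gh m0; rewrite integral_mkcond.
pose V : set (R * R) := [set 0] `*` [set z | (0 <= z) /\ (z%:E <= g 0%R)%E].
have mV : measurable V.
  apply: measurableX => //.
  have -> : [set z | 0 <= z /\ (z%:E <= g 0%R)%E] =
      `[0, +oo[ `&` [set z | (z%:E <= g 0%R)%E].
    by apply/seteqP; split => z /=; rewrite in_itv/= andbT.
  apply: measurableI; first exact: measurable_itv.
  by rewrite -[X in measurable X]setTI; apply: measurable_lee.
rewrite (eq_integral (fun p => (\1_(region 0 t h `|` V) p)%:E)); last first.
  move=> [u z] _; rewrite patchE !indicE.
  case: ifPn => [|/negP]; rewrite inE/= => uz.
    congr (_%:E); congr (_%:R); congr (nat_of_bool _).
    apply/idP/idP; rewrite !inE /region /V/=.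
      move=> zg; move: uz => [/=]; rewrite !in_itv/= andbT => /andP[u0 ut] z0.
      move: u0; rewrite le_eqVlt => /predU1P[u0|u0]; first by right; move: zg; rewrite -u0.
      by left; split; rewrite ?u0// -gh.
    by move=> [[/andP[u0 _] _]|[-> []]//]; rewrite gh.
  rewrite memNset// /region /V/= => -[[/andP[u0 ut] z0 _]|[u0 [z0 _]]]; apply: uz;
    split; rewrite /= in_itv/= ?z0//; first by rewrite ltW.
  by rewrite u0 lexx.
rewrite integral_indic//; last by apply: measurableU => //; exact: region_measurable.
rewrite setIT; apply/eqP; rewrite eq_le; apply/andP; split; last first.
  apply: le_measure; rewrite ?inE//; first exact: region_measurable.
  by apply: measurableU => //; exact: region_measurable.
apply: (le_trans (measureU2 m (region_measurable _ _) mV)).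
rewrite [X in (_ + X)%E](_ : _ = 0%E) ?adde0//.
apply/eqP; rewrite eq_le measure_ge0 andbT -m0; apply: le_measure; rewrite ?inE//.
  by apply: measurableX => //; exact: measurable_itv.
by move=> [u z] [/= -> [z0 _]]; split => //=; rewrite in_itv/= z0.
Qed.

Variable x : R -> R.
Hypothesis xE : forall t, 0 <= t -> (x t)%:E = m (region 0 t h).

Lemma thinning_increment s t : 0 <= s -> s <= t ->
  m (region s t h) = (x t - x s)%:E.
Proof.
move=> s0 st; rewrite EFinB !xE ?(le_trans s0)// (region_split s0 st).
by rewrite addeAC subee ?add0e// -xE.
Qed.

(** The regions over []r n, t]] have mass at least the jump height 1 and decrease to a subset of the
    vertical line at [t]. If all bounded segments of that line were null, continuity from above
    would give [1 <= 0]. *)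
Lemma thinning_jump_atom t : counting_path x -> 0 < t ->
  x t - lim (x r @[r --> t^'-]) != 0 ->
  exists K, m ([set t] `*` `[0, K]) <> 0%E.
Proof.
move=> cx t0 jt; have [_ xnd [_ xll] /(_ t t0 jt) j1] := cx.
apply: contrapT => /forallNP noK.
(* This sequence starts at 0 and increases to [t], so it never leaves the time half-line. *)
pose r n : R := t - t / n.+1%:R.
have r0 n : 0 <= r n.
  by rewrite subr_ge0 ler_pdivrMr ?ltr0n// ler_peMr ?ler1n// ltW.
have rt n : r n < t by rewrite ltrBlDr ltrDl divr_gt0.
have ge1 n : (1 <= m (region (r n) t h))%E.
  rewrite thinning_increment// ?(ltW (rt n))// lee_fin -j1 lerD2l lerN2.
  apply: limr_ge; first exact: xll.
  near=> s; apply: xnd => //.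
  near: s; exact: nbhs_left_ge.
pose V : set (R * R) := \bigcap_n region (r n) t h.
have mV0 : m V = 0%E.
  have mK n : measurable ([set t] `*` `[0, n%:R] : set (R * R)).
    by apply: measurableX => //; exact: measurable_itv.
  have mU : m (\bigcup_n ([set t] `*` `[0, n%:R])) = 0%E.
    apply/negligibleP; first exact: bigcupT_measurable.
    apply: negligible_bigcup => n; apply/negligibleP => //.
    exact: contrapT (noK n%:R).
  apply/eqP; rewrite eq_le measure_ge0 andbT -mU; apply: le_measure; rewrite ?inE.
  - by apply: bigcapT_measurable => n; exact: region_measurable.
  - exact: bigcupT_measurable.
  - move=> [u z] Vuz; have [/= /andP[_ ut] z0 _] := Vuz 0 I.
    exists (Num.bound z) => //; split => /=; last first.
      by rewrite in_itv/= z0 ltW// ltr_bound.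
    apply/eqP; rewrite eq_le ut/= leNgt; apply/negP => ult.
    pose n := Num.bound (t / (t - u)).
    have [/= /andP[rnu _] _ _] := Vuz n I.
    move: rnu; rewrite ltNge => /negP; apply.
    rewrite /r lerBrDr -lerBrDl ler_pdivrMr ?ltr0n// mulrC -ler_pdivrMr ?subr_gt0//.
    by rewrite (le_trans (ltW (ltr_bound _)))// ler_nat.
have : m (region (r n) t h) @[n --> \oo] --> m V.
  apply: nonincreasing_cvg_mu => //.
  - by rewrite thinning_increment ?ltry// ltW.
  - by move=> n; exact: region_measurable.
  - by apply: bigcapT_measurable => n; exact: region_measurable.
  - move=> a b ab; apply/subsetPset => -[u z] [/= /andP[ru ut] z0 zh]; split => //=.
    rewrite ut andbT (le_lt_trans _ ru)// lerD2l lerN2 ler_pM2l//.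
    by rewrite lef_pV2 ?posrE ?ltr0n// ler_nat ltnS.
rewrite mV0 => c0.
have : (1 <= 0 :> \bar R)%E.
  rewrite -(cvg_lim _ c0)//; apply: lime_ge; first by apply/cvg_ex; eexists; exact: c0.
  by apply: nearW => n; exact: ge1.
by rewrite lee_fin ler10.
Unshelve. all: by end_near. Qed.

End thinning.

Lemma esum_exchange {R : realType} {I J : choiceType} (a : I -> J -> \bar R) :
  (forall i j, 0 <= a i j)%E ->
  (\esum_(i in [set: I]) \esum_(j in [set: J]) a i j =
   \esum_(j in [set: J]) \esum_(i in [set: I]) a i j)%E.
Proof.
move=> a0; rewrite !esum_esum//.
rewrite (@reindex_esum R (I * J)%type (J * I)%type ([set: I] `*`` (fun=> [set: J]))
  ([set: J] `*`` (fun=> [set: I])) (fun p => (p.2, p.1)))//.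
  split=> [[i j]//|[i j] [i' j'] _ _ /= [-> ->]//|[j i] _ /=].
  by exists (i, j).
Qed.

(** * Neighbours in the lattice *)

Section neighbourhood.
Context {R : realType} (d : nat).
Local Notation Zd := 'rV[int]_d.

Let unit (k : 'I_d) : Zd := delta_mx ord0 k.

Let sqnorm (v : Zd) : int := \sum_(k < d) (v ord0 k) ^+ 2.

(** The squared distance is an integer, so adjacency can be decided by integer arithmetic. *)
Lemma edgeE (i j : Zd) : @edge R d i j = (sqnorm (i - j) == 0) || (sqnorm (i - j) == 1).
Proof.
rewrite /edge /euclidean_dist.
have -> : \sum_(k < d) ((i ord0 k - j ord0 k)%:~R : R) ^+ 2 = (sqnorm (i - j))%:~R.
  rewrite /sqnorm rmorph_sum/=; apply: eq_bigr => k _.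
  by rewrite !mxE rmorphXn.
have : 0 <= sqnorm (i - j) by apply: sumr_ge0 => k _; rewrite sqr_ge0.
move: (sqnorm _) => n n0.
have n0R : 0 <= n%:~R :> R by rewrite ler0z.
rewrite sqrtr_eq0 lerz0 -[X in X || _](_ : (n == 0) = _); last by rewrite eq_le n0 andbT.
congr (_ || _); rewrite -[X in _ == X](sqrtr1 R) eqr_sqrt//.
by rewrite -[1 in LHS]/(1%:~R) eqr_int.
Qed.

Lemma edge_sym (i j : Zd) : @edge R d i j = @edge R d j i.
Proof.
rewrite !edgeE -opprB; congr (_ || _); congr (_ == _); apply: eq_bigr => k _;
  by rewrite mxE sqrrN.
Qed.

Lemma sqnorm_eq0 v : sqnorm v = 0 -> v = 0.
Proof.
move=> /eqP; rewrite psumr_eq0 => [/allP v0|k _]; last exact: sqr_ge0.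
apply/rowP => k; rewrite mxE; apply/eqP; rewrite -sqrf_eq0.
by apply: v0; rewrite mem_index_enum.
Qed.

(** A non-zero integer coordinate has square at least 1 and so exhausts the sum; all others
    vanish. *)
Lemma sqnorm_eq1 v : sqnorm v = 1 -> exists k, v = unit k \/ v = - unit k.
Proof.
move=> v1.
have [/existsP[k vk]|] := boolP [exists k, v ord0 k != 0]; last first.
  rewrite negb_exists => /forallP v0; move: v1; rewrite /sqnorm big1// => k _.
  by have := v0 k; rewrite negbK => /eqP ->; rewrite expr0n.
move: v1; rewrite /sqnorm (bigD1 k)//= => v1.
have vk1 : 1 <= v ord0 k ^+ 2 by rewrite -gtz0_ge1 exprn_even_gt0.
have rest0 : 0 <= \sum_(l < d | l != k) v ord0 l ^+ 2.
  by apply: sumr_ge0 => l _; exact: sqr_ge0.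
have rest : \sum_(l < d | l != k) v ord0 l ^+ 2 = 0.
    by move: v1 vk1 rest0; move: (v ord0 k ^+ 2) (\sum_(_ < _ | _) _) => a b; lra.
have vl l : l != k -> v ord0 l = 0.
  move=> lk; apply/eqP; rewrite -sqrf_eq0.
  move: rest => /eqP; rewrite psumr_eq0 => [/allP/(_ l)|? _]; last exact: sqr_ge0.
  by rewrite mem_index_enum lk; apply.
have : v ord0 k ^+ 2 == 1 by apply/eqP; rewrite -v1 rest addr0.
rewrite sqrf_eq1 => /orP[] /eqP vk_; exists k; [left|right];
  apply/rowP => l; rewrite !mxE eqxx/=; have [->|lk] := eqVneq l k;
  rewrite ?vk_ ?eqxx ?vl// ?oppr0//; by rewrite (negbTE lk).
Qed.

Definition neighbours (j : Zd) : seq Zd :=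
  j :: [seq j + unit k | k <- enum 'I_d] ++ [seq j - unit k | k <- enum 'I_d].

Lemma size_neighbours j : size (neighbours j) = (2 * d + 1)%N.
Proof. rewrite /neighbours -cat1s !size_cat !size_map -enumT size_enum_ord.
by rewrite add1n addn1 mul2n addnn. Qed.

Let unitE k l : unit k ord0 l = (k == l)%:R.
Proof. by rewrite mxE eqxx eq_sym. Qed.

(** Distinctness lets a sum over the set of adjacent sites be computed on the list, and turns
    [size_neighbours] into a count of neighbours. *)
Lemma uniq_neighbours j : uniq (neighbours j).
Proof.
have u0 k : unit k != 0.
  by apply/eqP => /rowP/(_ k); rewrite unitE mxE eqxx.
have uinj : injective unit.
  move=> k l /rowP/(_ k); rewrite !unitE eqxx.
  by have [//|kl] := eqVneq k l.
have uN k l : unit k != - unit l.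
  apply/eqP => /rowP/(_ k); rewrite unitE eqxx mxE unitE.
  by have [_|kl] := eqVneq k l; rewrite ?eqxx ?(negbTE kl).
rewrite /= mem_cat negb_or cat_uniq !map_inj_uniq -?enumT ?enum_uniq//; last 2 first.
- by move=> k l /addrI/oppr_inj/uinj.
- by move=> k l /addrI/uinj.
rewrite /= andbT; apply/andP; split.
  apply/andP; split; apply/mapP => -[k _] /eqP.
    by rewrite -subr_eq0 opprD addNKr oppr_eq0 (negbTE (u0 k)).
  by rewrite -subr_eq0 opprB addrC subrK (negbTE (u0 k)).
apply/hasPn => _ /mapP[l _ ->]; apply/mapP => -[k _ /addrI/eqP].
by rewrite eq_sym (negbTE (uN k l)).
Qed.

Lemma mem_neighbours i j : (i \in neighbours j) = @edge R d j i.
Proof.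
rewrite edgeE; apply/idP/idP.
  rewrite in_cons mem_cat => /predU1P[->|].
    by rewrite subrr /sqnorm big1 ?eqxx// => k _; rewrite mxE expr0n.
  have sq1 (s : int) k : s ^+ 2 = 1 -> sqnorm (s *: unit k) = 1.
    move=> s1; rewrite /sqnorm (bigD1 k)//= big1 => [|l lk].
      by rewrite addr0 mxE unitE eqxx mulr1.
    by rewrite mxE unitE eq_sym (negbTE lk) mulr0 expr0n.
  move=> /orP[]/mapP[k _ ->]; apply/orP; right; apply/eqP.
    by rewrite opprD addNKr -scaleN1r sq1// sqrrN expr1n.
  by rewrite opprB addrC subrK -[unit k]scale1r sq1// expr1n.
move=> /orP[/eqP/sqnorm_eq0/eqP|/eqP/sqnorm_eq1[k kE]].
  by rewrite subr_eq0 => /eqP ->; rewrite inE eqxx.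
rewrite in_cons mem_cat; apply/orP; right; apply/orP.
case: kE => kE; [right|left]; apply/mapP; exists k; rewrite ?mem_enum//.
  by rewrite -kE opprB addrC subrK.
by rewrite -[unit k]opprK -kE opprB addrC subrK.
Qed.

End neighbourhood.

(** * Sums over countable types: measurability and Tonelli *)

Section countable_sums.
Context {R : realType} {I : countType}.
Local Open Scope ereal_scope.

Lemma esum_countable (a : I -> \bar R) : (forall i, 0 <= a i) ->
  \esum_(i in [set: I]) a i = \sum_(n <oo) oapp a 0 (pickle_inv n).
Proof.
move=> a0; pose b n := oapp a 0 (@pickle_inv I n).
have b0 n : 0 <= b n by rewrite /b; case: pickle_inv => [i|]//=; exact: a0.
rewrite -[RHS]/(\sum_(n <oo) b n) nneseries_esumT//.
transitivity (\esum_(n in [set pickle i | i in [set: I]]) b n).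
  rewrite (@esum_image R I nat setT pickle b); last first.
    by move=> i j _ _; exact: (pcan_inj pickleK_inv).
  by apply: eq_esum => i _; rewrite /b pickleK_inv.
rewrite esum_mkcond; apply: eq_esum => n _; case: ifPn => // /negP nr.
rewrite /b; case E : (pickle_inv n) => [i|//]; case: nr; rewrite inE.
by exists i => //; have := @pickle_invK I n; rewrite E.
Qed.

Lemma measurable_esum d (T : measurableType d) (D : set T) (h : I -> T -> \bar R) :
  (forall i x, 0 <= h i x) -> (forall i, measurable_fun D (h i)) ->
  measurable_fun D (fun x => \esum_(i in [set: I]) h i x).
Proof.
move=> h0 mh; under eq_fun do rewrite esum_countable//.
apply: ge0_emeasurable_sum => [n x _ _|n _].
  by case: pickle_inv => [i|]//=; exact: h0.
by case: pickle_inv => [i|]/=; [exact: mh|exact: measurable_cst].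
Qed.

Lemma integral_esum d (T : measurableType d) (mu : {measure set T -> \bar R})
    (D : set T) (h : I -> T -> \bar R) : measurable D ->
  (forall i x, 0 <= h i x) -> (forall i, measurable_fun D (h i)) ->
  \int[mu]_(x in D) (\esum_(i in [set: I]) h i x) =
  \esum_(i in [set: I]) (\int[mu]_(x in D) h i x).
Proof.
move=> mD h0 mh; rewrite esum_countable; last by move=> i; exact: integral_ge0.
transitivity (\int[mu]_(x in D) \sum_(n <oo) oapp (h ^~ x) 0 (@pickle_inv I n)).
  by apply: eq_integral => x _; rewrite esum_countable.
rewrite integral_nneseries//.
- apply: eq_eseriesr => n _; case: pickle_inv => [i|]//=.
  by rewrite integral0.
- by move=> n; case: pickle_inv => [i|]/=; [exact: mh|exact: measurable_cst].
- by move=> n x _; case: pickle_inv => [i|]//=; exact: h0.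
Qed.

(** [esum] is a supremum over finite subsets, which never gains from a negative term. Hence
    [total_process] is a sum of non-negative measurable functions even on the null set where a path
    takes negative values. *)
Lemma esum_max0 (a : I -> R) :
  \esum_(i in [set: I]) (a i)%:E = \esum_(i in [set: I]) (Num.max 0 (a i))%:E.
Proof.
apply/eqP; rewrite eq_le; apply/andP; split.
  by apply: le_esum => i _; rewrite lee_fin le_max lexx orbT.
apply: ge_ereal_sup => _ [X [finX _] <-].
apply: esum_ge; exists (X `&` [set i | (0 <= a i)%R]).
  by split => //; exact: finite_setIl.
rewrite le_eqVlt; apply/orP; left; apply/eqP.
rewrite [RHS](@fsbig_mkcondr _ _ _ _ X) /=.
apply: eq_fsbigr => i _; case: ifPn => [|/negP]; rewrite inE/=.
  by move=> ai; rewrite max_r.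
by move=> /negP; rewrite -ltNge => ai; rewrite max_l// ltW.
Qed.

Lemma ae_forall_countable d (T : measurableType d) (mu : {measure set T -> \bar R})
    (Q : I -> T -> Prop) :
  (forall i, {ae mu, forall x, Q i x}) -> {ae mu, forall x, forall i, Q i x}.
Proof.
move=> h.
have : {ae mu, forall x, forall n, oapp (Q ^~ x) True (@pickle_inv I n)}.
  apply: ae_foralln => n; case: pickle_inv => [i|]/=; first exact: h.
  exact: aeW.
by apply: filterS => x hx i; have := hx (pickle i); rewrite pickleK_inv.
Qed.

End countable_sums.

Section positive_part.
Context {R : realType}.
Variable phi : R -> R.
Hypothesis phi_ge0 : forall t : R, 0 <= t -> 0 <= phi t.
Hypothesis phi_locint : forall t : R, 0 <= t ->
  lebesgue_measure.-integrable `[0, t] (EFin \o phi).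

(** Vanishing at ages [<= 0], it lets the past excitation be written as a sum
    over all jumps. *)
Definition on_pos (v : R) : R := if 0 < v then phi v else 0.

Lemma on_pos_ge0 v : 0 <= on_pos v.
Proof. by rewrite /on_pos; case: ltP => // v0; rewrite phi_ge0// ltW. Qed.

Lemma on_pos_le0 v : v <= 0 -> on_pos v = 0.
Proof. by rewrite /on_pos ltNge => ->. Qed.

Lemma on_pos_gt0 v : 0 < v -> on_pos v = phi v.
Proof. by rewrite /on_pos => ->. Qed.

Lemma measurable_on_pos : measurable_fun [set: R] on_pos.
Proof.
have mphi : measurable_fun (`]0, +oo[%classic : set R) phi.
  have -> : `]0, +oo[%classic = \bigcup_n `]0, n%:R]%classic :> set R.
    apply/seteqP; split => [v|v [n _]] /=; rewrite !in_itv/= ?andbT.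
      move=> v0; exists (Num.bound v) => //=.
      by rewrite in_itv/= v0 ltW// ltr_bound.
    by case/andP.
  apply/measurable_fun_bigcup => [n|n]; first exact: measurable_itv.
  have /integrableP[/measurable_EFinP + _] := phi_locint (ler0n R n).
  apply: measurable_funS; first exact: measurable_itv.
  by move=> v /=; rewrite !in_itv/= => /andP[v0 ->]; rewrite ltW.
have -> : on_pos = phi \_ `]0, +oo[.
  apply/funext => v; rewrite patchE /on_pos.
  have [v0|v0] := ltP 0 v; first by rewrite mem_set//= in_itv/= v0.
  by rewrite memNset//= in_itv/= andbT ltNge v0.
by apply/(measurable_restrictT _ _).1 => //; exact: measurable_itv.
Qed.

Lemma integral_on_pos t :
  (\int[lebesgue_measure]_(s in `]-oo, t]) (on_pos s)%:E =
   \int[lebesgue_measure]_(s in `[0%R, t]) (phi s)%:E)%E.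
Proof.
rewrite -[RHS]integral_itv_obnd_cbnd; last first.
  have [t0|t0] := leP 0 t.
    have /integrableP[+ _] := phi_locint t0.
    apply: measurable_funS; first exact: measurable_itv.
    by move=> v /=; rewrite !in_itv/= => /andP[v0 ->]; rewrite ltW.
  rewrite set_itv_ge ?bnd_simp; first exact: measurable_fun_set0.
  by rewrite -leNgt ltW.
rewrite integral_mkcond [RHS]integral_mkcond; apply: eq_integral => s _.
rewrite !patchE /on_pos; have [s0|s0] := ltP 0 s; have [st|st] := leP s t.
- by rewrite !mem_set//= in_itv/= ?s0 ?st.
- by rewrite !memNset//= in_itv/= leNgt st/= ?andbF.
- rewrite [X in _ = if X then _ else _]memNset; first by case: ifP.
  by rewrite /= in_itv/= ltNge s0.
- by rewrite !memNset//= in_itv/= leNgt st/= ?andbF.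
Qed.

Lemma integral_on_pos_fin t :
  (\int[lebesgue_measure]_(s in `]-oo, t]) (on_pos s)%:E < +oo)%E.
Proof.
rewrite integral_on_pos; have [t0|t0] := leP 0 t; last first.
  by rewrite set_itv_ge ?integral_set0// bnd_simp -ltNge.
have /integrableP[_] := phi_locint t0; apply: le_lt_trans.
rewrite le_eqVlt; apply/orP; left; apply/eqP.
apply: eq_integral => s; rewrite inE/= in_itv/= => /andP[s0 _].
by rewrite ger0_norm// phi_ge0.
Qed.

End positive_part.

(** The sum counts the multiples of [1/(m+1)] in []0, y]], so the middle term is [y] rounded down to
    that grid. *)
Lemma count_multiples {R : realType} (y : R) (m N : nat) : 0 <= y -> y * m.+1%:R <= N%:R ->
  y - m.+1%:R^-1 <= m.+1%:R^-1 * \sum_(k < N) (k.+1%:R <= y * m.+1%:R)%R%:R <= y.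
Proof.
move=> y0 yN; have m0 : (0 : R) < m.+1%:R by rewrite ltr0n.
have z0 : 0 <= y * m.+1%:R by rewrite mulr_ge0// ltW.
pose q := Num.truncn (y * m.+1%:R); have /andP[qz zq] := truncn_itv z0.
have qN : (q <= N)%N by rewrite -(ler_nat R) (le_trans qz).
rewrite (eq_bigr (fun k : 'I_N => (k < q)%N%:R)); last first.
  move=> k _; congr (_%:R); congr nat_of_bool; apply/idP/idP => [kz|kq].
    by rewrite -ltnS -(ltr_nat R) (le_lt_trans kz).
  by rewrite (le_trans _ qz)// ler_nat.
rewrite -natr_sum -big_mkcond/= -(big_ord_widen N (fun=> 1%N) qN) sum_nat_const card_ord muln1.
rewrite -[X in X - _ <= _](mulfK (lt0r_neq0 m0)) -[X in _ <= _ <= X](mulfK (lt0r_neq0 m0)).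
rewrite -[X in _ - X <= _]mul1r -mulrBl [X in _ <= X <= _]mulrC !ler_pM2r ?invr_gt0// qz andbT.
by rewrite lerBlDr natr1 ltW.
Qed.

(** * Orthogonality of a centred increment to bounded past variables *)

Section orthogonality.
Context {R : realType} {dO : measure_display} {Omega : measurableType dO}.
Variables (P : probability Omega R) (G : set (set Omega)) (D : Omega -> R).
Hypotheses (sG : sigma_algebra setT G) (Gm : G `<=` measurable).
Hypothesis intD : P.-integrable setT (EFin \o D).
Hypothesis D_orth : forall E, G E -> (\int[P]_(w in E) (D w)%:E = 0)%E.

Let mD : measurable_fun setT D.
Proof. by apply/measurable_EFinP; exact: measurable_int intD. Qed.

Let wrt_meas (Y : Omega -> R) : measurable_wrt G Y -> measurable_fun setT Y.
Proof. by move=> mY _ U mU; rewrite setTI; apply: Gm; exact: mY. Qed.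

Lemma integrable_bounded_mul (Y : Omega -> R) (C : R) : measurable_fun setT Y ->
  (forall w, `|Y w| <= C) -> P.-integrable setT (fun w => (Y w * D w)%:E).
Proof.
move=> mY YC.
apply: (le_integrable measurableT (f := fun w => (Y w * D w)%:E)
  (g := fun w => (C%:E * (D w)%:E)%E)).
- by apply/measurable_EFinP; exact: measurable_funM.
- move=> w _; rewrite -EFinM !abse_EFin lee_fin !normrM ler_wpM2r//.
  by rewrite (le_trans (YC w))// ler_norm.
- exact: integrableZl.
Qed.

(** Rounding [Y] down to the grid of mesh [1/(m+1)] gives a combination of indicators of events of
    [G], each orthogonal to [D]; dominated convergence concludes. *)
Let orth_nonneg (Y : Omega -> R) (C : R) : measurable_wrt G Y -> (forall w, 0 <= Y w <= C) ->
  (\int[P]_w (Y w * D w)%:E = 0)%E.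
Proof.
move=> mY YC.
pose E m k := [set w | k.+1%:R <= Y w * m.+1%:R].
have GE m k : G (E m k).
  have := mY [set y | k.+1%:R <= y * m.+1%:R]; apply.
  have -> : [set y : R | k.+1%:R <= y * m.+1%:R] = `[k.+1%:R / m.+1%:R, +oo[%classic.
    by apply/seteqP; split => y /=; rewrite in_itv/= andbT ler_pdivrMr// ltr0n.
  exact: measurable_itv.
pose N m := (Num.truncn (C * m.+1%:R)).+1.
pose Ym m w : R := m.+1%:R^-1 * \sum_(k < N m) \1_(E m k) w.
have YmE m w : Y w - m.+1%:R^-1 <= Ym m w <= Y w.
  have [y0 yC] := andP (YC w).
  rewrite /Ym (eq_bigr (fun k : 'I_(N m) => (k.+1%:R <= Y w * m.+1%:R)%R%:R)).
    apply: count_multiples => //; rewrite (@le_trans _ _ (C * m.+1%:R))//.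
      by rewrite ler_wpM2r.
    by apply/ltW; exact: truncnS_gt.
  move=> k _; rewrite indicE; congr (_%:R); congr nat_of_bool.
  by apply/idP/idP => [/set_mem//|h]; apply/mem_set.
have mYm m : measurable_fun setT (Ym m).
  apply: measurable_funM => //; apply: measurable_sum => k.
  by apply: measurable_indic; exact: Gm.
have Ym0 m : (\int[P]_w (Ym m w * D w)%:E = 0)%E.
  have -> : (fun w => (Ym m w * D w)%:E) =
     (fun w => \sum_(k < N m) (m.+1%:R^-1%:E * ((\1_(E m k) w * D w)%:E)))%E.
    apply/funext => w; rewrite sumEFin; congr EFin.
    by rewrite /Ym mulr_sumr mulr_suml; apply: eq_bigr => k _; rewrite mulrA.
  have iE k : P.-integrable setT (fun w => (\1_(E m k) w * D w)%:E).
    apply: (@integrable_bounded_mul _ 1); first by apply: measurable_indic; exact: Gm.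
    by move=> w; rewrite indicE; case: (_ \in _); rewrite ?normr1// normr0.
  rewrite integral_sum//; last by move=> k; exact: integrableZl.
  rewrite big1// => k _; rewrite integralZl//.
  rewrite (_ : (\int[P]_w _)%E = (\int[P]_(w in E m k) (D w)%:E)%E).
    by rewrite D_orth// mule0.
  rewrite [RHS]integral_mkcond epatch_indic; apply: eq_integral => w _.
  by rewrite /= -EFinM mulrC.
case: (@dominated_convergence _ Omega R P setT measurableT
  (fun m w => (Ym m w * D w)%:E) (fun w => (Y w * D w)%:E)
  (fun w => ((C + 1) * `|D w|)%:E)); last 1 first.
- move=> _ _; have : (\int[P]_w (Ym m w * D w)%:E)%E @[m --> \oo] --> (0 : \bar R)%E.
    by under eq_fun do rewrite Ym0; exact: cvg_cst.
  by move=> h1 h2; exact: (cvg_unique _ h2 h1).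
- by move=> m; apply/measurable_EFinP; apply: measurable_funM.
- by apply/measurable_EFinP; apply: measurable_funM => //; exact: wrt_meas.
- apply: aeW => w _; apply: cvg_EFin; first by apply: nearW.
  apply: cvgMl; apply: (@squeeze_cvgr _ _ _ _ (fun m => Y w - m.+1%:R^-1) (cst (Y w))).
  + by apply: nearW => m; exact: YmE.
  + rewrite -[X in _ --> X]subr0; apply: cvgB; [exact: cvg_cst|exact: cvg_harmonic].
  + exact: cvg_cst.
- have -> : (fun w => ((C + 1) * `|D w|)%:E) = (fun w => (C+1)%:E * (abse (D w)%:E))%E.
    by [].
  apply: integrableZl => //; exact: integrable_abse.
- apply: aeW => w m _; rewrite abse_EFin lee_fin normrM ler_wpM2r//.
  have [y0 yC] := andP (YC w); have /andP[h1 h2] := YmE m w.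
  rewrite ler_norml; apply/andP; split.
    have v1 : m.+1%:R^-1 <= (1 : R) by rewrite invf_le1// ler1n.
    have c0 := le_trans y0 yC.
    by move: h1 v1; set v := m.+1%:R^-1 => h1 v1; lra.
  lra.
Qed.

(** Adding [C] makes the variable non-negative with values in [[0, 2 C]]; the added constant is
    orthogonal to [D] because the whole space belongs to [G]. *)
Lemma orthogonal_bounded (Y : Omega -> R) (C : R) : measurable_wrt G Y ->
  (forall w, `|Y w| <= C) -> (\int[P]_w (Y w * D w)%:E = 0)%E.
Proof.
move=> mY YC.
have h : (\int[P]_w ((Y w + C) * D w)%:E = 0)%E.
  apply: (@orth_nonneg _ (C + C)).
    move=> U mU; have := mY [set y | U (y + C)]; apply.
    have : measurable_fun setT (fun y : R => y + C).
      by apply: measurable_funD => //; exact: measurable_cst.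
    by move=> /(_ measurableT U mU); rewrite setTI.
  by move=> w; have := YC w; rewrite ler_norml; lra.
have hC : (\int[P]_w (C * D w)%:E = 0)%E.
  under eq_integral do rewrite EFinM.
  rewrite integralZl//; have [GT _ _] := sG.
  by rewrite D_orth ?mule0//; have := sG; move=> [G0 GC _]; rewrite -[setT]setD0; exact: GC.
rewrite -h -[LHS]adde0 -[X in (_ + X = _)%E]hC -integralD_EFin//.
- by apply: eq_integral => w _; rewrite -EFinD mulrDl.
- by apply: (@integrable_bounded_mul _ C) => //; exact: wrt_meas.
- by apply: (@integrable_bounded_mul _ `|C|).
Qed.

End orthogonality.

(** * Deterministic estimates for a path and its compensator *)

Section compensated_path.
Context {R : realType}.

Lemma finite_lower_bound (g : nat -> R) n : (forall k, (k < n)%N -> 0 < g k) ->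
  exists2 e, 0 < e & forall k, (k < n)%N -> e <= g k.
Proof.
elim: n => [_|n IH g0]; first by exists 1.
have [k kn|e e0 he] := IH; first by apply: g0; rewrite ltnS ltnW.
exists (Num.min e (g n)); first by rewrite lt_min e0 g0.
move=> k; rewrite ltnS leq_eqVlt ge_min => /orP[/eqP ->|/he ->//].
by rewrite lexx orbT.
Qed.

Variable Phi : R -> R.
Hypothesis Phi_nd : forall s t, s <= t -> Phi s <= Phi t.
Hypothesis Phi_le0 : forall v, v <= 0 -> Phi v = 0.
Hypothesis Phi_uc : forall T e, 0 < e -> exists2 d, 0 < d &
  forall s t, s <= t -> t <= T -> t - s < d -> Phi t - Phi s < e.

Let Phi_ge0 v : 0 <= Phi v.
Proof.
have [v0|v0] := leP v 0; first by rewrite Phi_le0.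
by rewrite -(Phi_le0 (lexx 0)) Phi_nd// ltW.
Qed.

(** The horizon [T] may exceed [t]: jumps after [t] contribute [Phi] of a negative number, that is
    0, so one finite list describes [a] up to [T]. *)
Record compensated_path (x a : R -> R) : Prop := CompensatedPath {
  compensated_counting : counting_path x;
  compensated_zero : x 0 = 0;
  compensatedE : forall T n, 0 <= T -> x T = n%:R -> forall t, t <= T ->
    a t = Phi t + \sum_(u <- jumps_up_to x n) Phi (t - u) }.

Variables (x a : R -> R).
Hypothesis xa : compensated_path x a.
Let cx := compensated_counting xa.
Let x0 := compensated_zero xa.

Lemma compensator_zero : a 0 = 0.
Proof.
by rewrite (compensatedE xa (n := 0%N) (lexx 0) x0 (lexx 0)) big_nil addr0 Phi_le0.
Qed.

Lemma compensated_nd s t : 0 <= s -> s <= t -> x s <= x t.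
Proof. by have [_ + _ _] := cx; exact. Qed.

Lemma compensated_ge0 t : 0 <= t -> 0 <= x t.
Proof. by have [+ _ _ _] := cx => /(_ t) h /h[n ->]. Qed.

Lemma compensator_increment s t : 0 <= s -> s <= t -> Phi t - Phi s <= a t - a s.
Proof.
move=> s0 st; have t0 := le_trans s0 st.
have [+ _ _ _] := cx => /(_ t t0)[n xt].
rewrite (compensatedE xa t0 xt (lexx t)) (compensatedE xa t0 xt st).
rewrite opprD addrACA lerDl subr_ge0; apply: ler_sum => u _; apply: Phi_nd.
by rewrite lerD2r.
Qed.

Lemma compensator_nd s t : 0 <= s -> s <= t -> a s <= a t.
Proof.
move=> s0 st; rewrite -subr_ge0; apply: le_trans (compensator_increment s0 st).
by rewrite subr_ge0 Phi_nd.
Qed.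

Lemma compensator_ge0 t : 0 <= t -> 0 <= a t.
Proof. by move=> t0; rewrite -compensator_zero compensator_nd. Qed.

Let jumps_le T n u : 0 <= T -> x T = n%:R -> u \in jumps_up_to x n -> 0 <= u <= T.
Proof.
move=> T0 xT /mapP[k]; rewrite mem_iota add0n => /andP[_ kn] ->.
have xk : k.+1%:R <= x T by rewrite xT ler_nat.
by rewrite (jump_time_ge0 T0 xk) (jump_time_le cx T0 xk).
Qed.

(** There are [1 + x t] terms, one for the initial impulsion and one per jump, each at most
    [Phi t]. *)
Lemma compensator_le t : 0 <= t -> a t <= Phi t * (1 + x t).
Proof.
move=> t0; have [+ _ _ _] := cx => /(_ t t0)[n xt].
rewrite (compensatedE xa t0 xt (lexx t)) mulrDr mulr1 lerD2l xt.
apply: (@le_trans _ _ (\sum_(u <- jumps_up_to x n) Phi t)).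
  rewrite big_seq [leRHS]big_seq; apply: ler_sum => u /(jumps_le t0 xt)/andP[u0 _].
  by apply: Phi_nd; rewrite gerBl.
by rewrite big_const_seq count_predT size_map size_iota iter_addr addr0 mulr_natr.
Qed.

(** Without jumps after [T], each of the [1 + x T] terms has age at least [t - T]. Together with
    [compensator_le] this fixes the limit of the compensator of a path that stops jumping. *)
Lemma compensator_ge T t : 0 <= T -> T <= t -> x t = x T ->
  Phi (t - T) * (1 + x T) <= a t.
Proof.
move=> T0 Tt xtT; have t0 := le_trans T0 Tt.
have [+ _ _ _] := cx => /(_ T T0)[n xT].
have xt : x t = n%:R by rewrite xtT.
rewrite (compensatedE xa t0 xt (lexx t)) mulrDr mulr1 xT; apply: lerD.
  by apply: Phi_nd; rewrite gerBl.
apply: (@le_trans _ _ (\sum_(u <- jumps_up_to x n) Phi (t - T))).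
  by rewrite big_const_seq count_predT size_map size_iota iter_addr addr0 mulr_natr.
rewrite big_seq [leRHS]big_seq; apply: ler_sum => u /(jumps_le T0 xT)/andP[_ uT].
by apply: Phi_nd; rewrite lerD2l lerN2.
Qed.

Lemma compensator_small_increments T e : 0 <= T -> 0 < e -> exists2 h, 0 < h &
  forall s t, 0 <= s -> s <= t -> t <= T -> t - s < h -> a t - a s <= e.
Proof.
move=> T0 e0; have [+ _ _ _] := cx => /(_ T T0)[n xT].
(* The tolerance is shared among [n + 1] terms: the [n] jumps and the initial impulsion. *)
have e'0 : 0 < e / n.+1%:R by rewrite divr_gt0.
have [h h0 hPhi] := Phi_uc T e'0.
exists h => // s t s0 st tT tsh.
rewrite (compensatedE xa T0 xT tT) (compensatedE xa T0 xT (le_trans st tT)).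
rewrite opprD addrACA -sumrB.
have -> : e = e / n.+1%:R + \sum_(u <- jumps_up_to x n) (e / n.+1%:R).
  rewrite big_const_seq count_predT size_map size_iota iter_addr addr0 -mulrS.
  by rewrite -[RHS]mulr_natr divfK.
apply: lerD; first by apply: ltW; exact: hPhi.
rewrite big_seq [leRHS]big_seq; apply: ler_sum => u /(jumps_le T0 xT)/andP[u0 _].
apply: ltW; apply: hPhi; first by rewrite lerD2r.
  by rewrite (le_trans _ tT)// gerBl.
by rewrite opprB addrA subrK.
Qed.

(** Take for [h] a lower bound of the gaps between consecutive jump times, positive by
    [jump_time_lt]: two jumps in a step would force its length to be at least [h]. *)
Lemma counting_small_increments T : 0 <= T -> exists2 h, 0 < h &
  forall s t, 0 <= s -> s <= t -> t <= T -> t - s < h -> x t - x s <= 1.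
Proof.
move=> T0; have [xnat xnd _ _] := cx; have [n xT] := xnat T T0.
pose g k := jump_time x k.+1 - jump_time x k.
have [k kn|h h0 hg] := @finite_lower_bound g n.-1.
  rewrite subr_gt0; apply: (jump_time_lt cx x0 T0) => //.
  by rewrite xT ler_nat; move: kn; case: (n).
exists h => // s t s0 st tT; apply: contraTT; rewrite -ltNge -leNgt.
have t0 := le_trans s0 st; have [i xs] := xnat s s0; have [j xt] := xnat t t0.
rewrite xs xt ltrBrDr nat1r ltr_nat => ij.
have jn : (j <= n)%N by rewrite -(ler_nat R) -xt -xT xnd.
have xTi : i.+2%:R <= x T by rewrite xT ler_nat (leq_trans ij).
have xTi' : i.+1%:R <= x T by rewrite (le_trans _ xTi)// ler_nat.
apply: (@le_trans _ _ (g i)).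
  by apply: hg; move: (leq_trans ij jn); case: (n).
apply: lerB; first by rewrite -(jump_timeP cx T0 xTi)// xt ler_nat.
apply: ltW; rewrite ltNge -(jump_timeP cx T0 xTi')// xs ler_nat.
by rewrite ltnn.
Qed.

End compensated_path.

Lemma ae_le_integral {R : realType} {dO} {Omega : measurableType dO}
    (P : {measure set Omega -> \bar R}) (g h : Omega -> R) :
  P.-integrable setT (EFin \o g) -> P.-integrable setT (EFin \o h) ->
  {ae P, forall w, g w <= h w} ->
  (\int[P]_w (g w)%:E <= \int[P]_w (h w)%:E)%E.
Proof.
move=> ig ih gh.
have fing : (\int[P]_w (g w)%:E)%E \is a fin_num by exact: integrable_fin_num.
rewrite -sube_ge0; last by rewrite fing.
rewrite -integralB_EFin//.
rewrite (_ : (\int[P]_w _)%E = (\int[P]_w (Num.max 0 (h w - g w))%:E)%E).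
  by apply: integral_ge0 => w _; rewrite lee_fin le_max lexx.
have mg : measurable_fun setT g by apply/measurable_EFinP; exact: measurable_int ig.
have mh : measurable_fun setT h by apply/measurable_EFinP; exact: measurable_int ih.
apply: ae_eq_integral => //.
- by apply/measurable_EFinP; exact: measurable_funB.
- apply/measurable_EFinP; apply: measurable_maxr; first exact: measurable_cst.
  exact: measurable_funB.
- by apply: filterS gh => w gh _; rewrite max_r ?subr_ge0// EFinB.
Qed.

(** Error bound for one step of a Riemann sum, [x] and [a] being the increments
    of a counting process and of its compensator.  Over a fine partition the
    first case holds at every step, so the errors add up to a small quantity. *)
Definition second_order {R : realType} (x a : R) : R :=
  if (x <= 1) && (a <= 1) then a * (a + x) else x + a.

Lemma second_order_le {R : realType} (x a : R) : 0 <= x -> 0 <= a ->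
  0 <= second_order x a <= x + a.
Proof.
move=> x0 a0; rewrite /second_order; case: ifP => [/andP[_ a1]|_].
  rewrite mulr_ge0 ?addr_ge0//= [a + x]addrC -[leRHS]mul1r ler_wpM2r//.
  exact: addr_ge0.
by rewrite addr_ge0/=.
Qed.

Lemma second_order_small {R : realType} (x a e : R) : 0 <= x <= 1 -> 0 <= a -> a <= e -> e <= 1 ->
  second_order x a <= e * (x + a).
Proof.
move=> /andP[x0 x1] a0 ae e1; rewrite /second_order x1 (le_trans ae)//= [a + x]addrC.
by rewrite ler_wpM2r// addr_ge0.
Qed.

Section adapted.
Context {R : realType} {dO : measure_display} {Omega : measurableType dO}.
Variable F : R -> set (set Omega).
Hypothesis hF : filtration F.

Lemma adapted_measurable_fun (Y : R -> Omega -> R) t : adapted F Y -> 0 <= t ->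
  measurable_fun [set: g_sigma_algebraType (F t)]
    (Y t : g_sigma_algebraType (F t) -> R).
Proof.
move=> aY t0 _ U mU; have [sF _ _] := hF; rewrite setTI.
by rewrite (measurable_g_measurableTypeE (sF t t0)); exact: (aY t t0 U mU).
Qed.

Lemma measurable_fun_adapted (Y : R -> Omega -> R) :
  (forall t, 0 <= t -> measurable_fun [set: g_sigma_algebraType (F t)]
    (Y t : g_sigma_algebraType (F t) -> R)) -> adapted F Y.
Proof.
move=> mY t t0 U mU; have [sF _ _] := hF; have := mY t t0 measurableT U mU.
by rewrite setTI (measurable_g_measurableTypeE (sF t t0)).
Qed.

End adapted.

Definition bounded_event {R : realType} {Omega : Type} (X : R -> Omega -> R) : set Omega :=
  \bigcup_m \bigcap_n [set w | X n%:R w <= m%:R].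

(** The one-step inequality for [1_{X_t < N} (Phi t + N - X_t)], of which
    [1_{X_t < N} Phi t] is a lower bound. *)
Lemma truncated_increment {R : realType} (i j N : nat) (s t a : R) :
  (i <= j)%N -> 0 <= s -> 0 <= a -> t - s <= a ->
  (j%:R < N%:R :> R)%R%:R * (t + N%:R - j%:R) - (i%:R < N%:R :> R)%R%:R * (s + N%:R - i%:R) <=
  - (i%:R < N%:R :> R)%R%:R * ((j%:R - i%:R) - a) + 1 * second_order (j%:R - i%:R) a.
Proof.
move=> ij s0 a0 tsa; have ijR : i%:R <= j%:R :> R by rewrite ler_nat.
have x0 : 0 <= j%:R - i%:R :> R by rewrite subr_ge0.
have /andP[so0 _] := second_order_le x0 a0.
have [iN|Ni] := ltP (i%:R : R) N%:R; last first.
  have Nj : N%:R <= j%:R :> R by exact: le_trans ijR.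
  by rewrite ltNge Nj/= mul0r sub0r mul0r !oppr0 mul0r add0r mul1r.
have [jN|Nj] := ltP (j%:R : R) N%:R.
  rewrite /= !mul1r mulN1r; lra.
rewrite /= mul0r sub0r mul1r mulN1r mul1r.
(* A jump by at most one lands exactly on [N]; a larger one is paid for by the error term, which is
   then [x + a]. *)
have [small|] := boolP ((j%:R - i%:R <= 1 :> R) && (a <= 1)); last first.
  move=> h; have := so0; rewrite /second_order (negbTE h) => _; lra.
have /andP[x1 _] := small.
have jN : (j <= N)%N.
  move: x1 iN; rewrite lerBlDr nat1r ler_nat ltr_nat => ji iN'.
  exact: leq_trans iN'.
have jNR : j%:R <= N%:R :> R by rewrite ler_nat.
lra.
Qed.

(** Squaring [exp (- y / 2) >= 1 - y / 2] bounds [exp y] by [(1 - y / 2)^-2]; a polynomial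
    inequality remains, settled by factoring. *)
Lemma expR_le_quadratic {R : realType} (y : R) : 0 <= y <= 1 -> expR y <= 1 + y + 2 * y ^+ 2.
Proof.
move=> /andP[y0 y1]; have h := expR_ge1Dx (- (y / 2)).
have p : 0 < 1 + - (y / 2) by lra.
rewrite expRN in h.
have e2 : expR y = expR (y / 2) ^+ 2 by rewrite -expRM_natr divfK.
have e0 := expR_gt0 (y / 2).
have h1 : (1 + - (y / 2)) * expR (y / 2) <= 1.
  by rewrite -ler_pdivlMr// mul1r.
have h2 : (1 + - (y / 2)) ^+ 2 * expR y <= 1.
  rewrite e2 -exprMn -[leRHS](expr1n _ 2) ler_pXn2r// nnegrE//.
  by rewrite mulr_ge0 ?ltW.
have p2 : 0 < (1 + - (y / 2)) ^+ 2 by rewrite exprn_gt0.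
rewrite -(ler_pM2l p2); apply: le_trans h2 _.
rewrite -subr_ge0.
have -> : (1 + - (y / 2)) ^+ 2 * (1 + y + 2 * y ^+ 2) - 1 =
  y ^+ 2 * ((1 - y) * (5%:R / 4%:R - y / 2)) by field.
by rewrite !mulr_ge0//; lra.
Qed.

(** The first-order part of [(1 - c)^k exp (c x)] is [1 - c k + c x]. For [x <= 1] the rest is of
    order [x^2] if [k = 0] and [x] if [k = 1], which is the shape of [second_order]; for larger
    increments a crude bound suffices, since the error term is then [k + x] itself. *)
Lemma exponential_increment {R : realType} (C c m m' x : R) (k : nat) :
  0 < c < 1 -> 0 <= x -> 0 <= m <= C -> 0 <= m' <= C ->
  m' = m * ((1 - c) ^+ k * expR (c * x)) ->
  `|m' - m + c * m * (k%:R - x)| <= 3 * C * second_order k%:R x.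
Proof.
move=> /andP[c0 c1] x0 /andP[m0 mC] /andP[m'0 m'C] m'E.
have C0 := le_trans m0 mC.
have y0 : 0 <= c * x by rewrite mulr_ge0// ltW.
have yx : c * x <= x by rewrite -[leRHS]mul1r ler_wpM2r// ltW.
have k0 : 0 <= k%:R :> R by [].
rewrite /second_order; case: ifPn => [/andP[k1 x1]|_].
  have y1 : c * x <= 1 by exact: le_trans x1.
  have eu : expR (c * x) <= 1 + c * x + 2 * (c * x) ^+ 2 by rewrite expR_le_quadratic// y0.
  have el := expR_ge1Dx (c * x).
  move: k1 m'E; rewrite lern1; case: k {k0} => [|[|//]] _ ->.
    rewrite expr0 mul1r.
    have -> : m * expR (c * x) - m + c * m * (0%:R - x) = m * (expR (c * x) - 1 - c * x) by ring.
    rewrite ger0_norm; last by rewrite mulr_ge0//; lra.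
    apply: (@le_trans _ _ (C * (2 * x ^+ 2))).
      apply: ler_pM => //; first lra.
      apply: (@le_trans _ _ (2 * (c * x) ^+ 2)); first lra.
      by rewrite ler_pM2l// ler_pXn2r.
    rewrite addr0 -expr2 mulrA ler_wpM2r// ?sqr_ge0//; lra.
  rewrite expr1.
  have -> : m * ((1 - c) * expR (c * x)) - m + c * m * (1%:R - x) =
    m * ((1 - c) * (expR (c * x) - 1) - c * x) by ring.
  rewrite normrM (ger0_norm m0).
  apply: (@le_trans _ _ (C * (3 * x))); last first.
    rewrite mulrCA mulrA ler_wpM2l ?mulr_ge0//.
    by rewrite mulrDr mulr1 lerDr mulr_ge0.
  apply: ler_pM => //.
  have y2 : (c * x) ^+ 2 <= c * x by rewrite expr2 -[leRHS]mulr1 ler_wpM2l.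
  have u : 0 <= (1 - c) * (expR (c * x) - 1) by rewrite mulr_ge0//; lra.
  have v : (1 - c) * (expR (c * x) - 1) <= expR (c * x) - 1.
    by rewrite -[leRHS]mul1r ler_wpM2r//; lra.
  by rewrite ler_norml; apply/andP; split; lra.
have tot : `|c * m * (k%:R - x)| <= C * (k%:R + x).
  rewrite normrM ger0_norm ?mulr_ge0 ?(ltW c0)//; apply: ler_pM => //.
  - by rewrite mulr_ge0// ltW.
  - by rewrite (le_trans _ mC)// -[leRHS]mul1r ler_wpM2r// ltW.
  - by rewrite ler_norml; apply/andP; split; lra.
have p1 : (1 - c) ^+ k <= 1 by apply: exprn_ile1; lra.
have p0 : 0 <= (1 - c) ^+ k by apply: exprn_ge0; lra.
have e1 : 1 <= expR (c * x) by rewrite -expR0 ler_expR.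
have up : m' - m <= C * x.
  have : m' * (1 - c * x) <= m.
    have hN := expR_ge1Dx (- (c * x)).
    apply: (@le_trans _ _ (m' * expR (- (c * x)))); first by rewrite ler_wpM2l.
    rewrite m'E -mulrA -mulrA expRN mulfV ?mulr1 ?lt0r_neq0 ?expR_gt0//.
    by rewrite -[leRHS]mulr1 ler_wpM2l.
  have : m' * (c * x) <= C * x by apply: ler_pM.
  lra.
have low : m - m' <= C * k%:R.
  case: k k0 m'E tot p1 p0 => [|k] _ m'E _ _ _.
    rewrite m'E expr0 mul1r mulr0 subr_le0 -[leLHS]mulr1.
    by rewrite ler_wpM2l.
  apply: (@le_trans _ _ C); first lra.
  by rewrite -[leLHS]mulr1 ler_wpM2l// ler1n.
have Cx : 0 <= C * x by rewrite mulr_ge0.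
have Ck : 0 <= C * k%:R by rewrite mulr_ge0.
move: tot; rewrite !ler_norml mulrDr => /andP[t1 t2].
have -> : 3 * C * (k%:R + x) = 3 * (C * k%:R) + 3 * (C * x) by ring.
by apply/andP; split; lra.
Qed.

(** * Expectations along a compensated counting process *)

Section compensated_process.
Context {R : realType} {dO : measure_display} {Omega : measurableType dO}.
Variables (P : probability Omega R) (F : R -> set (set Omega)).
Variables (X A : R -> Omega -> R) (Phi : R -> R).
Hypotheses (hF : filtration F) (aX : adapted F X) (aA : adapted F A).
Hypothesis Phi_nd : forall s t, s <= t -> Phi s <= Phi t.
Hypothesis Phi_le0 : forall v, v <= 0 -> Phi v = 0.
Hypothesis Phi_uc : forall T e, 0 < e -> exists2 h, 0 < h &
  forall s t, s <= t -> t <= T -> t - s < h -> Phi t - Phi s < e.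
Local Notation good w := (compensated_path Phi (X ^~ w) (A ^~ w)).
Hypothesis ae_good : {ae P, forall w, good w}.
Hypothesis intX : forall t, 0 <= t -> P.-integrable setT (EFin \o X t).
Hypothesis XA : forall s t E, 0 <= s -> s <= t -> F s E ->
  (\int[P]_(w in E) (X t w - X s w)%:E = \int[P]_(w in E) (A t w - A s w)%:E)%E.

Lemma adapted_measurable Y t : adapted F Y -> 0 <= t -> measurable_fun setT (Y t).
Proof.
move=> aY t0 _ U mU; rewrite setTI; have [_ Fm _] := hF.
by apply: (Fm t t0); exact: (aY t t0 U mU).
Qed.

(** With [s = 0] and the whole space, [XA] gives the almost surely non-negative [A t] the finite
    mean of [X t - X 0]. *)
Lemma integrable_compensator t : 0 <= t -> P.-integrable setT (EFin \o A t).
Proof.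
move=> t0; have mA := adapted_measurable aA t0.
apply/integrableP; split; first exact/measurable_EFinP.
have [s0 _ _] := hF.
have FT : F 0 setT by have [G0 GC _] := s0 0 (lexx 0); rewrite -[setT]setD0; exact: GC.
rewrite (_ : (\int[P]_w _)%E = (\int[P]_w (A t w - A 0 w)%:E)%E); last first.
  apply: ae_eq_integral => //.
  - by apply/measurable_EFinP; exact: measurableT_comp.
  - by apply/measurable_EFinP; apply: measurable_funB => //; exact: adapted_measurable.
  apply: filterS ae_good => w gw _ /=.
  by rewrite (compensator_zero Phi_le0 gw) subr0 ger0_norm// (compensator_ge0 Phi_nd Phi_le0 gw t0).
rewrite -XA//.
have : P.-integrable setT (fun w => (X t w)%:E - (X 0 w)%:E)%E.
  by apply: integrableB => //; exact: intX.
move=> /integrable_fin_num-/(_ measurableT).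
by rewrite ltey_eq => ->.
Qed.

Let D s t w := (X t w - X s w) - (A t w - A s w).

Let intD s t : 0 <= s -> s <= t -> P.-integrable setT (EFin \o D s t).
Proof.
move=> s0 st; have t0 := le_trans s0 st.
have -> : EFin \o D s t = (fun w => ((X t w)%:E - (X s w)%:E) - ((A t w)%:E - (A s w)%:E))%E.
  by [].
have iX u : 0 <= u -> P.-integrable setT (fun w => (X u w)%:E) by exact: intX.
have iA u : 0 <= u -> P.-integrable setT (fun w => (A u w)%:E) by exact: integrable_compensator.
by apply: integrableB => //; apply: integrableB => //; [exact: iX|exact: iX|exact: iA|exact: iA].
Qed.

Let D_orth s t E : 0 <= s -> s <= t -> F s E -> (\int[P]_(w in E) (D s t w)%:E = 0)%E.
Proof.
move=> s0 st FE; have t0 := le_trans s0 st.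
have mE : measurable E by have [_ Fm _] := hF; exact: (Fm s s0).
have sub Y : (forall u, 0 <= u -> P.-integrable setT (EFin \o Y u)) ->
    P.-integrable E (EFin \o (fun w => Y t w - Y s w)).
  move=> iY; apply: (integrableS measurableT) => //.
  rewrite (_ : _ \o _ = (fun w => (Y t w)%:E - (Y s w)%:E)%E)//.
  by apply: integrableB => //; exact: iY.
have iX := sub X intX; have iA := sub A integrable_compensator.
rewrite (integralB_EFin mE iX iA) XA// subee//.
exact: (integrable_fin_num mE iA).
Qed.

Section compare.
Variables (T C K : R) (W Y : R -> Omega -> R).
Hypothesis T0 : 0 <= T.
Hypothesis aY : adapted F Y.
Hypothesis YC : forall s w, `|Y s w| <= C.
Hypothesis intW : forall t, 0 <= t -> t <= T -> P.-integrable setT (EFin \o W t).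
Hypothesis W_increment : forall w s t, good w -> 0 <= s -> s <= t -> t <= T ->
  W t w - W s w <= Y s w * D s t w +
    K * second_order (X t w - X s w) (A t w - A s w).

Let time m i : R := i%:R / m.+1%:R * T.

Let time0 m : time m 0 = 0. Proof. by rewrite /time !mul0r. Qed.

Let timeT m : time m m.+1 = T.
Proof. by rewrite /time divff ?mul1r// pnatr_eq0. Qed.

Let time_ge0 m i : 0 <= time m i.
Proof. by rewrite !mulr_ge0. Qed.

Let time_le m i j : (i <= j)%N -> time m i <= time m j.
Proof. by move=> ij; rewrite !ler_wpM2r// ler_nat. Qed.

Let remainder m w := \sum_(i < m.+1)
  second_order (X (time m i.+1) w - X (time m i) w) (A (time m i.+1) w - A (time m i) w).

Let mremainder m : measurable_fun setT (remainder m).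
Proof.
apply: measurable_sum => i.
have mX := adapted_measurable aX (time_ge0 m i).
have mX' := adapted_measurable aX (time_ge0 m i.+1).
have mA := adapted_measurable aA (time_ge0 m i).
have mA' := adapted_measurable aA (time_ge0 m i.+1).
have mdX := measurable_funB mX' mX; have mdA := measurable_funB mA' mA.
apply: measurable_fun_ifT.
- by apply: measurable_and; apply: measurable_fun_ler => //; exact: measurable_cst.
- by apply: measurable_funM => //; exact: measurable_funD.
- exact: measurable_funD.
Qed.

Let remainder_le m w : good w -> 0 <= remainder m w <= X T w + A T w.
Proof.
move=> gw.
have h (i : 'I_m.+1) : true ->
    0 <= second_order (X (time m i.+1) w - X (time m i) w)
      (A (time m i.+1) w - A (time m i) w)
    <= (X (time m i.+1) w - X (time m i) w) + (A (time m i.+1) w - A (time m i) w).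
  move=> _; apply: second_order_le; rewrite subr_ge0.
    by apply: (compensated_nd gw) => //; exact: time_le.
  by apply: (compensator_nd Phi_nd gw) => //; exact: time_le.
apply/andP; split; first by apply: sumr_ge0 => i /(h i)/andP[].
apply: (@le_trans _ _ (\sum_(i < m.+1)
  ((X (time m i.+1) w - X (time m i) w) + (A (time m i.+1) w - A (time m i) w)))).
  by apply: ler_sum => i /(h i)/andP[].
rewrite big_split/= -!(big_mkord xpredT (fun i => _ (time m i.+1) w - _ (time m i) w)).
rewrite !(telescope_sumr (fun i => _ (time m i) w))// time0 timeT.
by rewrite (compensated_zero gw) (compensator_zero Phi_le0 gw) !subr0.
Qed.

(** Once the mesh is fine, every step has at most one jump and a compensator increment at most [e'],
    so the errors add up to at most [e'] times [X T + A T]. *)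
Let remainder_cvg w : good w -> remainder m w @[m --> \oo] --> 0.
Proof.
move=> gw; pose S := X T w + A T w.
have S0 : 0 <= S by rewrite addr_ge0 ?(compensated_ge0 gw)// (compensator_ge0 Phi_nd Phi_le0 gw).
apply/cvgrPdist_le => e e0.
(* The cap at 1 keeps every step in the first case of [second_order]; [S + 1] avoids a division by
   0. *)
pose e' := Num.min 1 (e / (S + 1)).
have e'0 : 0 < e' by rewrite lt_min ltr01 divr_gt0// ltr_wpDl.
have e'1 : e' <= 1 by rewrite ge_min lexx.
have [h1 h10 hA] := compensator_small_increments Phi_uc gw T0 e'0.
have [h2 h20 hX] := counting_small_increments gw T0.
pose N := Num.bound (T / Num.min h1 h2).
have hN : T / Num.min h1 h2 < N%:R by rewrite /N ltr_bound// divr_ge0// le_min !ltW.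
near=> m; rewrite sub0r normrN ger0_norm; last by have /andP[] := remainder_le m gw.
have mesh i : time m i.+1 - time m i < Num.min h1 h2.
  rewrite /time -!mulrBl -natrB// subSnn mul1r mulrC -ltr_pdivlMr ?invr_gt0 ?ltr0n//.
  rewrite invrK -ltr_pdivrMl ?lt_min ?h10// mulrC (lt_le_trans hN)// ler_nat.
  by near: m; exists N => // k /= /leqW.
have small i : (i < m.+1)%N ->
    second_order (X (time m i.+1) w - X (time m i) w) (A (time m i.+1) w - A (time m i) w) <=
    e' * ((X (time m i.+1) w - X (time m i) w) + (A (time m i.+1) w - A (time m i) w)).
  move=> im; have le := time_le m (leqnSn i); have le' : time m i.+1 <= T.
    by rewrite -(timeT m) time_le.
  have /andP[m1 m2] : (time m i.+1 - time m i < h1) && (time m i.+1 - time m i < h2).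
    by rewrite -lt_min.
  apply: second_order_small => //.
  - by rewrite subr_ge0 (compensated_nd gw)//= hX.
  - by rewrite subr_ge0 (compensator_nd Phi_nd gw).
  - exact: hA.
apply: (@le_trans _ _ (e' * S)); last first.
  apply: (@le_trans _ _ (e / (S + 1) * S)).
    by rewrite ler_wpM2r// ge_min lexx orbT.
  rewrite mulrAC ler_pdivrMr ?ltr_wpDl// ler_wpM2l ?(ltW e0)//.
  by rewrite lerDl.
have -> : S = \sum_(i < m.+1)
    ((X (time m i.+1) w - X (time m i) w) + (A (time m i.+1) w - A (time m i) w)).
  rewrite big_split/= -!(big_mkord xpredT (fun i => _ (time m i.+1) w - _ (time m i) w)).
  rewrite !(telescope_sumr (fun i => _ (time m i) w))// time0 timeT.
  by rewrite (compensated_zero gw) (compensator_zero Phi_le0 gw) !subr0.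
by rewrite mulr_sumr; apply: ler_sum => i _; exact: small.
Unshelve. all: by end_near. Qed.

Let iXA : P.-integrable setT (fun w => (X T w + A T w)%:E).
Proof.
rewrite (_ : (fun w => _) = (fun w => (X T w)%:E + (A T w)%:E)%E)//.
by apply: integrableD => //; [exact: intX|exact: integrable_compensator].
Qed.

Let int_remainder m : P.-integrable setT (EFin \o remainder m).
Proof.
apply/integrableP; split; first by apply/measurable_EFinP.
apply: le_lt_trans (_ : (\int[P]_w `|(X T w + A T w)%:E| < +oo)%E); last first.
  by have /integrableP[] := iXA.
apply: ae_ge0_le_integral => //.
- by apply/measurable_EFinP; exact: measurableT_comp.
- by apply: measurableT_comp => //; exact: measurable_int iXA.
apply: filterS ae_good => w gw _; have /andP[r0 rXA] := remainder_le m gw.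
by rewrite /= !ger0_norm ?lee_fin// (le_trans r0).
Qed.

Let cvg_int_remainder : (\int[P]_w (remainder m w)%:E)%E @[m --> \oo] --> (0 : \bar R)%E.
Proof.
case: (@dominated_convergence _ Omega R P setT measurableT
  (fun m w => (remainder m w)%:E) (cst 0%E) (fun w => (X T w + A T w)%:E)); last 1 first.
- by move=> _ _; rewrite integral0.
- by move=> m; exact/measurable_EFinP.
- exact: measurable_cst.
- apply: filterS ae_good => w gw _; apply: cvg_EFin; first by apply: nearW.
  exact: remainder_cvg.
- exact: iXA.
- apply: filterS ae_good => w gw m _; have /andP[r0 rXA] := remainder_le m gw.
  by rewrite abse_EFin lee_fin ger0_norm.
Qed.

(** A substitute for Ito's formula: the increments of [W] are, up to second
    order, integrals against the martingale [X - A]. *)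
Lemma compare_expectation : (\int[P]_w (W T w)%:E <= \int[P]_w (W 0 w)%:E)%E.
Proof.
pose S m w := \sum_(i < m.+1) Y (time m i) w * D (time m i) (time m i.+1) w.
have mY s : 0 <= s -> measurable_fun setT (Y s) by exact: adapted_measurable.
have iYD m i : P.-integrable setT (fun w => (Y (time m i) w * D (time m i) (time m i.+1) w)%:E).
  apply: (integrable_bounded_mul (intD (time_ge0 m i) (time_le m (leqnSn i))) (C := C)) => //.
  exact: mY.
have iS m : P.-integrable setT (EFin \o S m).
  rewrite (_ : _ \o _ = (fun w => \sum_(i < m.+1) (Y (time m i) w * D (time m i) (time m i.+1) w)%:E)%E).
    by apply: integrable_sum => // i _.
  by apply/funext => w; rewrite /= sumEFin.
have S0 m : (\int[P]_w (S m w)%:E = 0)%E.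
  under eq_integral do rewrite -sumEFin.
  rewrite integral_sum// big1// => i _.
  have [sF Fm _] := hF; pose s := time m i; have s0 : 0 <= s := time_ge0 m i.
  have le := time_le m (leqnSn i).
  apply: (orthogonal_bounded (sF s s0) (Fm s s0) (intD s0 le) (fun E => D_orth s0 le) (C := C)) => //.
  exact: aY.
have bound m : (\int[P]_w (W T w)%:E <= \int[P]_w (W 0 w)%:E + K%:E * \int[P]_w (remainder m w)%:E)%E.
  have iKr : P.-integrable setT (EFin \o (fun w => K * remainder m w)).
    rewrite (_ : _ \o _ = (fun w => K%:E * (remainder m w)%:E)%E)//.
    by apply: integrableZl => //; exact: int_remainder.
  have i0 := intW (lexx 0) T0.
  have iSr : P.-integrable setT (EFin \o (fun w => S m w + K * remainder m w)).
    by rewrite (_ : _ \o _ = (fun w => (S m w)%:E + (K * remainder m w)%:E)%E)//;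
      exact: (integrableD measurableT (iS m) iKr).
  have iWSr : P.-integrable setT (EFin \o (fun w => W 0 w + (S m w + K * remainder m w))).
    by rewrite (_ : _ \o _ = (fun w => (W 0 w)%:E + (S m w + K * remainder m w)%:E)%E)//;
      exact: (integrableD measurableT i0 iSr).
  have -> : (\int[P]_w (W 0 w)%:E + K%:E * \int[P]_w (remainder m w)%:E =
      \int[P]_w (W 0 w + (S m w + K * remainder m w))%:E)%E.
    rewrite integralD_EFin// integralD_EFin// S0 add0e; congr (_ + _)%E.
    by rewrite -(integralZl measurableT (int_remainder m)).
  apply: ae_le_integral => //; first exact: intW.
  apply: filterS ae_good => w gw; rewrite -lerBlDl.
  have -> : W T w - W 0 w = \sum_(i < m.+1) (W (time m i.+1) w - W (time m i) w).
    by rewrite -(big_mkord xpredT (fun i => W (time m i.+1) w - W (time m i) w))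
      (telescope_sumr (fun i => W (time m i) w))// time0 timeT.
  rewrite mulr_sumr -big_split/=; apply: ler_sum => i _; apply: W_increment => //.
    exact: time_le.
  by rewrite -(timeT m) time_le.
have c : (\int[P]_w (W 0 w)%:E + K%:E * \int[P]_w (remainder m w)%:E)%E @[m --> \oo] -->
    (\int[P]_w (W 0 w)%:E)%E.
  rewrite -[X in _ --> X]adde0; apply: cvgeD.
  - by rewrite fin_num_adde_defl//.
  - exact: cvg_cst.
  - rewrite -(mule0 K%:E); apply: cvgeZl => //; exact: cvg_int_remainder.
rewrite -(cvg_lim _ c)//; apply: lime_ge; first by apply/cvg_ex; eexists; exact: c.
exact: nearW.
Qed.

End compare.

Let mX t : 0 <= t -> measurable_fun setT (X t).
Proof. by move=> t0; exact: (adapted_measurable aX t0). Qed.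

Lemma measurable_bounded_event : measurable (bounded_event X).
Proof.
apply: bigcup_measurable => m _; apply: bigcapT_measurable => n.
rewrite -[X in measurable X]setTI.
have -> : [set w | X n%:R w <= m%:R] = X n%:R @^-1` `]-oo, m%:R].
  by apply/seteqP; split => w /=; rewrite in_itv.
by apply: mX => //; exact: measurable_itv.
Qed.

Let Phi_ge0 v : 0 <= Phi v.
Proof.
have [v0|v0] := leP v 0; first by rewrite Phi_le0.
by rewrite -(Phi_le0 (lexx 0)) Phi_nd// ltW.
Qed.

(** Below level [N] the process [W] moves by [dPhi - dX] with [dPhi <= dA], so it decreases on
    average; a unit jump onto [N] makes it drop by at least 1, as much as the compensation
    requires. *)
Lemma prob_lt_mul_compensator N T : 0 <= T ->
  ((Phi T)%:E * P [set w | X T w < N%:R]%R <= N%:R%:E)%E.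
Proof.
move=> T0; pose Y t w : R := (X t w < N%:R)%R%:R.
pose W t w := Y t w * (Phi t + N%:R - X t w).
have mlt d (S : measurableType d) (g : S -> R) : measurable_fun setT g ->
    measurable_fun setT (fun w => (g w < N%:R)%R%:R : R).
  move=> mg; have -> : (fun w => (g w < N%:R)%R%:R : R) =
      (fun w => if g w < N%:R then 1 else 0) by apply/funext => w; case: ifP.
  by apply: measurable_fun_ifT => //; apply: measurable_fun_ltr.
have Y1 t w : `|Y t w| <= 1 by rewrite /Y; case: ltP => _; rewrite ?normr1 ?normr0.
have iPX t : 0 <= t -> P.-integrable setT (EFin \o (fun w => Phi t + N%:R - X t w)).
  move=> t0; rewrite (_ : _ \o _ = (fun w => (Phi t + N%:R)%:E - (X t w)%:E)%E)//.
  apply: integrableB => //; last exact: intX.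
  exact: finite_measure_integrable_cst.
have iW t : 0 <= t -> P.-integrable setT (EFin \o W t).
  move=> t0; apply: (integrable_bounded_mul (iPX t t0) (C := 1)) => //.
  by apply: mlt; exact: mX.
have le := @compare_expectation T 1 1 W (fun t w => - Y t w) T0 _ _ (fun t t0 _ => iW t t0) _.
have W0 : (\int[P]_w (W 0 w)%:E <= N%:R%:E)%E.
  rewrite -[leRHS]mule1 -(@probability_setT _ _ _ P) -integral_cst//.
  apply: ae_le_integral => //; first exact: iW.
    exact: finite_measure_integrable_cst.
  apply: filterS ae_good => w gw; rewrite /W /Y (compensated_zero gw) Phi_le0// add0r subr0.
  by case: ltP => _; rewrite ?mul1r ?mul0r.
apply: le_trans W0; apply: le_trans (le _ _ _); last first.
- move=> w s t gw s0 st tT; have t0 := le_trans s0 st.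
  have [xnat _ _ _] := compensated_counting gw.
  have [i xs] := xnat s s0; have [j xt] := xnat t t0.
  rewrite /W /Y /D xs xt; apply: truncated_increment.
  + by rewrite -(ler_nat R) -xs -xt (compensated_nd gw).
  + exact: Phi_ge0.
  + by rewrite subr_ge0 (compensator_nd Phi_nd gw).
  + exact: (compensator_increment Phi_nd gw).
- by move=> s w; rewrite normrN.
- apply: measurable_fun_adapted => // t t0; apply: measurableT_comp => //.
  by apply: mlt; exact: adapted_measurable_fun.
have mE : measurable [set w | X T w < N%:R].
  rewrite -[X in measurable X]setTI.
  have -> : [set w | X T w < N%:R] = X T @^-1` `]-oo, N%:R[.
    by apply/seteqP; split => w /=; rewrite in_itv.
  by apply: mX => //; exact: measurable_itv.
have iE : P.-integrable setT (EFin \o (fun w => Phi T * \1_[set w | X T w < N%:R] w)).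
  rewrite (_ : _ \o _ = (fun w => (Phi T)%:E * (\1_[set w | X T w < N%:R] w)%:E)%E)//.
  by apply: integrableZl => //; exact: integrable_indic.
rewrite -[X in (_ * P X)%E]setIT -integral_indic// -integralZl//; last exact: integrable_indic.
apply: (@ae_le_integral _ _ _ P (fun w => Phi T * \1_[set w | X T w < N%:R] w) (W T)) => //.
  exact: iW.
apply: filterS ae_good => w gw; rewrite indicE /W /Y.
have [xN|Nx] := ltP (X T w) N%:R; last by rewrite memNset ?mulr0 ?mul0r//=; apply/negP; rewrite -leNgt.
by rewrite mem_set// mulr1 mul1r -addrA lerDl subr_ge0 ltW.
Qed.

Lemma bounded_event_null : (forall y, exists n : nat, y <= Phi n%:R) ->
  P (bounded_event X) = 0%E.
Proof.
move=> Phioo; apply/eqP; rewrite eq_le measure_ge0 andbT.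
have mB m : measurable (\bigcap_n [set w | X n%:R w <= m%:R]).
  apply: bigcapT_measurable => n; rewrite -[X in measurable X]setTI.
  have -> : [set w | X n%:R w <= m%:R] = X n%:R @^-1` `]-oo, m%:R].
    by apply/seteqP; split => w /=; rewrite in_itv.
  by apply: mX => //; exact: measurable_itv.
have B0 m : P (\bigcap_n [set w | X n%:R w <= m%:R]) = 0%E.
  have fB := fin_num_measure P _ (mB m).
  apply/eqP; rewrite eq_le measure_ge0 andbT leNgt; apply/negP.
  rewrite -[X in (_ < X)%E](fineK fB) lte_fin => p0.
  set p := fine _ in p0.
  (* The extra 1 makes the contradiction strict: the product of [Phi n] and [p] is at least [m + 2],
     against the bound [m + 1]. *)
  have [n hn] := Phioo ((m.+1%:R + 1) / p).
  have Phi0 : 0 < Phi n%:R by apply: lt_le_trans hn; rewrite divr_gt0.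
  have := @prob_lt_mul_compensator m.+1 n%:R (ler0n _ _).
  apply/negP; rewrite -ltNge; apply: (@lt_le_trans _ _ ((Phi n%:R)%:E * p%:E)%E).
    rewrite -EFinM lte_fin -ltr_pdivrMr//; apply: lt_le_trans hn.
    by rewrite ltr_pM2r ?invr_gt0// ltrDl.
  rewrite lee_pmul2l//= /p fineK//; apply: le_measure; rewrite ?inE//.
    rewrite -[X in measurable X]setTI.
    have -> : [set w | X n%:R w < m.+1%:R] = X n%:R @^-1` `]-oo, m.+1%:R[.
      by apply/seteqP; split => w /=; rewrite in_itv.
    by apply: mX => //; exact: measurable_itv.
  by move=> w /(_ n I)/= h; rewrite (le_lt_trans h)// ltr_nat.
apply: (le_trans (measure_sigma_subadditive _ _ _ (@subset_refl _ _))) => //.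
  exact: measurable_bounded_event.
by rewrite eseries0// => m _ _; exact: B0.
Qed.

Variable L : R.
Hypothesis PhiL : forall t, Phi t <= L.

Section exponential_martingale.
Variable c : R.
Hypotheses (c01 : 0 < c < 1) (subcritical : c * L + ln (1 - c) < 0).

Let c0 : 0 < c. Proof. by have /andP[] := c01. Qed.
Let c1 : 0 < 1 - c. Proof. by have /andP[_] := c01; rewrite subr_gt0. Qed.

Let C := expR (c * L).

(** The truncation is inactive on the paths of interest, and makes [expmart]
    bounded everywhere. *)
Definition expmart t w : R := Num.min C (expR (X t w * ln (1 - c) + c * A t w)).

Lemma expmart_bound t w : 0 <= expmart t w <= C.
Proof.
by rewrite /expmart le_min !expR_ge0/= ge_min lexx.
Qed.

(** By [A <= L (1 + X)] the exponent is at most [c L + (c L + ln (1 - c)) X], hence at most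
    [c L]. *)
Lemma expmartE t w : good w -> 0 <= t ->
  expmart t w = expR (X t w * ln (1 - c) + c * A t w).
Proof.
move=> gw t0; rewrite /expmart min_r// ler_expR.
have X0 := compensated_ge0 gw t0; have AX := compensator_le Phi_nd gw t0.
have : A t w <= L * (1 + X t w) by rewrite (le_trans AX)// ler_wpM2r// addr_ge0.
rewrite -(ler_pM2l c0) => h.
have : X t w * (c * L + ln (1 - c)) <= 0 by rewrite mulr_ge0_le0// ltW.
lra.
Qed.

Lemma adapted_expmart : adapted F expmart.
Proof.
apply: measurable_fun_adapted => // t t0.
apply: measurable_minr; first exact: measurable_cst.
apply: measurableT_comp => //; apply: measurable_funD; apply: measurable_funM => //.
- exact: (adapted_measurable_fun hF aX t0).
- exact: (adapted_measurable_fun hF aA t0).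
Qed.

Lemma measurable_expmart t : 0 <= t -> measurable_fun setT (expmart t).
Proof. by move=> t0; exact: (adapted_measurable adapted_expmart t0). Qed.

Let integrable_expmart t : 0 <= t -> P.-integrable setT (EFin \o expmart t).
Proof.
move=> t0; apply: (@le_integrable _ _ _ P setT measurableT _ (EFin \o cst C)).
- by apply/measurable_EFinP; exact: measurable_expmart.
- move=> w _; have /andP[m0 mC] := expmart_bound t w.
  by rewrite /= lee_fin !ger0_norm// (le_trans m0).
- exact: finite_measure_integrable_cst.
Qed.

Let increment w s t : good w -> 0 <= s -> s <= t ->
  `|expmart t w - expmart s w + c * expmart s w * ((X t w - X s w) - (A t w - A s w))|
  <= 3 * C * second_order (X t w - X s w) (A t w - A s w).
Proof.
move=> gw s0 st; have t0 := le_trans s0 st.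
have [xnat _ _ _] := compensated_counting gw.
have [i xs] := xnat s s0; have [j xt] := xnat t t0.
have ij : (i <= j)%N by rewrite -(ler_nat R) -xs -xt (compensated_nd gw).
have -> : X t w - X s w = (j - i)%:R by rewrite xs xt natrB.
apply: exponential_increment; rewrite ?expmart_bound//.
  by rewrite subr_ge0 (compensator_nd Phi_nd gw).
rewrite !expmartE// -[in RHS](lnK c1) -expRM_natl -!expRD; congr expR.
by rewrite xs xt natrB// lnK//; ring.
Qed.

(** The first-order expansion is two-sided, so [compare_expectation] applies both to [expmart] and
    to its opposite. *)
Lemma expectation_expmart T : 0 <= T -> (\int[P]_w (expmart T w)%:E = 1)%E.
Proof.
move=> T0.
have start : (\int[P]_w (expmart 0 w)%:E = 1)%E.
  rewrite -(@probability_setT _ _ _ P) -[RHS]mul1e -integral_cst//.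
  apply: ae_eq_integral => //.
    by apply/measurable_EFinP; exact: measurable_expmart.
  apply: filterS ae_good => w gw _; rewrite expmartE//.
  by rewrite (compensated_zero gw) (compensator_zero Phi_le0 gw) mul0r mulr0 add0r expR0.
have cb t w : `|c * expmart t w| <= c * C.
  have /andP[m0 mC] := expmart_bound t w.
  by rewrite ger0_norm ?mulr_ge0 ?(ltW c0)// ler_pM2l.
have madapt : adapted F (fun t w => c * expmart t w).
  apply: measurable_fun_adapted => // t t0; apply: measurable_funM => //.
  exact: (adapted_measurable_fun hF adapted_expmart t0).
have madapt' : adapted F (fun t w => - (c * expmart t w)).
  apply: measurable_fun_adapted => // t t0; apply: measurableT_comp => //.
  exact: (adapted_measurable_fun hF madapt t0).
apply/eqP; rewrite eq_le; apply/andP; split.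
  rewrite -start.
  apply: (@compare_expectation T (c * C) (3 * C) expmart (fun t w => - (c * expmart t w))) => //.
  - by move=> t w; rewrite normrN.
  - by move=> t t0 _; exact: integrable_expmart.
  - move=> w s t gw s0 st _; have := increment gw s0 st.
    by rewrite ler_norml /D => /andP[_]; lra.
have opp t : 0 <= t ->
    (\int[P]_w (- expmart t w)%:E = - \int[P]_w (expmart t w)%:E)%E.
  move=> t0; exact: (integralN (integrable_add_def measurableT (integrable_expmart t0))).
rewrite -start -leeN2 -(opp T T0) -(opp 0 (lexx 0)).
apply: (@compare_expectation T (c * C) (3 * C) (fun t w => - expmart t w)
  (fun t w => c * expmart t w)) => //.
- move=> t t0 _; rewrite (_ : _ \o _ = (fun w => - (expmart t w)%:E)%E)//.
  exact: (integrableN (integrable_expmart t0)).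
- move=> w s t gw s0 st _; have := increment gw s0 st.
  by rewrite ler_norml /D => /andP[+ _]; lra.
Qed.

End exponential_martingale.

Hypothesis cvg_Phi : Phi n%:R @[n --> \oo] --> L.

Let L0 : 0 <= L. Proof. by rewrite -(Phi_le0 (lexx 0)). Qed.

(** A limsup is measurable whatever the paths are. [fine] sends an infinite value to 0, which is
    harmless because [limit_expmart] multiplies by the indicator of [bounded_event]. *)
Definition limit_count w : R := fine (limn_esup (fun n => (X n%:R w)%:E)).

(** A bounded set of integers has a maximum, and a non-decreasing path stays there once it is
    reached. *)
Lemma bounded_stabilizes w : good w -> bounded_event X w ->
  exists n0, forall n, (n0 <= n)%N -> X n%:R w = X n0%:R w.
Proof.
move=> gw [m _ Xm]; have [xnat _ _ _] := compensated_counting gw.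
pose p k := `[< exists n : nat, X n%:R w = k%:R >].
have p0 : exists k, p k by have [k xk] := xnat 0%:R (ler0n _ _); exists k; apply/asboolP; exists 0%N.
have pm k : p k -> (k <= m)%N.
  by move=> /asboolP[n xk]; rewrite -(ler_nat R) -xk; exact: Xm.
case: (ex_maxnP p0 pm) => k /asboolP[n0 xn0] kmax; exists n0 => n n0n.
apply/eqP; rewrite eq_le; apply/andP; split; last first.
  by apply: (compensated_nd gw) => //; rewrite ler_nat.
rewrite xn0.
have [j xj] := xnat n%:R (ler0n _ _).
by rewrite xj ler_nat kmax//; apply/asboolP; exists n.
Qed.

Let limit_countE w n0 : (forall n, (n0 <= n)%N -> X n%:R w = X n0%:R w) ->
  limit_count w = X n0%:R w.
Proof.
move=> h; rewrite /limit_count.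
have c : (X n%:R w)%:E @[n --> \oo] --> (X n0%:R w)%:E.
  by apply: cvg_near_cst; exists n0 => // n /= /h ->.
by rewrite is_cvg_limn_esupE ?(cvg_lim _ c)//; apply/cvg_ex; eexists; exact: c.
Qed.

Lemma measurable_limit_count : measurable_fun setT limit_count.
Proof.
apply: measurableT_comp => //; apply: measurable_fun_limn_esup => n.
by apply/measurable_EFinP; exact: (adapted_measurable aX).
Qed.

Definition limit_expmart c w : R :=
  \1_(bounded_event X) w * expR (c * L + (c * L + ln (1 - c)) * limit_count w).

Let measurable_limit_expmart c : measurable_fun setT (limit_expmart c).
Proof.
apply: measurable_funM.
  by apply: measurable_indic; exact: (measurable_bounded_event).
apply: measurableT_comp => //; apply: measurable_funD => //.
by apply: measurable_funM => //; exact: measurable_limit_count.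
Qed.

(** No jump occurs along the integer times after [n0], so [compensator_ge] at time [n + n0] and
    [compensator_le] squeeze the value between [Phi n] and [L] times the same factor. *)
Let compensator_cvg w n0 : good w ->
  (forall n, (n0 <= n)%N -> X n%:R w = X n0%:R w) ->
  A n%:R w @[n --> \oo] --> L * (1 + X n0%:R w).
Proof.
move=> gw h; rewrite -(cvg_shiftn n0).
have q0 := compensated_ge0 gw (ler0n R n0).
apply: (@squeeze_cvgr _ _ _ _ (fun n => Phi n%:R * (1 + X n0%:R w)) (cst (L * (1 + X n0%:R w)))).
- apply: nearW => n /=; have Xn : X (n + n0)%:R w = X n0%:R w by apply: h; exact: leq_addl.
  apply/andP; split; last first.
    apply: le_trans (compensator_le Phi_nd gw (ler0n R (n + n0))) _.
    by rewrite Xn ler_wpM2r// addr_ge0.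
  have := compensator_ge Phi_nd gw (T := n0%:R) (t := (n + n0)%:R).
  by rewrite -natrB ?leq_addl// addnK; apply => //; rewrite ler_nat leq_addl.
- by apply: cvgM => //; exact: cvg_cst.
- exact: cvg_cst.
Qed.

Lemma expmart_cvg c w : 0 < c < 1 -> c * L + ln (1 - c) < 0 -> good w ->
  expmart c n%:R w @[n --> \oo] --> limit_expmart c w.
Proof.
move=> c01 sub gw; have /andP[c0 c1] := c01.
rewrite /limit_expmart indicE; have [Bw|nB] := boolP (w \in bounded_event X); last first.
  rewrite mul0r; pose C := expR (c * L); pose b := - (c * L + ln (1 - c)).
  have b0 : 0 < b by rewrite oppr_gt0.
  apply/cvgrPdist_le => e e0.
  (* Since [exp (b x) >= b x], the bound [C exp (- b x)] is at most [e] as soon as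
     [x >= C / (e b)]. *)
  pose m := Num.bound (C / e / b).
  have hm : C / e / b < m%:R by rewrite /m ltr_bound// !divr_ge0 ?expR_ge0// ltW.
  have [n0 hn0] : exists n0 : nat, m%:R < X n0%:R w.
    apply: contrapT => nex; move/negP: nB; apply; apply/mem_set; exists m => // n _ /=.
    by rewrite leNgt; apply/negP => lt; apply: nex; exists n.
  exists n0 => // n /= n0n; rewrite sub0r normrN.
  have /andP[M0 _] := expmart_bound c n%:R w.
  rewrite ger0_norm// (expmartE c01 sub gw (ler0n R n)).
  have Xn : m%:R <= X n%:R w.
    by rewrite (le_trans (ltW hn0))// (compensated_nd gw)// ler_nat.
  have X0 := compensated_ge0 gw (ler0n R n).
  have AX : A n%:R w <= L * (1 + X n%:R w).
    by rewrite (le_trans (compensator_le Phi_nd gw (ler0n R n)))// ler_wpM2r// addr_ge0.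
  apply: (@le_trans _ _ (C * expR (- (b * X n%:R w)))).
    rewrite -expRD ler_expR; move: AX; rewrite -(ler_pM2l c0) /b; lra.
  have y0 : 0 < b * m%:R.
    by rewrite mulr_gt0// (le_lt_trans _ hm)// !divr_ge0 ?expR_ge0// ltW.
  rewrite expRN ler_pdivrMr ?expR_gt0//.
  apply: (@le_trans _ _ (e * (b * X n%:R w))); last first.
    rewrite ler_pM2l// (le_trans _ (expR_ge1Dx _))// lerDr//.
  rewrite mulrCA -ler_pdivrMl// mulrC -ler_pdivrMl// mulrC.
  have -> : e^-1 * (b^-1 * C) = C / e / b by ring.
  by rewrite (le_trans _ Xn)// ltW.
have [n0 h] := bounded_stabilizes gw (set_mem Bw).
rewrite (limit_countE h) mul1r.
have -> : c * L + (c * L + ln (1 - c)) * X n0%:R w =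
  X n0%:R w * ln (1 - c) + c * (L * (1 + X n0%:R w)) by ring.
have -> : (fun n : nat => expmart c n%:R w) =
    (fun n : nat => expR (X n%:R w * ln (1 - c) + c * A n%:R w)).
  by apply/funext => n; rewrite (expmartE c01 sub gw (ler0n R n)).
apply: continuous_cvg; first exact: continuous_expR.
apply: cvgD; apply: cvgM; [|exact: cvg_cst|exact: cvg_cst|exact: compensator_cvg].
by apply: cvg_near_cst; exists n0 => // n /= /h ->.
Qed.

Lemma expectation_limit c : 0 < c < 1 -> c * L + ln (1 - c) < 0 ->
  (\int[P]_w (limit_expmart c w)%:E = 1)%E.
Proof.
move=> c01 sub.
case: (@dominated_convergence _ Omega R P setT measurableT
  (fun n w => (expmart c n%:R w)%:E) (fun w => (limit_expmart c w)%:E)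
  (fun=> (expR (c * L))%:E)); last 1 first.
- move=> _ _; have : (\int[P]_w (expmart c n%:R w)%:E)%E @[n --> \oo] --> (1 : \bar R)%E.
    have -> : (fun n : nat => \int[P]_w (expmart c n%:R w)%:E)%E = cst 1%E.
      apply/funext => n.
      exact: (expectation_expmart c01 sub).
    exact: cvg_cst.
  by move=> h1 h2; exact: (cvg_unique _ h2 h1).
- move=> n; apply/measurable_EFinP.
  exact: (measurable_expmart c (ler0n R n)).
- by apply/measurable_EFinP.
- apply: filterS ae_good => w gw _; apply: cvg_EFin; first by apply: nearW.
  exact: expmart_cvg.
- exact: finite_measure_integrable_cst.
- apply: aeW => w n _; have /andP[M0 MC] := expmart_bound c n%:R w.
  by rewrite abse_EFin lee_fin ger0_norm.
Qed.

(** The limit of the martingale at time +oo is the exponential of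
    [c L + (c L + ln (1 - c)) X_oo] on the event where [X] is bounded, and 0
    elsewhere; letting [c] decrease to [gamma] eliminates [X_oo]. *)
Lemma prob_bounded_event gamma : 0 <= gamma < 1 ->
  gamma * L + ln (1 - gamma) = 0 ->
  (forall c, gamma < c < 1 -> c * L + ln (1 - c) < 0) ->
  P (bounded_event X) = (expR (- (gamma * L)))%:E.
Proof.
move=> /andP[g0 g1] gL sub.
(* The denominators start at 2, so that every [c k] is strictly below 1. *)
pose c (k : nat) := gamma + (1 - gamma) * k.+2%:R^-1.
have g1' : 0 < 1 - gamma by rewrite subr_gt0.
have ck k : gamma < c k < 1.
  rewrite /c ltrDl mulr_gt0//= -ltrBrDl -[ltRHS]mulr1 ltr_pM2l//.
  by rewrite invf_lt1// ltr1n.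
have c01 k : 0 < c k < 1 by have /andP[h ->] := ck k; rewrite (le_lt_trans g0).
have cvg_c : c k @[k --> \oo] --> gamma.
  rewrite -[X in _ --> X]addr0 -[X in _ --> _ + X](mulr0 (1 - gamma)).
  apply: cvgD; first exact: cvg_cst.
  apply: cvgMr; have := @cvg_harmonic R; rewrite -(cvg_shiftn 1).
  by under eq_fun do rewrite /harmonic addn1.
have mB : measurable (bounded_event X) := measurable_bounded_event.
case: (@dominated_convergence _ Omega R P setT measurableT
  (fun k w => (limit_expmart (c k) w)%:E)
  (fun w => (expR (gamma * L) * \1_(bounded_event X) w)%:E)
  (fun=> (expR L)%:E)); last 1 first.
- move=> _ _; under eq_fun => k do rewrite (expectation_limit (c01 k) (sub _ (ck k))).
  have -> : (\int[P]_w (expR (gamma * L) * \1_(bounded_event X) w)%:E =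
      (expR (gamma * L))%:E * P (bounded_event X))%E.
    rewrite -[X in (_ * P X)%E]setIT -integral_indic// -integralZl//.
    exact: integrable_indic.
  move=> h; have h1 : (1 : \bar R)%E @[_ --> \oo] --> (1 : \bar R)%E by exact: cvg_cst.
  have : (1 = (expR (gamma * L))%:E * P (bounded_event X))%E.
    exact: (cvg_unique _ h1 h).
  rewrite -[P _](fineK (fin_num_measure P _ mB)).
  move=> [e]; congr EFin; rewrite expRN; apply: (mulfI (lt0r_neq0 (expR_gt0 (gamma * L)))).
  by rewrite -e mulfV// lt0r_neq0// expR_gt0.
- by move=> k; apply/measurable_EFinP; exact: measurable_limit_expmart.
- apply/measurable_EFinP; apply: measurable_funM => //; exact: measurable_indic.
- apply: aeW => w _; apply: cvg_EFin; first by apply: nearW.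
  rewrite /limit_expmart mulrC; apply: cvgM; first exact: cvg_cst.
  apply: continuous_cvg; first exact: continuous_expR.
  rewrite -[X in _ --> X]addr0 -[X in _ --> _ + X](mul0r (limit_count w)) -gL.
  have cL : c k * L @[k --> \oo] --> gamma * L by apply: cvgM => //; exact: cvg_cst.
  apply: cvgD => //; apply: cvgM; last exact: cvg_cst.
  apply: cvgD => //; apply: continuous_cvg; first exact: continuous_ln.
  by apply: cvgB => //; exact: cvg_cst.
- exact: finite_measure_integrable_cst.
- apply: filterS ae_good => w gw k _; rewrite /limit_expmart indicE.
  have [Bw|_] := boolP (w \in bounded_event X); last by rewrite mul0r abse0 lee_fin expR_ge0.
  have [n0 h] := bounded_stabilizes gw (set_mem Bw).
  rewrite mul1r abse_EFin lee_fin ger0_norm ?expR_ge0// ler_expR (limit_countE h).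
  have X0 := compensated_ge0 gw (ler0n R n0).
  have neg : (c k * L + ln (1 - c k)) * X n0%:R w <= 0.
    by rewrite mulr_le0_ge0// ltW// sub.
  have : c k * L <= L by rewrite -[leRHS]mul1r ler_wpM2r// ltW//; have /andP[] := c01 k.
  lra.
Qed.

End compensated_process.

(** * The root of [c L + ln (1 - c)] *)

Section extinction_rate.
Context {R : realType}.
Implicit Types (a b c L : R).

(** This is [1 + u < exp u] at [u = ln (y / z)], which is non-zero. *)
Lemma ln_lt_tangent (y z : R) : 0 < y -> 0 < z -> y != z -> ln y < ln z + (y - z) / z.
Proof.
move=> y0 z0 yz; rewrite -ltrBlDl -ln_div//.
have -> : (y - z) / z = y / z - 1 by rewrite mulrBl divff// lt0r_neq0.
have u0 : 0 < y / z by rewrite divr_gt0.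
rewrite ltrBrDl -[ltRHS]lnK// expR_gt1Dx//.
rewrite ln_eq0//; apply: contraNneq yz => h.
by rewrite -[y](divfK (lt0r_neq0 z0)) h mul1r.
Qed.

Lemma ln1B_lt c : 0 < c < 1 -> ln (1 - c) < - c.
Proof.
move=> /andP[c0 c1]; have := @ln_lt_tangent (1 - c) 1 _ ltr01.
rewrite ln1 divr1; have -> : 1 - c - 1 = - c by ring.
by rewrite add0r; apply; [lra|lra].
Qed.

(** Strict concavity of [ln], using its tangent at [1 - a]. *)
Lemma rate_decreasing L a b : 0 < a < b -> b < 1 ->
  0 <= b * L + ln (1 - b) -> 0 < a * L + ln (1 - a).
Proof.
move=> /andP[a0 ab] b1 gb; have b0 := lt_trans a0 ab; have a1 := lt_trans ab b1.
have ya : 0 < 1 - a by rewrite subr_gt0.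
have yb : 0 < 1 - b by rewrite subr_gt0.
have h1 : ln (1 - b) < ln (1 - a) + (1 - b - (1 - a)) / (1 - a).
  by apply: ln_lt_tangent => //; lra.
have h2 : 0 < ln (1 - a) + (1 - (1 - a)) / (1 - a).
  by rewrite -[ltLHS]ln1; apply: ln_lt_tangent => //; lra.
pose t := a / b; have t0 : 0 < t by rewrite divr_gt0.
have t1 : t < 1 by rewrite ltr_pdivrMr// mul1r.
have tb : t * b = a by rewrite divfK// lt0r_neq0.
(* [1 - a] is the mean of [1 - b] and 1 with weights [t] and [1 - t], so the linear terms of the two
   tangent bounds cancel. *)
have e : t * ((1 - b - (1 - a)) / (1 - a)) + (1 - t) * ((1 - (1 - a)) / (1 - a)) = 0.
  have -> : t * ((1 - b - (1 - a)) / (1 - a)) + (1 - t) * ((1 - (1 - a)) / (1 - a)) =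
    (a - t * b) / (1 - a) by field; rewrite lt0r_neq0.
  by rewrite tb subrr mul0r.
have := mulr_ge0 (ltW t0) gb; rewrite mulrDr mulrA tb => h3.
move: h1 h2; rewrite -(ltr_pM2l t0) -[0 < _](pmulr_rgt0 _ (_ : 0 < 1 - t)) ?subr_gt0//.
rewrite !mulrDr => h1 h2; lra.
Qed.

(** The intermediate value theorem gives a root; [rate_decreasing] makes the function positive
    before any root in []0, 1[] and negative after it, hence uniqueness. *)
Lemma extinction_rate_exists L : 1 < L -> exists gamma : R,
  [/\ 0 < gamma < 1, gamma * L + ln (1 - gamma) = 0,
    forall gamma' : R, 0 < gamma' < 1 -> gamma' * L + ln (1 - gamma') = 0 -> gamma' = gamma
  & forall c, gamma < c < 1 -> c * L + ln (1 - c) < 0].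
Proof.
move=> L1; have L0 : 0 < L by exact: lt_trans L1.
pose g c := c * L + ln (1 - c).
(* At [a] one has [1 - a > 1 / L], so the tangent bound [ln (1 - a) > - a / (1 - a)] makes [g a]
   positive; at [b] the value is [- L exp (- L)]. *)
pose a := (1 - L^-1) / 2; pose b := 1 - expR (- L).
have Li0 : 0 < L^-1 by rewrite invr_gt0.
have Li : L^-1 < 1 by rewrite invf_lt1.
have a0 : 0 < a by rewrite /a; lra.
have a1 : a < 1 by rewrite /a; lra.
have e0 := expR_gt0 (- L).
have e1 : expR (- L) < 1 by rewrite expR_lt1 oppr_lt0.
have b0 : 0 < b by rewrite /b; lra.
have b1 : b < 1 by rewrite /b; lra.
have ya : 0 < 1 - a by rewrite subr_gt0.
have ga : 0 < g a.
  have h : 0 < ln (1 - a) + (1 - (1 - a)) / (1 - a).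
    by rewrite -[ltLHS]ln1; apply: ln_lt_tangent => //; lra.
  apply: (lt_trans h); rewrite /g addrC ltrD2r.
  have -> : 1 - (1 - a) = a by ring.
  rewrite ltr_pM2l// -[ltRHS]invrK ltf_pV2//.
  by rewrite /a; lra.
have gb : g b < 0.
  rewrite /g /b; have -> : 1 - (1 - expR (- L)) = expR (- L) by ring.
  have eL : 0 < expR (- L) * L by rewrite mulr_gt0.
  by rewrite expRK; lra.
have ab : a <= b.
  rewrite leNgt; apply/negP => ba.
  have : 0 < g b by apply: (@rate_decreasing L b a); rewrite ?b0//; exact: ltW.
  by rewrite ltNge ltW.
have cg : {within `[a, b], continuous g}.
  apply: continuous_in_subspaceT => x /set_mem; rewrite /= in_itv/= => /andP[_ xb].
  have x1 : 0 < 1 - x by rewrite subr_gt0 (le_lt_trans xb).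
  rewrite /g; apply: cvgD; first by apply: cvgM; [exact: cvg_id|exact: cvg_cst].
  apply: continuous_cvg; first exact: continuous_ln.
  by apply: cvgB; [exact: cvg_cst|exact: cvg_id].
have [|gamma] := @IVT R g a b 0 ab cg.
  by rewrite ge_min le_max (ltW gb) (ltW ga) orbT.
rewrite in_itv/= => /andP[ag gb'] g0.
have gamma0 : 0 < gamma by exact: lt_le_trans ag.
have gamma1 : gamma < 1 by exact: le_lt_trans b1.
have above c : gamma < c < 1 -> g c < 0.
  move=> /andP[gc c1]; rewrite ltNge; apply/negP => gc0.
  have : 0 < g gamma by apply: (@rate_decreasing L gamma c) => //; rewrite gamma0.
  by rewrite g0 ltxx.
exists gamma; split => //; first by rewrite gamma0.
move=> c /andP[c0 c1] gc; apply/eqP; rewrite eq_le !leNgt; apply/andP; split; apply/negP => lt.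
  by have := above c; rewrite lt c1 /g gc ltxx => /(_ isT).
have : 0 < g c by apply: (@rate_decreasing L c gamma) => //; rewrite ?c0 -/(g _) ?g0.
by rewrite /g gc ltxx.
Qed.

End extinction_rate.

Lemma integral_increment_swap {R : realType} {dO} {Omega : measurableType dO}
    (P : {measure set Omega -> \bar R}) (E : set Omega) (x x' a a' : Omega -> R) :
  measurable E ->
  P.-integrable E (EFin \o x) -> P.-integrable E (EFin \o x') ->
  P.-integrable E (EFin \o a) -> P.-integrable E (EFin \o a') ->
  (\int[P]_(w in E) (x w - x' w)%:E = \int[P]_(w in E) (a w - a' w)%:E)%E ->
  (\int[P]_(w in E) (x w - a w)%:E = \int[P]_(w in E) (x' w - a' w)%:E)%E.
Proof.
move=> mE ix ix' ia ia'.
rewrite (integralB_EFin mE ix ix') (integralB_EFin mE ia ia').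
rewrite (integralB_EFin mE ix ia) (integralB_EFin mE ix' ia').
move: (integrable_fin_num mE ix) (integrable_fin_num mE ix').
move: (integrable_fin_num mE ia) (integrable_fin_num mE ia') => /=.
move=> /fineK <- /fineK <- /fineK <- /fineK <-.
by rewrite -!EFinB => -[e]; congr EFin; lra.
Qed.

(** * The Hawkes process on the lattice and its total count *)

Section hawkes_process.
Context {R : realType} {dO : measure_display} {Omega : measurableType dO}.
Variables (P : probability Omega R) (F : R -> set (set Omega)).
Variables (d : nat) (phi : R -> R).
Variable pi : 'rV[int]_d -> R.-ker Omega ~> (R * R)%type.
Variable Z : 'rV[int]_d -> R -> Omega -> R.
Hypothesis phi_ge0 : forall t : R, 0 <= t -> 0 <= phi t.
Hypothesis phi_locint : forall t : R, 0 <= t ->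
  lebesgue_measure.-integrable `[0, t] (EFin \o phi).
Hypotheses (hF : filtration F) (hpi : iid_poisson_measures P F pi).
Hypothesis hZ : impulsion_hawkes P F phi pi Z.

Local Notation Zd := 'rV[int]_d.
Let f := on_pos phi.
Let f_ge0 : forall v, 0 <= f v := on_pos_ge0 phi_ge0.
Let f_le0 : forall v, v <= 0 -> f v = 0 := @on_pos_le0 R phi.
Let f_meas : measurable_fun setT f := measurable_on_pos phi_locint.
Let f_int : forall t, (\int[lebesgue_measure]_(s in `]-oo, t]) (f s)%:E < +oo)%E
  := integral_on_pos_fin phi_ge0 phi_locint.
Let inv_deg : R := (2 * d + 1)%:R^-1.

Let inv_deg_ge0 : 0 <= inv_deg.
Proof. by rewrite invr_ge0. Qed.

Lemma measurable_fun_age (g : R -> R) X k : measurable_fun setT g -> adapted F X ->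
  measurable_fun [set: predictable_space F]
    (fun p : predictable_space F => (g (age (X ^~ p.1) k p.2))%:E).
Proof.
move=> mg aX; apply/measurable_EFinP.
exact: (measurableT_comp mg (measurable_age hF k aX)).
Qed.

Lemma measurable_excitation X : adapted F X ->
  measurable_fun [set: predictable_space F]
    (fun p : predictable_space F => excitation f (X ^~ p.1) p.2).
Proof.
move=> aX; apply: ge0_emeasurable_sum => [k p _ _|k _].
  by rewrite lee_fin.
exact: measurable_fun_age.
Qed.

Lemma measurable_primitive : measurable_fun setT (primitive f).
Proof.
apply: continuous_measurable_fun.
exact: (primitive_continuous f_ge0 f_meas f_int).
Qed.

Lemma measurable_cum_excitation X : adapted F X ->
  measurable_fun [set: predictable_space F]
    (fun p : predictable_space F => cum_excitation f (X ^~ p.1) p.2).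
Proof.
move=> aX; apply: ge0_emeasurable_sum => [k p _ _|k _].
  by rewrite lee_fin primitive_ge0.
by apply: measurable_fun_age => //; exact: measurable_primitive.
Qed.

Lemma measurable_fun_time (g : R -> R) : measurable_fun setT g ->
  (forall v, v <= 0 -> g v = g 0) ->
  measurable_fun [set: predictable_space F] (fun p : predictable_space F => g p.2).
Proof.
move=> mg g0.
have -> : (fun p : predictable_space F => g p.2) =
    g \o (fun p : predictable_space F => Num.max 0 p.2).
  by apply/funext => p /=; have [//|p0] := leP 0 p.2; rewrite g0// ltW.
exact: (measurableT_comp mg (measurable_time hF)).
Qed.

Let Zadapted j : adapted F (Z j).
Proof. by have [+ _ _] := hZ => /(_ j)[]. Qed.

(** A version of [intensity] built from ages, predictable without any assumption on paths; the two
    agree at positive times when the [Z j] are counting paths started at 0. *)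
Definition spatial_intensity (i : Zd) (p : Omega * R) : \bar R :=
  (\sum_(j <- neighbours i) inv_deg%:E *
     (excitation f (Z j ^~ p.1) p.2 + (f p.2 * (j == 0)%:R)%:E))%E.

Let summand_ge0 (j : Zd) p :
  (0 <= excitation f (Z j ^~ p.1) p.2 + (f p.2 * (j == 0)%:R)%:E)%E.
Proof. by rewrite adde_ge0 ?excitation_ge0// lee_fin mulr_ge0. Qed.

Lemma spatial_intensity_ge0 i p : (0 <= spatial_intensity i p)%E.
Proof. by apply: sume_ge0 => j _; rewrite mule_ge0// lee_fin. Qed.

Lemma measurable_spatial_intensity i :
  measurable_fun [set: predictable_space F]
    (spatial_intensity i : predictable_space F -> \bar R).
Proof.
apply: emeasurable_sum => j; apply: measurable_funeM; apply: emeasurable_funD.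
  exact: measurable_excitation.
apply/measurable_EFinP.
apply: (@measurable_fun_time (fun v => f v * (j == 0)%:R)).
  by apply: measurable_funM => //; exact: measurable_cst.
by move=> v v0; rewrite !f_le0.
Qed.

Lemma predictable_space_prod (H : Omega * R -> \bar R) :
  measurable_fun [set: predictable_space F] (H : predictable_space F -> \bar R) ->
  measurable_fun [set: Omega * measurableTypeR R] H.
Proof.
move=> mH _ U mU; have := mH measurableT U mU; rewrite !setTI.
exact: predictable_space_measurable.
Qed.

Lemma predictable_space_time_section (H : Omega * R -> \bar R) w :
  measurable_fun [set: predictable_space F] (H : predictable_space F -> \bar R) ->
  measurable_fun [set: measurableTypeR R] (fun u => H (w, u)).
Proof.
by move=> /predictable_space_prod mH; exact: (measurable_fun_pair2 w mH).
Qed.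

(** The almost sure facts from which all later pathwise statements follow deterministically. *)
Record good_path (w : Omega) : Prop := GoodPath {
  good_counting : forall i, counting_path (Z i ^~ w);
  good_thinning : forall i t, 0 <= t ->
    (Z i t w)%:E = pi i w (region 0 t (fun u => spatial_intensity i (w, u)));
  good_finite : forall t, 0 <= t -> (total_process Z t w < +oo)%E;
  good_atoms : forall i j t K, i != j -> 0 < t ->
    pi i w ([set t] `*` `[0, K]) = 0%E \/ pi j w ([set t] `*` `[0, K]) = 0%E }.

Let esum_edges (a : Zd -> \bar R) (i : Zd) : (forall j, 0 <= a j)%E ->
  (\esum_(j in [set j | @edge R d j i]) a j = \sum_(j <- neighbours i) a j)%E.
Proof.
move=> a0; rewrite esum_mkcond (esum_seq (uniq_neighbours i)).
- rewrite big_seq [RHS]big_seq; apply: eq_bigr => j.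
  by rewrite (mem_neighbours (R := R)) => ij; rewrite mem_set//= edge_sym.
- by move=> j; case: ifP.
- by move=> j; rewrite (mem_neighbours (R := R)) edge_sym => /negP ij; rewrite memNset.
Qed.

Lemma spatial_intensityE i u w : (forall j, counting_path (Z j ^~ w)) ->
  (forall j, Z j 0 w = 0) -> 0 < u ->
  intensity phi Z i u w = spatial_intensity i (w, u).
Proof.
move=> cZ Z0 u0; rewrite /intensity.
have past j : past_excitation phi (Z j) u w = excitation f (Z j ^~ w) u.
  by apply: excitation_past => // v v0; exact: on_pos_gt0.
under eq_esum do rewrite past -(on_pos_gt0 phi u0) -/f.
apply: esum_edges => j; apply: mule_ge0; last exact: (summand_ge0 j (w, u)).
by rewrite lee_fin inv_deg_ge0.
Qed.

(** The axis has zero area; cutting it at height [n] gives sets of finite measure 0, on which the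
    Poisson law is the Dirac mass at 0. *)
Let null_axis i : {ae P, forall w, pi i w ([set 0] `*` `[0, +oo[) = 0%E}.
Proof.
have [hp _] := hpi.
have mK n : measurable ([set 0] `*` `[0, n%:R] : set (R * R)).
  by apply: measurableX => //; exact: measurable_itv.
have nu0 n : planar_measure ([set 0] `*` `[0%R, n%:R] : set (R * R)) = 0%E.
  have := @planar_measureX R [set 0] `[0, n%:R]%classic (measurable_set1 _) (measurable_itv _).
  by move=> ->; rewrite lebesgue_measure_set1 mul0e.
have h : {ae P, forall w, forall n, pi i w ([set 0] `*` `[0, n%:R]) = 0%E}.
  apply: ae_foralln => n; apply: (negligibleS (A := [set w | pi i w ([set 0] `*` `[0, n%:R]) != 0%E])).
    by move=> w /= /eqP.
  have [[law _] _ _] := hp i.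
  have m0 : measurable [set w | pi i w ([set 0] `*` `[0, n%:R]) = 0%E].
    rewrite -[X in measurable X]setTI.
    exact: (measurable_kernel (pi i) _ (mK n) measurableT [set 0%E]).
  have -> : [set w | pi i w ([set 0] `*` `[0, n%:R]) != 0%E] =
      ~` [set w | pi i w ([set 0] `*` `[0, n%:R]) = 0%E].
    by apply/seteqP; split => w /= /eqP.
  apply/negligibleP; first exact: measurableC.
  apply: (etrans (probability_setC P m0)); rewrite (law _ (mK n) _ _ 0%N).
  - by rewrite [product_measure1 _ _ _](nu0 n)/= /poisson_prob ltxx diracE mem_set//= subee.
  - by move=> [u z] [/= ->]; rewrite in_itv/= => /andP[z0 _]; split;
      rewrite /= in_itv/= ?lexx ?z0.
  - by rewrite [X in (X < _)%E](nu0 n).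
apply: filterS h => w h; apply/negligibleP.
  by apply: measurableX => //; exact: measurable_itv.
have sub : ([set 0] `*` `[0, +oo[ : set (R * R)) `<=`
    \bigcup_n ([set 0] `*` `[0, n%:R]).
  move=> [u z] [/= ->]; rewrite in_itv/= andbT => z0.
  by exists (Num.bound z) => //; split => //=; rewrite in_itv/= z0 ltW// ltr_bound.
apply: (negligibleS sub).
by apply: negligible_bigcup => n; apply/negligibleP; [exact: mK|exact: h].
Qed.

Lemma ae_good_path : {ae P, forall w, good_path w}.
Proof.
have [cZ Efin sde] := hZ; have [hp _] := hpi.
have c_ae := ae_forall_countable (fun i => (cZ i).2).
have n_ae := ae_forall_countable null_axis.
have s_ae := ae_forall_countable sde.
have a_ae : {ae P, forall w, forall i j : Zd, i != j -> forall t K : R, 0 < t ->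
    pi i w ([set t] `*` `[0, K]) = 0%E \/ pi j w ([set t] `*` `[0, K]) = 0%E}.
  apply: ae_forall_countable => i; apply: ae_forall_countable => j.
  have [ij|ij] := boolP (i != j).
    by apply: filterS (no_simultaneous_atoms hF hpi ij) => w h _.
  exact: aeW.
have mZ i t : 0 <= t -> measurable_fun setT (Z i t).
  move=> t0 _ U mU; rewrite setTI; have [_ Fm _] := hF.
  by apply: (Fm t t0); exact: (@Zadapted i t t0 U mU).
(* Finite expectation gives almost sure finiteness at integer times; monotonicity of the paths then
   covers all times. *)
have f_ae : {ae P, forall w, forall n : nat, (total_process Z n%:R w < +oo)%E}.
  apply: ae_foralln => n.
  pose Y w := (\esum_(i in [set: Zd]) (Num.max 0 (Z i n%:R w))%:E)%E.
  have mY : measurable_fun setT Y.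
    apply: measurable_esum => [i w|i]; first by rewrite lee_fin le_max lexx.
    apply/measurable_EFinP; apply: measurable_maxr; first exact: measurable_cst.
    exact: mZ.
  have Y0 w : (0 <= Y w)%E by apply: esum_ge0 => i _; rewrite lee_fin le_max lexx.
  have EY : (\int[P]_w Y w < +oo)%E.
    rewrite /Y integral_esum//; last 2 first.
    - by move=> i w; rewrite lee_fin le_max lexx.
    - move=> i; apply/measurable_EFinP; apply: measurable_maxr; first exact: measurable_cst.
      exact: mZ.
    apply: le_lt_trans (Efin n%:R (ler0n R n)); apply: le_esum => i _.
    rewrite unlock le_eqVlt; apply/orP; left; apply/eqP.
    apply: ae_eq_integral => //.
    - apply/measurable_EFinP; apply: measurable_maxr; first exact: measurable_cst.
      exact: mZ.
    - by apply/measurable_EFinP; exact: mZ.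
    apply: filterS c_ae => w cw _; rewrite max_r//.
    by have [+ _ _ _] := cw i => /(_ n%:R (ler0n R n))[k ->]; rewrite ler0n.
  have Yint : P.-integrable setT Y.
    apply/integrableP; split => //.
    by under eq_integral do rewrite gee0_abs//.
  apply: filterS (integrable_ae measurableT Yint) => w /(_ I).
  by rewrite /total_process esum_max0 -/(Y w) ge0_fin_numE.
apply: filterS3 (filterI c_ae n_ae) s_ae (filterI a_ae f_ae) => w [cw nw] sw [aw fw].
(* At [t = 0] the defining integral runs over the axis at time 0, a null set. *)
have Z0 i : Z i 0 w = 0.
  apply: EFin_inj; rewrite (sw i 0 (lexx 0)) (eq_measure_integral mzero).
    exact: integral_measure_zero.
  move=> A mA AD; apply/eqP; rewrite eq_le measure_ge0 andbT.
  rewrite [leRHS](_ : _ = pi i w ([set 0] `*` `[0, +oo[)); last exact/esym/nw.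
  apply: le_measure; rewrite ?inE//.
    by apply: measurableX => //; exact: measurable_itv.
  by move=> q /AD; rewrite set_itv1.
split => //.
- move=> i t t0; rewrite (sw i t t0).
  apply: (@integral_thinning R (pi i w) (fun u => spatial_intensity i (w, u)) _
    (fun u => intensity phi Z i u w) t t0 _ (nw i)).
    exact: (predictable_space_time_section w (measurable_spatial_intensity i)).
  by move=> u u0; exact: spatial_intensityE.
- move=> t t0; apply: le_lt_trans (fw (Num.bound t)); apply: le_esum => i _.
  have [_ + _ _] := cw i => /(_ t (Num.bound t)%:R t0).
  by rewrite lee_fin; apply; rewrite ltW// ltr_bound.
- by move=> i j t K ij t0; exact: aw.
Qed.

Definition total_count (t : R) (w : Omega) : R := fine (total_process Z t w).

Lemma adapted_total : adapted F total_count.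
Proof.
move=> t t0; have [sF _ _] := hF.
have FE := @measurable_g_measurableTypeE Omega (F t) (sF t t0).
have mX : measurable_fun [set: g_sigma_algebraType (F t)]
    (total_count t : g_sigma_algebraType (F t) -> R).
  have -> : total_count t = fine \o (fun w => \esum_(i in [set: Zd]) (Num.max 0 (Z i t w))%:E)%E.
    by apply/funext => w; rewrite /total_count /total_process esum_max0.
  apply: (measurableT_comp (@fine_measurable R _ measurableT)).
  apply: measurable_esum => [i w|i]; first by rewrite lee_fin le_max lexx.
  apply/measurable_EFinP; apply: measurable_maxr; first exact: measurable_cst.
  by move=> _ U mU; rewrite setTI FE; exact: (@Zadapted i t t0 U mU).
by move=> U mU; have := mX measurableT U mU; rewrite setTI FE.
Qed.

Lemma good_zero w i : good_path w -> Z i 0 w = 0.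
Proof.
move=> [_ th _ _]; apply: EFin_inj; rewrite th//.
rewrite [region _ _ _](_ : _ = set0) ?measure0//.
rewrite -subset0 => -[u z] [/= /andP[u0 u0'] _ _].
by move: u0; rewrite ltNge u0'.
Qed.

Lemma good_total0 w : good_path w -> total_count 0 w = 0.
Proof.
move=> gw; have [cw _ fw _] := gw.
exact: (total_path0 cw (fun i => good_zero i gw) fw).
Qed.

(** A common jump of two sites would give each of their Poisson measures an atom on the vertical
    line at [t], below a common height, against [good_atoms]. *)
Lemma good_total_counting w : good_path w -> counting_path (total_count ^~ w).
Proof.
move=> gw; have [cw th fw aw] := gw.
suff : counting_path (total_path (fun i => Z i ^~ w)) by [].
apply: (counting_total_path cw fw) => t i j t0 ij.
apply: contrapT => /not_orP[/eqP ji /eqP jj].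
have mh k := predictable_space_time_section w (measurable_spatial_intensity k).
have [Ki iK] := thinning_jump_atom (mh i) (th i) (cw i) t0 ji.
have [Kj jK] := thinning_jump_atom (mh j) (th j) (cw j) t0 jj.
have mK K : measurable ([set t] `*` `[0, K] : set (R * R)).
  by apply: measurableX => //; exact: measurable_itv.
have le0 (m : {measure set (R * R)%type -> \bar R}) K K' : K <= K' ->
    m ([set t] `*` `[0, K']) = 0%E -> m ([set t] `*` `[0, K]) = 0%E.
  move=> KK' m0; apply/eqP; rewrite eq_le measure_ge0 andbT -m0.
  apply: le_measure; rewrite ?inE//.
  move=> [u z] [/= ->]; rewrite !in_itv/= => /andP[z0 zK]; split => //=.
  by rewrite z0 (le_trans zK).
have [/le0 e|/le0 e] := aw i j t (Num.max Ki Kj) ij t0.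
  by apply: iK; apply: e; rewrite le_max lexx.
by apply: jK; apply: e; rewrite le_max lexx orbT.
Qed.

Lemma good_total_seq w T : good_path w -> 0 <= T -> exists2 r : seq Zd, uniq r &
  forall t, 0 <= t <= T -> [/\ forall i, i \notin r -> Z i t w = 0,
    total_process Z t w = (total_count t w)%:E &
    total_count t w = \sum_(i <- r) Z i t w].
Proof.
by move=> gw T0; have [cw _ fw _] := gw; exact: (total_path_seq cw fw T0).
Qed.

Definition total_intensity (p : Omega * R) : \bar R :=
  ((f p.2)%:E + excitation f (total_count ^~ p.1) p.2)%E.

(** Each site has exactly [2 d + 1] neighbours, so its weights add up to 1. *)
Lemma sum_spatial_intensity w u : good_path w ->
  (\esum_(i in [set: Zd]) spatial_intensity i (w, u) = total_intensity (w, u))%E.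
Proof.
move=> gw.
pose b j := (excitation f (Z j ^~ w) u + (f u * (j == 0)%:R)%:E)%E.
have b0 j : (0 <= b j)%E by exact: (summand_ge0 j (w, u)).
have ib0 j : (0 <= inv_deg%:E * b j)%E by rewrite mule_ge0// lee_fin.
have step i : (spatial_intensity i (w, u) = \esum_(j in [set: Zd])
    (if j \in [set j | @edge R d j i] then inv_deg%:E * b j else 0))%E.
  by rewrite -esum_mkcond esum_edges.
under eq_esum do rewrite step.
rewrite esum_exchange; last by move=> i j; case: ifP.
have step2 j : (\esum_(i in [set: Zd])
    (if j \in [set j | @edge R d j i] then inv_deg%:E * b j else 0) = b j)%E.
  rewrite (esum_seq (uniq_neighbours j)); last 2 first.
  - by move=> i; case: ifP.
  - by move=> i; rewrite (mem_neighbours (R := R)) => /negP ji; rewrite memNset.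
  rewrite (eq_big_seq (fun=> inv_deg%:E * b j)%E); last first.
    by move=> i; rewrite (mem_neighbours (R := R)) => ji; rewrite mem_set.
  rewrite -ge0_sume_distrl => [|i _]; last by rewrite lee_fin.
  rewrite sumEFin big_const_seq count_predT size_neighbours iter_addr addr0.
  by rewrite -mulr_natr mulVf ?mul1e// pnatr_eq0 addn1.
under eq_esum do rewrite step2.
rewrite esumD; [|by move=> j _; exact: excitation_ge0|by move=> j _; rewrite lee_fin mulr_ge0].
rewrite addeC /total_intensity/=; congr (_ + _)%E.
  rewrite (@esum_seq _ _ _ [:: 0 : Zd])//.
  - by rewrite big_seq1 eqxx mulr1.
  - by move=> j; rewrite lee_fin mulr_ge0.
  - by move=> j; rewrite inE => /negbTE ->; rewrite mulr0.
pose T := Num.max 0 u; have T0 : 0 <= T by rewrite le_max lexx.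
have uT : u <= T by rewrite le_max lexx orbT.
have [r ur h] := good_total_seq gw T0; have [cw _ _ _] := gw.
rewrite (esum_seq ur).
- rewrite (@excitation_sum _ _ f_ge0 f_le0 f_meas _ r (total_count ^~ w) (fun j => Z j ^~ w) T)//.
  + exact: good_total_counting.
  + exact: good_total0.
  + by move=> j _; split; [exact: cw|exact: good_zero].
  + by move=> s sT; have [] := h s sT.
- by move=> j; exact: excitation_ge0.
- move=> j jr; rewrite /excitation eseries0// => k _ _.
  rewrite (@age_nojump _ _ k u T)//; first by rewrite f_le0.
  have [|zj _ _] := h T; first by rewrite T0 lexx.
  by rewrite zj// ltr0n.
Qed.

(** The explicit integral of [total_intensity], written with ages so as to be predictable
    everywhere; [fine] acts only off the good paths. *)
Definition compensating (t : R) (w : Omega) : R :=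
  primitive f t + fine (cum_excitation f (total_count ^~ w) t).

Lemma scalar_intensityE u w : good_path w -> 0 < u ->
  scalar_intensity phi total_count u w = total_intensity (w, u).
Proof.
move=> gw u0; rewrite /scalar_intensity /total_intensity/= /f on_pos_gt0//.
congr (_ + _)%E; apply: (excitation_past f_ge0 f_le0 f_meas) => //.
- exact: good_total_counting.
- exact: good_total0.
- by move=> v v0; exact: on_pos_gt0.
Qed.

Lemma compensating_path w T n : good_path w -> 0 <= T -> total_count T w = n%:R ->
  forall t, t <= T -> compensating t w =
    primitive f t + \sum_(a <- jumps_up_to (total_count ^~ w) n) primitive f (t - a).
Proof.
move=> gw T0 XT t tT; rewrite /compensating.
rewrite (cum_excitationE f_ge0 f_le0 f_int (good_total_counting gw) (good_total0 gw) T0 XT tT).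
by [].
Qed.

Let cum_fin w t : good_path w -> cum_excitation f (total_count ^~ w) t \is a fin_num.
Proof.
move=> gw; pose T := Num.max 0 t; have T0 : 0 <= T by rewrite le_max lexx.
have tT : t <= T by rewrite le_max lexx orbT.
have [xnat _ _ _] := good_total_counting gw; have [n XT] := xnat T T0.
by rewrite (cum_excitationE f_ge0 f_le0 f_int (good_total_counting gw) (good_total0 gw) T0 XT tT).
Qed.

Lemma measurable_total_intensity :
  measurable_fun [set: predictable_space F]
    (total_intensity : predictable_space F -> \bar R).
Proof.
apply: emeasurable_funD; last exact: (measurable_excitation adapted_total).
apply/measurable_EFinP; apply: measurable_fun_time => // v v0.
by rewrite !f_le0.
Qed.

Lemma total_intensity_ge0 p : (0 <= total_intensity p)%E.
Proof. by rewrite adde_ge0 ?excitation_ge0// lee_fin. Qed.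

Lemma compensating_integral w t : good_path w -> 0 <= t ->
  (\int[lebesgue_measure]_(u in `]-oo, t]) total_intensity (w, u))%E =
  (compensating t w)%:E.
Proof.
move=> gw t0; rewrite /total_intensity/= ge0_integralD//=.
- rewrite (integral_excitation f_ge0 f_le0 f_meas f_int (good_total_counting gw) (good_total0 gw) t0).
  by rewrite -(primitiveE f_ge0 f_int) /compensating EFinD (fineK (cum_fin t gw)).
- by move=> u _; rewrite lee_fin.
- by apply/measurable_EFinP; exact: measurable_funTS.
- by move=> u _; exact: excitation_ge0.
- apply: measurable_funTS.
  exact: (predictable_space_time_section w (measurable_excitation adapted_total)).
Qed.

Let EFin_sub_eq (a b : \bar R) (x y : R) :
  a = x%:E -> (a + b = y%:E)%E -> b = (y - x)%:E.
Proof.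
move=> ->; case: b => [b| |]//= [<-].
by rewrite addrAC subrr add0r.
Qed.

Lemma compensating_increment w s t : good_path w -> 0 <= s -> s <= t ->
  (\int[lebesgue_measure]_(u in `]s, t]) total_intensity (w, u))%E =
  (compensating t w - compensating s w)%:E.
Proof.
move=> gw s0 st; have t0 := le_trans s0 st.
have mi D : measurable_fun D (fun u : measurableTypeR R => total_intensity (w, u)).
  apply: measurable_funTS.
  exact: (predictable_space_time_section w measurable_total_intensity).
have := compensating_integral gw t0.
have -> : (`]-oo, t]%classic : set R) = `]-oo, s] `|` `]s, t].
  by rewrite -itv_bndbnd_setU// bnd_simp.
rewrite ge0_integral_setU//=; last 2 first.
- by move=> u _; exact: total_intensity_ge0.
- apply/disj_setPS => r [/=]; rewrite !in_itv/= => rs /andP[].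
  by rewrite ltNge rs.
exact: EFin_sub_eq (compensating_integral gw s0).
Qed.

Local Notation X := total_count.
Local Notation A := compensating.

Let Zmeas i t : 0 <= t -> measurable_fun setT (Z i t).
Proof. exact: (adapted_measurable hF (Zadapted i)). Qed.

Lemma measurable_compensating :
  measurable_fun [set: predictable_space F]
    (fun p : predictable_space F => A p.2 p.1).
Proof.
apply: measurable_funD.
  apply: (measurable_fun_time (measurable_primitive)) => v v0.
  by rewrite !primitive_le0.
apply: (measurableT_comp (@fine_measurable R _ measurableT)).
exact: (measurable_cum_excitation (adapted_total)).
Qed.

Lemma adapted_compensating : adapted F A.
Proof.
move=> t t0 U mU.
apply: (@predictable_space_section _ _ _ F hF [set p | U (A p.2 p.1)] t t0).
by have := measurable_compensating measurableT mU; rewrite setTI.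
Qed.

(** The positive part is inactive on good paths and makes the sum over sites a sum of non-negative
    functions at every [w], as Tonelli's theorem asks. *)
Let increment i s t w := Num.max 0 (Z i t w - Z i s w).

Let increment_meas i s t : 0 <= s -> s <= t ->
  measurable_fun setT (fun w => (increment i s t w)%:E).
Proof.
move=> s0 st; apply/measurable_EFinP; apply: measurable_maxr; first exact: measurable_cst.
by apply: measurable_funB; apply: Zmeas => //; exact: le_trans st.
Qed.

Let increment_total s t w : 0 <= s -> s <= t -> good_path w ->
  (\esum_(i in [set: Zd]) (increment i s t w)%:E = (X t w - X s w)%:E)%E.
Proof.
move=> s0 st gw; have t0 := le_trans s0 st.
have [r ur h] := good_total_seq gw t0.
have [|zt _ ->] := h t; first by rewrite t0 lexx.
have [|zs _ ->] := h s; first by rewrite s0.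
rewrite (esum_seq ur).
- rewrite sumEFin -sumrB; congr EFin; apply: eq_bigr => i _.
  rewrite /increment max_r// subr_ge0; have [ci _ _ _] := gw.
  by have [_ + _ _] := ci i; exact.
- by move=> i; rewrite lee_fin le_max lexx.
- by move=> i ir; rewrite /increment zt// zs// subrr maxxx.
Qed.

Let Hint (H : Omega * R -> \bar R) s t w :=
  (\int[lebesgue_measure]_(u in `]s, t]) H (w, u))%E.

Let Hint_meas H s t :
  measurable_fun [set: predictable_space F] (H : predictable_space F -> \bar R) ->
  (forall p, 0 <= H p)%E -> measurable_fun setT (Hint H s t).
Proof.
move=> /predictable_space_prod mH H0.
pose D := (`]s, t]%classic : set (measurableTypeR R)).
pose H' p := (H p * (\1_D p.2)%:E)%E.
have -> : Hint H s t = fubini_F lebesgue_measure H'.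
  apply/funext => w; rewrite /Hint integral_mkcond epatch_indic.
  by [].
apply: measurable_fun_fubini_tonelli_F.
  apply: emeasurable_funM => //; apply/measurable_EFinP.
  apply: measurableT_comp; last exact: measurable_snd.
  by apply: measurable_indic; exact: measurable_itv.
by move=> p; rewrite mule_ge0// lee_fin.
Qed.

(** The compensation formula is applied at each site. The exchanges of the sum over sites with the
    expectation and the time integral concern non-negative terms, and integrability of [A] is
    afterwards drawn from this identity. *)
Lemma total_martingale s t E : 0 <= s -> s <= t -> F s E ->
  (\int[P]_(w in E) (X t w - X s w)%:E = \int[P]_(w in E) (A t w - A s w)%:E)%E.
Proof.
move=> s0 st FE; have t0 := le_trans s0 st.
have mE : measurable E by have [_ Fm _] := hF; exact: (Fm s s0).
have gp := ae_good_path.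
have [hp _] := hpi.
have inc0 i w : (0 <= (increment i s t w)%:E)%E by rewrite lee_fin le_max lexx.
have inc_m i := increment_meas i s0 st.
have mH i := measurable_spatial_intensity i.
have H0 i p := spatial_intensity_ge0 i p.
have mdiff Y : adapted F Y -> measurable_fun E (fun w => (Y t w - Y s w)%:E).
  move=> aY; apply: measurable_funTS; apply/measurable_EFinP.
  by apply: measurable_funB; exact: (adapted_measurable hF).
have HI0 i w : (0 <= Hint (spatial_intensity i) s t w)%E.
  by apply: integral_ge0 => u _; exact: H0.
transitivity (\int[P]_(w in E) (\esum_(i in [set: Zd]) (increment i s t w)%:E))%E.
  apply: ae_eq_integral => //.
  - exact: (mdiff X (adapted_total)).
  - by apply: measurable_funTS; exact: measurable_esum.
  - by apply: filterS gp => w gw _; rewrite increment_total.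
rewrite integral_esum//; last by move=> i; exact: measurable_funTS.
transitivity (\esum_(i in [set: Zd])
    \int[P]_(w in E) (Hint (spatial_intensity i) s t w))%E.
  apply: eq_esum => i _.
  apply: (compensation hF (hp i) (T := t)) => //; first by rewrite s0.
  apply: filterS gp => w gw.
  rewrite (thinning_increment _ (good_thinning gw i) s0 st).
    rewrite /increment max_r// subr_ge0; have [ci _ _ _] := gw.
    by have [_ + _ _] := ci i; exact.
  exact: (predictable_space_time_section w (mH i)).
rewrite -integral_esum//; last by move=> i; apply: measurable_funTS; exact: Hint_meas.
apply: ae_eq_integral => //.
- apply: measurable_funTS; apply: measurable_esum => // i; exact: Hint_meas.
- exact: (mdiff A adapted_compensating).
apply: filterS gp => w gw _.
rewrite -(compensating_increment gw s0 st).
rewrite /Hint -integral_esum//.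
- apply: eq_integral => u _; exact: (sum_spatial_intensity u gw).
- by move=> i; apply: measurable_funTS; exact: (predictable_space_time_section w (mH i)).
Qed.

Lemma integrable_total t : 0 <= t -> P.-integrable setT (EFin \o X t).
Proof.
move=> t0; have [cZ Efin _] := hZ.
have gp := ae_good_path.
have mX := adapted_measurable hF (adapted_total) t0.
apply/integrableP; split; first exact/measurable_EFinP.
have inc0 i w : (0 <= (increment i 0 t w)%:E)%E by rewrite lee_fin le_max lexx.
have inc_m i := increment_meas i (lexx 0) t0.
rewrite (_ : (\int[P]_w _)%E =
    (\int[P]_w (\esum_(i in [set: Zd]) (increment i 0 t w)%:E))%E); last first.
  apply: ae_eq_integral => //.
  - by apply/measurable_EFinP; exact: measurableT_comp.
  - exact: measurable_esum.
  apply: filterS gp => w gw _; rewrite increment_total//=.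
  rewrite (good_total0 gw) subr0 ger0_norm//.
  by have [+ _ _ _] := good_total_counting gw => /(_ t t0)[k ->].
rewrite integral_esum//; apply: le_lt_trans (Efin t t0); apply: le_esum => i _.
rewrite unlock le_eqVlt; apply/orP; left; apply/eqP; apply: ae_eq_integral => //.
  by apply/measurable_EFinP; exact: Zmeas.
apply: filterS gp => w gw _; rewrite /increment (good_zero i gw) subr0 max_r//.
by have [ci _ _ _] := gw; have [+ _ _ _] := ci i => /(_ t t0)[k ->].
Qed.

Local Notation Phi := (primitive f).

Let Phi_nd : forall s t, s <= t -> Phi s <= Phi t := primitive_nd f_ge0 f_meas f_int.
Let Phi_le0 : forall v, v <= 0 -> Phi v = 0 := primitive_le0 f_ge0 f_le0 f_int.
Let Phi_uc := primitive_unif_continuous f_ge0 f_meas f_int.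
Let gp := ae_good_path.
Let aX : adapted F X := adapted_total.
Let aA : adapted F A := adapted_compensating.

Lemma good_compensated w : good_path w ->
  compensated_path Phi (X ^~ w) (A ^~ w).
Proof.
move=> gw; split.
- exact: (good_total_counting gw).
- exact: (good_total0 gw).
- by move=> T n T0 xT t tT; exact: (compensating_path gw T0 xT tT).
Qed.

(** Near [t] the compensator is a finite sum of translates of the continuous [Phi]; the horizon lies
    strictly beyond [t] so that one jump list serves a neighbourhood. *)
Let compensating_continuous w : good_path w -> continuous (A ^~ w).
Proof.
move=> gw t; pose T := Num.max 0 t + 1.
have T0 : 0 <= T by rewrite addr_ge0// le_max lexx.
have tT : t < T by rewrite ltr_pwDr// le_max lexx orbT.
have [+ _ _ _] := compensated_counting (good_compensated gw) => /(_ T T0)[n xT].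
have E := compensatedE (good_compensated gw) T0 xT.
rewrite /continuous_at E ?(ltW tT)//.
pose g s := Phi s + \sum_(a <- jumps_up_to (X ^~ w) n) Phi (s - a).
have cPhi := primitive_continuous f_ge0 f_meas f_int.
have cg : g s @[s --> t] --> g t.
  apply: cvgD; first exact: cPhi.
  apply: (@cvg_seq_sum R R R (nbhs t) _ _ (fun a s => Phi (s - a))
    (fun a => Phi (t - a))) => a.
  apply: continuous_cvg; first exact: cPhi.
  by apply: cvgB; [exact: cvg_id|exact: cvg_cst].
apply: cvg_trans cg; apply: near_eq_cvg; near=> s; rewrite E//.
by apply: ltW; near: s; exact: lt_nbhsl.
Unshelve. all: by end_near. Qed.

Let compensating_cadlag w : good_path w -> cadlag (A ^~ w).
Proof.
move=> gw; have cA := compensating_continuous gw; split=> t _.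
  by apply: cvg_at_right_filter; exact: cA.
by apply/cvg_ex; exists (A t w); apply: cvg_at_left_filter; exact: cA.
Qed.

Let compensated := fun t w => X t w - A t w.

Let adapted_compensated : adapted F compensated.
Proof.
apply: measurable_fun_adapted => // t t0; apply: measurable_funB.
- exact: (adapted_measurable_fun hF aX t0).
- exact: (adapted_measurable_fun hF aA t0).
Qed.

Let compensated_cadlag : {ae P, forall w, cadlag (compensated ^~ w)}.
Proof.
apply: filterS gp => w gw.
have [Ar Al] := compensating_cadlag gw.
have [_ _ [Xr Xl] _] := compensated_counting (good_compensated gw).
split=> t t0; first by apply: cvgB; [exact: Xr|exact: Ar].
by apply: is_cvgB; [exact: Xl|exact: Al].
Qed.

Let ae_compensated : {ae P, forall w, compensated_path Phi (X ^~ w) (A ^~ w)}.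
Proof. by apply: filterS gp => w gw; exact: good_compensated. Qed.

Let intX : forall t, 0 <= t -> P.-integrable setT (EFin \o X t) :=
  integrable_total.
Let XA := total_martingale.

Let intA t : 0 <= t -> P.-integrable setT (EFin \o A t).
Proof.
exact: (integrable_compensator hF aA Phi_nd Phi_le0 ae_compensated intX XA).
Qed.

Let martingale_compensated : martingale P F compensated.
Proof.
split; [exact: adapted_compensated|exact: compensated_cadlag| |].
  move=> t t0; rewrite (_ : _ \o _ = (fun w => (X t w)%:E - (A t w)%:E)%E)//.
  by apply: integrableB => //; [exact: intX|exact: intA].
move=> s t s0 st E FE; have t0 := le_trans s0 st.
have mE : measurable E by have [_ Fm _] := hF; exact: (Fm s s0).
have iX u : 0 <= u -> P.-integrable E (EFin \o X u).
  by move=> u0; exact: (integrableS measurableT mE (@subsetT _ E) (intX u0)).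
have iA u : 0 <= u -> P.-integrable E (EFin \o A u).
  by move=> u0; exact: (integrableS measurableT mE (@subsetT _ E) (intA u0)).
exact: (integral_increment_swap mE (iX t t0) (iX s s0) (iA t t0) (iA s s0) (XA s0 st FE)).
Qed.

Lemma hawkes_total : scalar_impulsion_hawkes P F phi X.
Proof.
have [sF Fm _] := hF.
split; first split; first exact: aX.
  by apply: filterS gp => w gw; exact: (compensated_counting (good_compensated gw)).
exists A; split.
- move=> U mU.
  have -> : [set p : Omega * R | 0 <= p.2 /\ U (A p.2 p.1)] =
      [set p | U (A p.2 p.1)] `&` [set: Omega] `*` `[0, +oo[.
    apply/seteqP; split => [[w t] /= [t0 Ut]|[w t] /= [Ut [_]]].
      by split => //; split => //; rewrite /= in_itv/= t0.
    by rewrite in_itv/= andbT.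
  apply: predictable_space_predictable => //.
  have := measurable_compensating measurableT mU.
  by rewrite setTI.
- apply: filterS gp => w gw; split.
  + exact: (compensator_zero Phi_le0 (good_compensated gw)).
  + exact: (compensator_nd Phi_nd (good_compensated gw)).
  + exact: compensating_cadlag.
- split; [exact: adapted_compensated|exact: compensated_cadlag|].
  (* [X - A] is a genuine martingale, so all localising times can be infinite. *)
  exists (fun=> cst +oo%E); split.
  + move=> n; split => [w|t t0]; first exact: leey.
    have -> : [set w : Omega | (cst +oo w <= t%:E)%E] = set0.
      by apply/seteqP; split => w //=; rewrite leye_eq.
    by have [] := sF t t0.
  + by apply: aeW => w; split => //; exact: cvg_cst.
  + move=> n; suff -> : stopped (fun t w => X t w - A t w) (cst +oo%E) = compensated by [].
    apply/funext => t; apply/funext => w; rewrite /stopped /= min_l ?leey//.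
- apply: filterS gp => w gw t t0.
  have mtot D : measurable_fun D (fun u : measurableTypeR R => total_intensity (w, u)).
    apply: measurable_funTS.
    exact: (predictable_space_time_section w (measurable_total_intensity)).
  (* The two intensities are known to agree only at positive times; the integral ignores the point
     0. *)
  have eqt : {in (`]0, t]%classic : set R),
      (fun u => total_intensity (w, u)) =1 scalar_intensity phi X ^~ w}.
    move=> u /set_mem; rewrite /= in_itv/= => /andP[u0 _].
    by rewrite (scalar_intensityE gw u0).
  rewrite -integral_itv_obnd_cbnd; last by apply: (eq_measurable_fun _ eqt); exact: mtot.
  transitivity (\int[lebesgue_measure]_(u in `]0%R, t]) total_intensity (w, u))%E.
    by apply: eq_integral => u uI; rewrite -(eqt u uI).
  have := compensating_increment gw (lexx 0) t0.
  by rewrite (compensator_zero Phi_le0 (good_compensated gw)) subr0.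
Qed.

Lemma ae_total_finite :
  {ae P, forall w, forall t : R, 0 <= t -> (total_process Z t w < +oo)%E}.
Proof. by apply: filterS gp => w gw t t0; exact: (good_finite gw t0). Qed.

(** By monotonicity the limit along real times is decided at integer times: an unbounded path tends
    to [+oo], a bounded one is eventually constant. *)
Lemma extinction_boundedE w : good_path w -> extinction Z w <-> bounded_event X w.
Proof.
move=> gw; have cw := good_compensated gw.
have totE t : 0 <= t -> total_process Z t w = (X t w)%:E.
  move=> t0; have [r ur h] := good_total_seq gw t0.
  by have [|_ -> _] := h t; first by rewrite t0 lexx.
split => [|Bw].
  rewrite /extinction/=; apply: contraPP => nB.
  suff -> : lim (total_process Z t w @[t --> +oo%R]) = +oo%E by rewrite ltxx.
  apply: cvg_lim => //; apply/cvgeyPge => y.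
  have [n0 hn0] : exists n0 : nat, y < X n0%:R w.
    apply: contrapT => nex; apply: nB; exists (Num.bound `|y|) => // n _ /=.
    rewrite (@le_trans _ _ y)//; first by rewrite leNgt; apply/negP => lt; apply: nex; exists n.
    by rewrite (le_trans (ler_norm y))// ltW// archi_boundP.
  near=> t; have n0t : n0%:R <= t by near: t; exact: nbhs_pinfty_ge.
  rewrite totE ?(le_trans _ n0t)// lee_fin (le_trans (ltW hn0))//.
  exact: (compensated_nd cw).
have [n0 h] := bounded_stabilizes cw Bw; rewrite /extinction/=.
suff -> : lim (total_process Z t w @[t --> +oo%R]) = (X n0%:R w)%:E by rewrite ltry.
apply: cvg_lim => //; apply: cvg_near_cst; near=> t.
have n0t : n0%:R <= t by near: t; exact: nbhs_pinfty_ge.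
have t0 : 0 <= t by rewrite (le_trans _ n0t).
rewrite totE//; apply/eqP; rewrite eqe eq_le; apply/andP; split; last first.
  exact: (compensated_nd cw).
pose m := Num.bound t; have tm : t < m%:R := archi_boundP t0.
have n0m : (n0 <= m)%N by rewrite -(ler_nat R) (le_trans n0t)// ltW.
by rewrite -(h m n0m); apply: (compensated_nd cw) => //; exact: ltW.
Unshelve. all: by end_near. Qed.

Lemma has_prob_extinction : has_prob P (extinction Z) (P (bounded_event X)).
Proof.
exists (bounded_event X); split => //.
  exact: (measurable_bounded_event hF aX).
apply: negligibleS gp => w + gw; have [h1 h2] := extinction_boundedE gw.
by case=> -[a b]; apply: b; [exact: h1|exact: h2].
Qed.

Let Lambda := (\int[lebesgue_measure]_(s in `[0%R, +oo[) (phi s)%:E)%E.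

Lemma cvg_primitive : (Phi n%:R)%:E @[n --> \oo] --> Lambda.
Proof.
have mf D : measurable_fun D (fun s : R => (f s)%:E).
  by apply/measurable_EFinP; exact: measurable_funTS.
have -> : Lambda = (\int[lebesgue_measure]_(s in \bigcup_n `]0%R, n%:R]%classic) (f s)%:E)%E.
  have -> : \bigcup_n `]0%R, n%:R]%classic = `]0, +oo[%classic :> set R.
    apply/seteqP; split => [v [n _]|v] /=; rewrite !in_itv/= ?andbT.
      by move=> /andP[].
    by move=> v0; exists (Num.bound v) => //=; rewrite in_itv/= v0 ltW// archi_boundP// ltW.
  have eqf : {in (`]0, +oo[%classic : set R), (fun s => (f s)%:E) =1 (fun s => (phi s)%:E)}.
    by move=> u /set_mem; rewrite /= in_itv/= andbT => u0; rewrite /f on_pos_gt0.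
  rewrite /Lambda -integral_itv_obnd_cbnd; last by apply: (eq_measurable_fun _ eqf); exact: mf.
  by apply: eq_integral => u uI; rewrite -(eqf u uI).
have -> : (fun n : nat => (Phi n%:R)%:E) =
    (fun n : nat => \int[lebesgue_measure]_(s in `]0%R, n%:R]) (f s)%:E)%E.
  apply/funext => n; rewrite -(primitiveB f_ge0 f_meas f_int (ler0n R n)).
  by rewrite (Phi_le0 (lexx 0)) subr0.
apply: ge0_nondecreasing_set_cvg_integral => //.
- move=> n m nm; apply/subsetPset => v /=; rewrite !in_itv/= => /andP[-> vn]/=.
  by rewrite (le_trans vn)// ler_nat.
- by move=> n; exact: mf.
- by move=> n v _; rewrite lee_fin.
Qed.

Lemma prob_extinction_infinite : Lambda = +oo%E -> P (bounded_event X) = 0%E.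
Proof.
move=> Loo; apply: (bounded_event_null hF aX aA Phi_nd Phi_le0 Phi_uc ae_compensated intX XA).
move=> y; have := cvg_primitive; rewrite Loo => /cvgeyPge/(_ y)[n _ h].
by exists n; have := h n (leqnn n); rewrite /= lee_fin.
Qed.

Lemma prob_extinction_finite L gamma : Lambda = L%:E -> 0 <= gamma < 1 ->
  gamma * L + ln (1 - gamma) = 0 ->
  (forall c, gamma < c < 1 -> c * L + ln (1 - c) < 0) ->
  P (bounded_event X) = (expR (- (gamma * L)))%:E.
Proof.
move=> LL g01 gL sub.
have cvgL : Phi n%:R @[n --> \oo] --> L.
  by have := cvg_primitive; rewrite LL => /fine_cvgP[].
have PhiL t : Phi t <= L.
  pose n := Num.bound `|t|.
  apply: (@le_trans _ _ (Phi n%:R)).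
    by apply: Phi_nd; rewrite (le_trans (ler_norm t))// ltW// archi_boundP.
  rewrite -(cvg_lim _ cvgL)//; apply: (nondecreasing_cvgn_le (u_ := fun n => Phi n%:R)).
    by move=> i j ij; apply: Phi_nd; rewrite ler_nat.
  by apply/cvg_ex; exists L.
exact: (prob_bounded_event hF aX aA Phi_nd Phi_le0 Phi_uc ae_compensated intX XA PhiL cvgL g01 gL sub).
Qed.

End hawkes_process.

Theorem theorem19 (R : realType) (dO : measure_display)
  (Omega : measurableType dO) (P : probability Omega R)
  (F : R -> set (set Omega)) (d : nat) (phi : R -> R)
  (pi : 'rV[int]_d -> R.-ker Omega ~> (R * R)%type)
  (Z : 'rV[int]_d -> R -> Omega -> R)
  (hd : (1 <= d)%N)
  (phi_ge0 : forall t : R, 0 <= t -> 0 <= phi t)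
  (phi_locint : forall t : R, 0 <= t ->
     lebesgue_measure.-integrable `[0, t] (EFin \o phi))
  (hF : filtration F)
  (hpi : iid_poisson_measures P F pi)
  (hZ : impulsion_hawkes P F phi pi Z) :
  let Lambda := (\int[lebesgue_measure]_(s in `[0%R, +oo[) (phi s)%:E)%E in
  ({ae P, forall w, forall t : R, 0 <= t -> (total_process Z t w < +oo)%E} /\
   scalar_impulsion_hawkes P F phi (fun t w => fine (total_process Z t w))) /\
  [/\ Lambda = +oo%E -> has_prob P (extinction Z) 0%E,
      forall L : R, Lambda = L%:E -> 1 < L ->
        exists gamma : R,
          [/\ 0 < gamma < 1,
              gamma * L + ln (1 - gamma) = 0,
              forall gamma' : R, 0 < gamma' < 1 ->
                gamma' * L + ln (1 - gamma') = 0 -> gamma' = gamma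
            & has_prob P (extinction Z) (expR (- (gamma * L)))%:E]
    & (0 < Lambda <= 1)%E -> has_prob P (extinction Z) 1%E].
Proof.
move=> Lambda.
have hprob := has_prob_extinction phi_ge0 phi_locint hF hpi hZ.
split; first split.
- exact: (ae_total_finite phi_ge0 phi_locint hF hpi hZ).
- exact: (hawkes_total phi_ge0 phi_locint hF hpi hZ).
split.
- by move=> Loo; rewrite -(prob_extinction_infinite phi_ge0 phi_locint hF hpi hZ Loo).
- move=> L LL L1; have [gamma [g01 gL uniq sub]] := extinction_rate_exists L1.
  exists gamma; split => //.
  rewrite -(prob_extinction_finite phi_ge0 phi_locint hF hpi hZ LL _ gL sub)//.
  by have /andP[/ltW -> ->] := g01.
- move=> /andP[L0 L1].
  have LfinE : (fine Lambda)%:E = Lambda.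
    by rewrite fineK// ge0_fin_numE ?(ltW L0)// (le_lt_trans L1)// ltry.
  have L1' : fine Lambda <= 1 by rewrite -lee_fin LfinE.
  have -> : 1%E = (expR (- (0 * fine Lambda)))%:E by rewrite mul0r oppr0 expR0.
  rewrite -(prob_extinction_finite phi_ge0 phi_locint hF hpi hZ (esym LfinE) (gamma := 0))//.
  + by rewrite lexx ltr01.
  + by rewrite mul0r add0r subr0 ln1.
  (* Here [c L <= c < - ln (1 - c)], which includes the critical case [L = 1]. *)
  + move=> c c01; have := ln1B_lt c01; have /andP[c0 _] := c01.
    have : c * fine Lambda <= c by rewrite -[leRHS]mulr1 ler_pM2l.
    by move=> h1 h2; lra.
Qed.
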